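(* Let $m,q,n\ge0$ be integers. Let $S_1=\begin{pmatrix}K_1&L_1\\ L_1^t&M_1\end{pmatrix}$ be a symmetric complex $(m+q)\times(m+q)$ matrix ($K_1$ of size $m\times m$, $M_1$ of size $q\times q$) and $S_2=\begin{pmatrix}K_2&L_2\\ L_2^t&M_2\end{pmatrix}$ a symmetric complex $(q+n)\times(q+n)$ matrix ($K_2$ of size $q\times q$, $M_2$ of size $n\times n$), both with strictly negative definite real part. Then the composition $Q_3=\mathcal Q_{q,m}[S_1]\,\mathcal Q_{n,q}[S_2]:G(\mathbb R^{2n})\to G(\mathbb R^{2m})$ is the operator $$(Q_3g)(x,\xi)=\frac1{(2\pi)^{3(n+m)/4}}\int_{[0,2\pi]^{2n}}\mathcal K_3(x,\xi;y,\eta)\,g(y,\eta)\,dy\,d\eta,$$ where $$\mathcal K_3(x,\xi;y,\eta)=\lambda(S_1,S_2)\sum_{k\in\mathbb Z^m}\sum_{l\in\mathbb Z^n}\exp\Bigl\{\tfrac12\begin{pmatrix}x^t+2\pi k^t&y^t+2\pi l^t\end{pmatrix}S_3\begin{pmatrix}x+2\pi k\\ y+2\pi l\end{pmatrix}\Bigr\}e^{ik\cdot\xi}e^{-il\cdot\eta},$$ $$\lambda(S_1,S_2)=\det\bigl[(-M_1-K_2)^{-1/2}\bigr],$$ $$S_3=\begin{pmatrix}K_1-L_1(M_1+K_2)^{-1}L_1^t&-L_1(M_1+K_2)^{-1}L_2\\ -L_2^t(M_1+K_2)^{-1}L_1^t&M_2-L_2^t(M_1+K_2)^{-1}L_2\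end{pmatrix}.$$
   Context: **Space $G(\mathbb R^{2n})$.** It consists of $g\in C^\infty(\mathbb R^{2n})$, written $g(x,\xi)$ with $x,\xi\in\mathbb R^n$, such that for all $k\in\mathbb Z^n$ $$g(x,\xi+2\pi k)=g(x,\xi),\qquad g(x+2\pi k,\xi)=e^{-ik\cdot\xi}g(x,\xi).$$ **Operators with theta-kernels.** For a symmetric complex $(m+n)\times(m+n)$ matrix $S$ with strictly negative definite real part, and $x,\xi\in\mathbb R^m$, $y,\eta\in\mathbb R^n$, put $b(x,y)=\frac12\begin{pmatrix}x^t&y^t\end{pmatrix}S\begin{pmatrix}x\\ y\end{pmatrix}$ and $$\mathcal K_{n,m}[S](x,\xi;y,\eta)=\sum_{k\in\mathbb Z^m}\sum_{l\in\mathbb Z^n}\exp\{b(x+2\pi k,y+2\pi l)\}\,e^{ik\cdot\xi}e^{-il\cdot\eta}.$$ The operator $\mathcal Q_{n,m}[S]:G(\mathbb R^{2n})\to G(\mathbb R^{2m})$ is $$(\mathcal Q_{n,m}[S]g)(x,\xi)=\frac1{(2\pi)^{3(n+m)/4}}\int_{[0,2\pi]^{2n}}\mathcal K_{n,m}[S](x,\xi;y,\eta)\,g(y,\eta)\,dy\,d\eta .$$ **Determinant convention.** If $T$ is a symmetric complex matrix with $\operatorname{Re}T$ positive definite, all its eigenvalues $\lambda_j$ (with algebraic multiplicity) satisfy $\operatorname{Re}\lambda_j>0$, and $\det(T^{-1/2}):=\prod_j\lambda_j^{-1/2}$ with the principal branch. *)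

(* Defs.v *)
From HB Require Import structures.
From mathcomp Require Import all_boot all_order all_algebra.
From mathcomp Require Import complex.
From mathcomp Require Import all_classical all_reals all_analysis.

Set Implicit Arguments.
Unset Strict Implicit.
Unset Printing Implicit Defensive.

Import Order.TTheory GRing.Theory Num.Theory.
Import numFieldNormedType.Exports.

Local Open Scope classical_set_scope.
Local Open Scope ring_scope.
Local Open Scope complex_scope.

Section LebesgueMeasure.
Variable R : realType.
Local Notation tupleR n := (n.-tuple (measurableTypeR R)).

Definition tcons n (p : measurableTypeR R * tupleR n) : tupleR n.+1 :=
  [tuple of p.1 :: p.2].

Lemma measurable_tcons n : measurable_fun [set: _] (@tcons n).
Proof. exact: measurable_cons. Qed.

(* Lebesgue measure on R^n, by iterating the binary product measure. *)
Fixpoint lebesgue_tuple n : set (tupleR n) -> \bar R :=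
  match n with
  | 0 => dirac [tuple]
  | n'.+1 => pushforward (lebesgue_measure \x @lebesgue_tuple n')%E (@tcons n')
  end.

Section step.
Variables (n : nat) (mu : {sigma_finite_measure set (tupleR n) -> \bar R}).

Let pw : set (tupleR n.+1) -> \bar R :=
  pushforward (lebesgue_measure \x mu)%E (@tcons n).

Let pw0 : pw set0 = 0%E.
Proof. by rewrite /pw /pushforward preimage_set0 measure0. Qed.

Let pw_ge0 A : (0 <= pw A)%E.
Proof. by rewrite /pw /pushforward; exact: measure_ge0. Qed.

Let pw_sigma_additive : semi_sigma_additive pw.
Proof.
have mc := @measurable_tcons n.
move=> F mF tF mUF; rewrite /pw /pushforward preimage_bigcup.
apply: measure_semi_sigma_additive.
- by move=> i; rewrite -[X in measurable X]setTI; exact: mc.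
- apply/trivIsetP => /= i j _ _ ij; rewrite -preimage_setI.
  by move/trivIsetP : tF => /(_ _ _ _ _ ij) ->//; rewrite preimage_set0.
- by rewrite -preimage_bigcup -[X in measurable X]setTI; exact: mc.
Qed.

HB.instance Definition _ := isMeasure.Build _ _ _ pw
  pw0 pw_ge0 pw_sigma_additive.

Let pw_sigma_finite : sigma_finite setT pw.
Proof.
have /sigma_finiteP[F [FT ndF mF]] := sigma_finiteT (@lebesgue_measure R).
have /sigma_finiteP[G [GT ndG mG]] := sigma_finiteT mu.
pose th (t : tupleR n.+1) := tnth t ord0.
pose tl (t : tupleR n.+1) : tupleR n := [tuple of behead t].
have FGE i : @tcons n @^-1` (th @^-1` F i `&` tl @^-1` G i) = F i `*` G i.
  apply/seteqP; split => -[x t] /=.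
  + rewrite /th /tl => -[Fx Gt]; split => //=.
    by move: Gt; congr (G i _); exact: val_inj.
  + move=> [/= Fx Gt]; split; rewrite /th /tl //=.
    by move: Gt; congr (G i _); exact: val_inj.
exists (fun i => th @^-1` F i `&` tl @^-1` G i).
  apply/esym; rewrite -subTset => t _.
  have [i _ Fi] : (\bigcup_i F i) (th t) by rewrite -FT.
  have [j _ Gj] : (\bigcup_i G i) (tl t) by rewrite -GT.
  exists (maxn i j) => //; split => /=.
  + by move: Fi; exact/subsetPset/ndF/leq_maxl.
  + by move: Gj; exact/subsetPset/ndG/leq_maxr.
move=> i; have [mFi Fioo] := mF i; have [mGi Gioo] := mG i; split.
  apply: measurableI; rewrite -[X in measurable X]setTI.
  + exact: (measurable_tnth ord0).
  + exact: measurable_behead.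
rewrite /pw /pushforward FGE product_measure1E//.
by rewrite lte_mul_pinfty// ge0_fin_numE.
Qed.

HB.instance Definition _ := Measure_isSigmaFinite.Build _ _ _ pw
  pw_sigma_finite.

Definition lebesgue_tuple_step :
  {sigma_finite_measure set (tupleR n.+1) -> \bar R} := pw.

End step.

Lemma lebesgue_tupleP n :
  exists mu : {sigma_finite_measure set (tupleR n) -> \bar R},
    @lebesgue_tuple n = mu.
Proof.
elim: n => [|n [mu /= ->]]; first by exists (dirac [tuple]).
by exists (lebesgue_tuple_step mu).
Qed.

Section instances.
Variable n : nat.
Let mu := @lebesgue_tuple n.

Let mu0 : mu set0 = 0%E.
Proof. by rewrite /mu; have [nu ->] := lebesgue_tupleP n; exact: measure0. Qed.

Let mu_ge0 A : (0 <= mu A)%E.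
Proof. by rewrite /mu; have [nu ->] := lebesgue_tupleP n; exact: measure_ge0. Qed.

Let mu_sigma_additive : semi_sigma_additive mu.
Proof.
rewrite /mu; have [nu ->] := lebesgue_tupleP n.
exact: measure_semi_sigma_additive.
Qed.

Let mu_sigma_finite : sigma_finite setT mu.
Proof.
by rewrite /mu; have [nu ->] := lebesgue_tupleP n; exact: sigma_finiteT.
Qed.

HB.instance Definition _ := isMeasure.Build _ _ _ (@lebesgue_tuple n)
  mu0 mu_ge0 mu_sigma_additive.
HB.instance Definition _ := Measure_isSigmaFinite.Build _ _ _
  (@lebesgue_tuple n) mu_sigma_finite.

End instances.
End LebesgueMeasure.
Arguments lebesgue_tuple {R} n.

Section ThetaKernels.
Variable R : realType.
Local Notation C := R[i].
Local Notation phase n := ('cV[R]_n * 'cV[R]_n)%type.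

Definition cexp (z : C) : C :=
  (expR (complex.Re z) * cos (complex.Im z)) +i*
  (expR (complex.Re z) * sin (complex.Im z)).

(* Sum of an absolutely convergent family of reals; esum is only meaningful for
   nonnegative terms. *)
Definition rsum (T : choiceType) (f : T -> R) : R :=
  fine (\esum_(t in [set: T]) (Num.max (f t) 0)%:E) -
  fine (\esum_(t in [set: T]) (Num.max (- f t) 0)%:E).

Definition csum (T : choiceType) (f : T -> C) : C :=
  rsum (fun t => complex.Re (f t)) +i* rsum (fun t => complex.Im (f t)).

Definition cintegral d (T : measurableType d) (mu : {measure set T -> \bar R})
    (D : set T) (f : T -> C) : C :=
  (\int[mu]_(t in D) complex.Re (f t)) +i* (\int[mu]_(t in D) complex.Im (f t)).

Definition col_of_tuple n (t : n.-tuple R) : 'cV[R]_n := \col_i tnth t i.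

Definition cube n : set (n.-tuple (measurableTypeR R)) :=
  [set t | forall i, 0 <= (tnth t i : R) <= 2 * pi].

(* Integral over (y, eta) in [0, 2 pi]^n x [0, 2 pi]^n. *)
Definition phase_integral n (f : phase n -> C) : C :=
  cintegral (lebesgue_tuple n \x lebesgue_tuple n)%E (@cube n `*` @cube n)
    (fun t => f (col_of_tuple t.1, col_of_tuple t.2)).

(* C^k in terms of iterated directional derivatives; on the finite-dimensional
   spaces used below this is the usual notion. *)
Fixpoint Ck (V : normedModType R) (k : nat) (f : V -> R) : Prop :=
  continuous f /\
  if k is k'.+1 then
    forall v : V, (forall x, derivable f x v) /\ Ck k' ('D_v f)
  else True.

Definition smooth (V : normedModType R) (f : V -> C) : Prop :=
  forall k, Ck k (fun x => complex.Re (f x)) /\ Ck k (fun x => complex.Im (f x)).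

Definition intv n (k : 'cV[int]_n) : 'cV[R]_n := map_mx intr k.
Definition period n (k : 'cV[int]_n) : 'cV[R]_n := (2 * pi) *: intv k.

Definition dotv n (x y : 'cV[R]_n) : R := (x^T *m y) 0 0.

Definition theta_space n : set (phase n -> C) :=
  [set g | smooth g /\
    forall (k : 'cV[int]_n) (x xi : 'cV[R]_n),
      g (x, xi + period k) = g (x, xi) /\
      g (x + period k, xi) = cexp (0 +i* - dotv (intv k) xi) * g (x, xi)].

Definition half_form n (S : 'M[C]_n) (z : 'cV[R]_n) : C :=
  let zc := map_mx (real_complex R) z in (zc^T *m S *m zc) 0 0 / 2.

Definition theta_kernel m n (S : 'M[C]_(m + n)) (p : phase m) (w : phase n) : C :=
  csum (fun k : 'cV[int]_m => csum (fun l : 'cV[int]_n =>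
    cexp (half_form S (col_mx (p.1 + period k) (w.1 + period l))) *
    cexp (0 +i* dotv (intv k) p.2) *
    cexp (0 +i* - dotv (intv l) w.2))).

Definition kernel_op m n (K : phase m -> phase n -> C) (g : phase n -> C) :
    phase m -> C :=
  fun p => (((2 * pi) `^ (3 * (n + m)%:R / 4))^-1)%:C *
           phase_integral (fun w => K p w * g w).

Definition Qop m n (S : 'M[C]_(m + n)) : (phase n -> C) -> (phase m -> C) :=
  kernel_op (theta_kernel S).

Definition symmetric_mx n (S : 'M[C]_n) : Prop := S^T = S.

Definition Re_negdef n (S : 'M[C]_n) : Prop :=
  forall v : 'cV[R]_n, v != 0 ->
    (v^T *m map_mx (@complex.Re R) S *m v) 0 0 < 0.

Definition eigenvalues n (T : 'M[C]_n) : seq C :=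
  sval (closed_field_poly_normal (char_poly T)).

(* sqrtc is the principal square root: its values have nonnegative real part. *)
Definition det_invsqrt n (T : 'M[C]_n) : C :=
  \prod_(a <- eigenvalues T) (sqrtc a)^-1.

End ThetaKernels.

(* Main.v *)
From HB Require Import structures.
Require Import Defs.
From mathcomp Require Import all_boot all_order all_algebra.
From mathcomp Require Import complex.
From mathcomp Require Import all_classical all_reals all_analysis.
From mathcomp Require Import measurable_realfun lebesgue_integral_under.
From mathcomp Require Import ring lra.
Import Order.TTheory GRing.Theory Num.Theory.
Import numFieldNormedType.Exports Normc.
Local Open Scope classical_set_scope.
Local Open Scope ring_scope.
Local Open Scope complex_scope.

(** Everything reduces to one Gaussian integral and to the Zak transform.

    A theta kernel is the double periodization of the Gaussian kernel
    [ekernel S x y = cexp (half_form S (col_mx x y))]. All sums converge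
    absolutely, so the sum over [l] can be unfolded against the integral over
    the cube and the sum over [k] taken outside ([kernel_op_transform]):
    [Qop S g] becomes the lattice sum [theta_transform] of the integrals
    [source_integral], in which the bare kernel [ekernel S] is integrated against
    a source carrying [g]. In this form [Qop S g] is smooth, because the
    derivatives of the summands in the parameters are polynomials times Gaussians
    ([smooth_theta_transform]), and it is quasi-periodic, because a period only
    shifts the summation index ([theta_space_transform]).

    The same formula says that [Qop S2 g] is the Zak transform of a rapidly
    decreasing function [H]. Pairing a Zak transform with a periodized kernel over
    the cube gives back, up to a power of [2 pi], the integral of the kernel
    against [H] over the whole space: orthogonality of the characters selects the
    diagonal of the double sum, and the translates of the cube tile the space
    ([zak_pairing]). Hence [Qop S1 (Qop S2 g)] is the lattice sum attached to the
    kernel [x, y |-> integral of ekernel S1 x z * ekernel S2 z y dz].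

    As a function of [z] this integrand is a Gaussian with matrix
    [A = - M1 - K2] and linear term [L1^T x + L2 y]. Completing the square gives
    [ekernel S3 x y] times [(2 pi)^(q/2)] times a square root of [1 / det A]
    ([ekernel_convolution]); the powers of [2 pi] match the normalizations of the
    operators ([op_cst_mul]).

    Two points need an argument of their own. The square root is the product of
    the principal roots of the eigenvalues: the Gaussian integral, computed up to
    sign by successive Schur complements ([cint_ggauss]), and the product of
    principal roots are both continuous along a path from the identity to [A] on
    which the real part stays positive definite, and they agree at the identity
    ([cint_ggauss_det]). Second, the lattice sum attached to [S3] has to converge;
    the required Gaussian bound on [ekernel S3] is read off from the convolution
    integral itself ([gauss_dominated_composition]). *)

Set Implicit Arguments.
Unset Strict Implicit.
Unset Printing Implicit Defensive.

(** * Complex numbers and the complex exponential *)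

Section complex_facts.
Context {R : realType}.
Local Notation C := R[i].
Implicit Types z w : C.

Lemma ReD z w : complex.Re (z + w) = complex.Re z + complex.Re w.
Proof. by case: z w => [a b] [c d]. Qed.

Lemma ImD z w : complex.Im (z + w) = complex.Im z + complex.Im w.
Proof. by case: z w => [a b] [c d]. Qed.

Lemma ReN z : complex.Re (- z) = - complex.Re z.
Proof. by case: z => [a b]. Qed.

Lemma ReM z w : complex.Re (z * w) =
  complex.Re z * complex.Re w - complex.Im z * complex.Im w.
Proof. by case: z w => [a b] [c d]. Qed.

Lemma ImM z w : complex.Im (z * w) =
  complex.Re z * complex.Im w + complex.Im z * complex.Re w.
Proof. by case: z w => [a b] [c d]. Qed.

Lemma Re_sum (I : Type) (r : seq I) (P : pred I) (F : I -> C) :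
  complex.Re (\sum_(i <- r | P i) F i) = \sum_(i <- r | P i) complex.Re (F i).
Proof. by apply: (big_morph (@complex.Re R)) => // x y; exact: ReD. Qed.

Lemma Im_sum (I : Type) (r : seq I) (P : pred I) (F : I -> C) :
  complex.Im (\sum_(i <- r | P i) F i) = \sum_(i <- r | P i) complex.Im (F i).
Proof. by apply: (big_morph (@complex.Im R)) => // x y; exact: ImD. Qed.

Lemma complex_eqP z w :
  complex.Re z = complex.Re w -> complex.Im z = complex.Im w -> z = w.
Proof. by case: z w => [a b] [c d] /= -> ->. Qed.

Lemma cexpD z w : cexp (z + w) = cexp z * cexp w.
Proof.
by apply: complex_eqP; rewrite ?ReM ?ImM/= ReD ImD expRD ?cosD ?sinD; ring.
Qed.

Lemma cexp0 : cexp (0 : C) = 1.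
Proof. by rewrite /cexp /= expR0 cos0 sin0 mul1r mulr0. Qed.

Lemma normc_ge0 z : 0 <= normc z.
Proof. by case: z => a b; exact: sqrtr_ge0. Qed.

Lemma normc_cexp z : normc (cexp z) = expR (complex.Re z).
Proof.
by rewrite /cexp /= !exprMn -mulrDr cos2Dsin2 mulr1 sqrtr_sqr ger0_norm// expR_ge0.
Qed.

Lemma cexp_neq0 z : cexp z != 0.
Proof.
apply/eqP => z0; have := normc_cexp z; rewrite z0 normc0 => /eqP.
by rewrite eq_sym gt_eqF// expR_gt0.
Qed.

Lemma normc_Re z : `|complex.Re z| <= normc z.
Proof.
by case: z => a b /=; rewrite -sqrtr_sqr ler_wsqrtr// lerDl sqr_ge0.
Qed.

Lemma normc_Im z : `|complex.Im z| <= normc z.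
Proof.
by case: z => a b /=; rewrite -sqrtr_sqr ler_wsqrtr// lerDr sqr_ge0.
Qed.

Lemma normc_le z : normc z <= `|complex.Re z| + `|complex.Im z|.
Proof.
case: z => a b /=.
rewrite -[leRHS]ger0_norm ?addr_ge0// -sqrtr_sqr ler_wsqrtr//.
rewrite sqrrD !real_normK ?num_real// addrAC lerDl mulrn_wge0// mulr_ge0.
Qed.

Lemma normc_real (x : R) : normc x%:C = `|x|.
Proof. by rewrite /= expr0n addr0 sqrtr_sqr. Qed.

End complex_facts.

(** * Complex-valued measurable functions and their integrals *)

Section measurable_complex.
Context d (T : measurableType d) (R : realType).
Local Notation C := R[i].

Definition cmeas (f : T -> C) :=
  measurable_fun setT (fun t => complex.Re (f t)) /\
  measurable_fun setT (fun t => complex.Im (f t)).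

Lemma cmeas_cst (c : C) : cmeas (fun=> c).
Proof. by split; exact: measurable_cst. Qed.

Lemma cmeasD f g : cmeas f -> cmeas g -> cmeas (fun t => f t + g t).
Proof.
move=> [f1 f2] [g1 g2]; split.
- by under eq_fun do rewrite ReD; exact: measurable_funD.
- by under eq_fun do rewrite ImD; exact: measurable_funD.
Qed.

Lemma cmeasM f g : cmeas f -> cmeas g -> cmeas (fun t => f t * g t).
Proof.
move=> [f1 f2] [g1 g2]; split.
- under eq_fun do rewrite ReM.
  by apply: measurable_funB; exact: measurable_funM.
- under eq_fun do rewrite ImM.
  by apply: measurable_funD; exact: measurable_funM.
Qed.

Lemma cmeas_sum (I : Type) (r : seq I) (F : I -> T -> C) :
  (forall i, cmeas (F i)) -> cmeas (fun t => \sum_(i <- r) F i t).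
Proof.
move=> mF; elim: r => [|i r ih].
  by under eq_fun do rewrite big_nil; exact: cmeas_cst.
by under eq_fun do rewrite big_cons; exact: cmeasD.
Qed.

Lemma cmeas_real (a : T -> R) :
  measurable_fun setT a -> cmeas (fun t => (a t)%:C).
Proof. by move=> ma; split => //=; exact: measurable_cst. Qed.

Lemma cmeas_imag (a : T -> R) :
  measurable_fun setT a -> cmeas (fun t => 0 +i* a t).
Proof. by move=> ma; split => //=; exact: measurable_cst. Qed.

Lemma cmeas_cexp f : cmeas f -> cmeas (fun t => cexp (f t)).
Proof.
move=> [f1 f2].
have mc : measurable_fun setT (@cos R).
  by apply: continuous_measurable_fun; exact: continuous_cos.
have ms : measurable_fun setT (@sin R).
  by apply: continuous_measurable_fun; exact: continuous_sin.
have me := measurableT_comp (@measurable_expR R) f1.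
split => /=; apply: measurable_funM => //; exact: (measurableT_comp _ f2).
Qed.

Lemma measurable_normc f : cmeas f -> measurable_fun setT (fun t => normc (f t)).
Proof.
move=> [f1 f2].
have -> : (fun t => normc (f t)) =
    (fun t => Num.sqrt (complex.Re (f t) ^+ 2 + complex.Im (f t) ^+ 2)).
  by apply/funext => t; case: (f t).
have ms : measurable_fun setT (@Num.sqrt R).
  by apply: continuous_measurable_fun; exact: sqrt_continuous.
by apply: (measurableT_comp ms); apply: measurable_funD; exact: measurable_funX.
Qed.

End measurable_complex.

Lemma cmeas_comp d1 d2 (T1 : measurableType d1) (T2 : measurableType d2)
    (R : realType) (f : T2 -> R[i]) (g : T1 -> T2) :
  cmeas f -> measurable_fun setT g -> cmeas (fun t => f (g t)).
Proof.
move=> [f1 f2] mg; split.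
- exact: (measurableT_comp f1 mg).
- exact: (measurableT_comp f2 mg).
Qed.

Section complex_integral.
Context d (T : measurableType d) (R : realType).
Variable mu : {measure set T -> \bar R}.
Local Notation C := R[i].

Definition rintegrable (a : T -> R) := mu.-integrable setT (EFin \o a).

Definition cintegrable (f : T -> C) :=
  cmeas f /\ rintegrable (fun t => normc (f t)).

Definition cint (f : T -> C) : C := cintegral mu setT f.

Lemma Re_cint f : complex.Re (cint f) = \int[mu]_t complex.Re (f t).
Proof. by []. Qed.

Lemma Im_cint f : complex.Im (cint f) = \int[mu]_t complex.Im (f t).
Proof. by []. Qed.

Lemma rintegrable_le (f a : T -> R) : measurable_fun setT f ->
  (forall t, `|f t| <= a t) -> rintegrable a -> rintegrable f.
Proof.
move=> mf fa; apply: le_integrable => //; first exact/measurable_EFinP.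
by move=> t _ /=; rewrite lee_fin (le_trans (fa t))// ler_norm.
Qed.

Lemma rintegrable_meas a : rintegrable a -> measurable_fun setT a.
Proof. by move=> /measurable_int/measurable_EFinP. Qed.

Lemma rintegrableZ c a : rintegrable a -> rintegrable (fun t => c * a t).
Proof.
move=> ia; apply: (eq_integrable _ (fun t => c%:E * (EFin \o a) t)%E) => //.
exact: integrableZl.
Qed.

Lemma rintegrable_normc (f : T -> C) : cintegrable f ->
  rintegrable (fun t => complex.Re (f t)) /\
  rintegrable (fun t => complex.Im (f t)).
Proof.
move=> [[f1 f2] fi]; split; apply: rintegrable_le fi => // t.
- exact: normc_Re.
- exact: normc_Im.
Qed.

Lemma cintegrable_le f a : cmeas f -> (forall t, normc (f t) <= a t) ->
  rintegrable a -> cintegrable f.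
Proof.
move=> mf fa ia; split => //; apply: rintegrable_le ia => //.
  exact: measurable_normc.
by move=> t; rewrite ger0_norm ?normc_ge0.
Qed.

Lemma cintegrableZ c f : cintegrable f -> cintegrable (fun t => c * f t).
Proof.
move=> [mf fi]; apply: (cintegrable_le (a := fun t => normc c * normc (f t))).
- by apply: cmeasM => //; exact: cmeas_cst.
- by move=> t; rewrite normcM.
- exact: rintegrableZ.
Qed.

Lemma cintD f g : cintegrable f -> cintegrable g ->
  cint (fun t => f t + g t) = cint f + cint g.
Proof.
move=> /rintegrable_normc[f1 f2] /rintegrable_normc[g1 g2].
apply: complex_eqP; rewrite ?ReD ?ImD /=.
- by under eq_Rintegral do rewrite ReD; exact: RintegralD.
- by under eq_Rintegral do rewrite ImD; exact: RintegralD.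
Qed.

Lemma cintZ c f : cintegrable f -> cint (fun t => c * f t) = c * cint f.
Proof.
move=> /rintegrable_normc[f1 f2]; apply: complex_eqP; rewrite ?ReM ?ImM /=.
- under eq_Rintegral do rewrite ReM.
  rewrite RintegralB//; [|exact: rintegrableZ..].
  by congr (_ - _); rewrite RintegralZl.
- under eq_Rintegral do rewrite ImM.
  rewrite RintegralD//; [|exact: rintegrableZ..].
  by congr (_ + _); rewrite RintegralZl.
Qed.

Lemma eq_cint f g : f =1 g -> cint f = cint g.
Proof. by move=> /funext ->. Qed.

Lemma normc_cint f a : cmeas f -> (forall t, normc (f t) <= a t) ->
  rintegrable a -> normc (cint f) <= 2 * (\int[mu]_t a t).
Proof.
move=> mf fa ia; have fi := cintegrable_le mf fa ia.
have [f1 f2] := rintegrable_normc fi.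
rewrite (le_trans (normc_le _))// mulr2n mulrDl mul1r.
have na g : rintegrable g -> (forall t, `|g t| <= a t) ->
    `|\int[mu]_t g t| <= \int[mu]_t a t.
  move=> ig ga; apply: (le_trans (le_normr_Rintegral _ ig)) => //.
  apply: le_Rintegral => //.
  by apply: rintegrable_le ia => [|t]; rewrite ?normr_id//;
    apply: measurableT_comp => //; exact: rintegrable_meas.
by apply: lerD; apply: na => // t; apply: le_trans (fa t);
  [exact: normc_Re|exact: normc_Im].
Qed.

End complex_integral.

Section tensor_fubini.
Context d1 d2 (T1 : measurableType d1) (T2 : measurableType d2) (R : realType).
Variables (mu : {sigma_finite_measure set T1 -> \bar R})
          (nu : {sigma_finite_measure set T2 -> \bar R}).
Variables (a : T1 -> R) (b : T2 -> R).
Hypothesis ia : rintegrable mu a.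
Hypothesis ib : rintegrable nu b.
Hypothesis a0 : forall x, 0 <= a x.
Hypothesis b0 : forall x, 0 <= b x.

(** All exchanges of sums and integrals in the sequel rest on this domination,
    by a product of integrable functions of separate variables. *)
Lemma rintegrable_tensor :
  rintegrable (mu \x nu)%E (fun z => a z.1 * b z.2).
Proof.
have ma := rintegrable_meas ia; have mb := rintegrable_meas ib.
apply/integrable12ltyP.
  apply/measurable_EFinP/measurable_funM; exact: measurableT_comp.
under eq_integral => x _.
  under eq_integral => y _ do rewrite /= ger0_norm ?mulr_ge0// EFinM.
  rewrite ge0_integralZl//=; last 3 first.
  - exact/measurable_EFinP.
  - by move=> y _; rewrite lee_fin.
  - by rewrite lee_fin.
  over.
have Ib : (\int[nu]_y (b y)%:E)%E \is a fin_num by exact: integrable_fin_num.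
rewrite -(fineK Ib); under eq_integral do rewrite muleC.
rewrite ge0_integralZl//=; last 3 first.
- exact/measurable_EFinP.
- by move=> y _; rewrite lee_fin.
- by rewrite lee_fin fine_ge0// integral_ge0// => y _; rewrite lee_fin.
have Ia : (\int[mu]_y (a y)%:E)%E \is a fin_num by exact: integrable_fin_num.
by rewrite -(fineK Ia) -EFinM ltry.
Qed.

Section real.
Variable f : T1 * T2 -> R.
Hypothesis mf : measurable_fun setT f.
Hypothesis fab : forall x y, `|f (x, y)| <= a x * b y.

Let if_ : rintegrable (mu \x nu)%E f.
Proof.
by apply: rintegrable_le rintegrable_tensor => // -[x y]; exact: fab.
Qed.

Let ifx x : rintegrable nu (fun y => f (x, y)).
Proof.
apply: (rintegrable_le (a := fun y => a x * b y)) => [|y|].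
- exact: (measurableT_comp mf (measurable_pair1 x)).
- exact: fab.
- exact: rintegrableZ.
Qed.

Let ify y : rintegrable mu (fun x => f (x, y)).
Proof.
apply: (rintegrable_le (a := fun x => b y * a x)) => [|x|].
- exact: (measurableT_comp mf (measurable_pair2 y)).
- by rewrite mulrC; exact: fab.
- exact: rintegrableZ.
Qed.

Let Rint_fubini1 :
  \int[(mu \x nu)%E]_z f z = \int[mu]_x (\int[nu]_y f (x, y)).
Proof.
rewrite /Rintegral -(integral12_prod_meas1 if_); congr fine.
by apply: eq_integral => x _; rewrite fineK//; exact: (integrable_fin_num _ (ifx x)).
Qed.

Let Rint_fubini2 :
  \int[(mu \x nu)%E]_z f z = \int[nu]_y (\int[mu]_x f (x, y)).
Proof.
rewrite /Rintegral -(integral21_prod_meas1 if_); congr fine.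
by apply: eq_integral => y _; rewrite fineK//; exact: (integrable_fin_num _ (ify y)).
Qed.

Let meas1 : measurable_fun setT (fun x => \int[nu]_y f (x, y)).
Proof.
exact: (measurableT_comp _ (measurable_fubini_F if_)).
Qed.

Let meas2 : measurable_fun setT (fun y => \int[mu]_x f (x, y)).
Proof.
exact: (measurableT_comp _ (measurable_fubini_G if_)).
Qed.

Lemma real_tensor_fubini :
  [/\ \int[(mu \x nu)%E]_z f z = \int[mu]_x (\int[nu]_y f (x, y)),
      \int[(mu \x nu)%E]_z f z = \int[nu]_y (\int[mu]_x f (x, y)),
      measurable_fun setT (fun x => \int[nu]_y f (x, y)) &
      measurable_fun setT (fun y => \int[mu]_x f (x, y))].
Proof. by split. Qed.

End real.

Variable f : T1 * T2 -> R[i].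
Hypothesis mf : cmeas f.
Hypothesis fab : forall x y, normc (f (x, y)) <= a x * b y.

Let reP x y : `|complex.Re (f (x, y))| <= a x * b y.
Proof. exact: (le_trans (normc_Re _)). Qed.

Let imP x y : `|complex.Im (f (x, y))| <= a x * b y.
Proof. exact: (le_trans (normc_Im _)). Qed.

Lemma cint_fubini1 :
  cint (mu \x nu)%E f = cint mu (fun x => cint nu (fun y => f (x, y))).
Proof.
have [m1 m2] := mf.
have [e1 _ _ _] := real_tensor_fubini m1 reP.
have [e2 _ _ _] := real_tensor_fubini m2 imP.
exact: complex_eqP.
Qed.

Lemma cint_fubini2 :
  cint (mu \x nu)%E f = cint nu (fun y => cint mu (fun x => f (x, y))).
Proof.
have [m1 m2] := mf.
have [_ e1 _ _] := real_tensor_fubini m1 reP.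
have [_ e2 _ _] := real_tensor_fubini m2 imP.
exact: complex_eqP.
Qed.

Lemma cint_swap : cint mu (fun x => cint nu (fun y => f (x, y))) =
  cint nu (fun y => cint mu (fun x => f (x, y))).
Proof. by rewrite -cint_fubini1 cint_fubini2. Qed.

Lemma cmeas_cint1 : cmeas (fun x => cint nu (fun y => f (x, y))).
Proof.
have [m1 m2] := mf.
have [_ _ e1 _] := real_tensor_fubini m1 reP.
by have [_ _ e2 _] := real_tensor_fubini m2 imP.
Qed.

Lemma cmeas_cint2 : cmeas (fun y => cint mu (fun x => f (x, y))).
Proof.
have [m1 m2] := mf.
have [_ _ _ e1] := real_tensor_fubini m1 reP.
by have [_ _ _ e2] := real_tensor_fubini m2 imP.
Qed.

Lemma normc_cint1 x :
  normc (cint nu (fun y => f (x, y))) <= 2 * (\int[nu]_y b y) * a x.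
Proof.
rewrite -mulrA [X in _ * X]mulrC -RintegralZl//.
apply: normc_cint; last exact: rintegrableZ; last by move=> y; exact: fab.
exact: (cmeas_comp mf (measurable_pair1 x)).
Qed.

End tensor_fubini.

(** * Lattice sums as integrals against the counting measure *)

(** The index set of the theta series, with every subset measurable, so that
    exchanging a sum with an integral is an instance of Fubini's theorem. *)
Definition lattice (n : nat) : Type := 'cV[int]_n.

Section lattice_measurable.
Variable n : nat.

HB.instance Definition _ := Countable.on (lattice n).
HB.instance Definition _ := isPointed.Build (lattice n) (0 : 'cV[int]_n).
HB.instance Definition _ := @isMeasurable.Build default_measure_display
  (lattice n) discrete_measurable discrete_measurable0
  discrete_measurableC discrete_measurableU.

Lemma measurable_lattice d (T : measurableType d) (f : lattice n -> T) :
  measurable_fun setT f.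
Proof. by []. Qed.

Let fibre (i : nat) : set (lattice n) := [set k | pickle k = i].

Let bigcup_fibre : \bigcup_i fibre i = setT.
Proof. by apply/seteqP; split => // k _; exists (pickle k). Qed.

Let fibreP i : fibre i = set0 \/ exists k, fibre i = [set k].
Proof.
have [[k Fk]|nF] := pselect (exists k, fibre i k); [right|left].
  exists k; apply/seteqP; split => [l Fl /=|l ->//].
  by apply: (pcan_inj (@pickleK (lattice n))); rewrite Fl Fk.
by apply/seteqP; split => // k Fk; apply: nF; exists k.
Qed.

Let trivIset_fibre : trivIset setT fibre.
Proof.
apply/trivIsetP => i j _ _ ij; apply/seteqP; split => // k [ki kj].
by move: ij; rewrite -ki -kj eqxx.
Qed.

Lemma measurable_lattice_prod d d' (T : measurableType d)
    (U : measurableType d') (f : lattice n * T -> U) :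
  (forall k, measurable_fun setT (fun t => f (k, t))) -> measurable_fun setT f.
Proof.
move=> mf _ Y mY; rewrite setTI.
have -> : f @^-1` Y = \bigcup_i (fibre i `*` setT `&` f @^-1` Y).
  apply/seteqP; split=> [[k t] fY|[k t] [i _ []]//].
  by exists (pickle k).
apply: bigcup_measurable => i _; have [->|[k ->]] := fibreP i.
  by rewrite set0X set0I.
have -> : [set k] `*` setT `&` f @^-1` Y =
    [set k] `*` ((fun t => f (k, t)) @^-1` Y).
  by apply/seteqP; split=> [[l t] [[/= -> _]]|[l t] [/= -> ?]].
by apply: measurableX => //; rewrite -[X in measurable X]setTI; exact: mf.
Qed.

Variable R : realType.

(** Counting measure under a constant of its own, to which sigma-finiteness is
    attached. *)
Definition lattice_count : set (lattice n) -> \bar R :=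
  @counting (lattice n) R.

HB.instance Definition _ := Measure.copy lattice_count (@counting (lattice n) R).

Let sigma_finite_lattice : sigma_finite setT lattice_count.
Proof.
exists fibre => [|i]; first by rewrite bigcup_fibre.
split => //; have [->|[k ->]] := fibreP i.
  by rewrite measure0 ltry.
by rewrite /lattice_count /counting asboolT// ltry.
Qed.

HB.instance Definition _ :=
  Measure_isSigmaFinite.Build _ _ _ lattice_count sigma_finite_lattice.

Lemma integral_lattice (f : lattice n -> \bar R) : (forall k, (0 <= f k)%E) ->
  (\int[lattice_count]_k f k = \esum_(k in [set: lattice n]) f k)%E.
Proof.
move=> f0; rewrite -bigcup_fibre (nneseries_sum_bigcup trivIset_fibre)//.
rewrite ge0_integral_bigcup//.
apply: eq_eseriesr => i _; have [->|[k ->]] := fibreP i.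
  by rewrite integral_set0 esum_set0.
rewrite esum_set1// (eq_integral (cst (f k))) => [|l]; last first.
  by rewrite inE => /= ->.
rewrite integral_cst//= /lattice_count /counting/= asboolT//=.
rewrite fset_set1.
by rewrite finmap.cardfs1 mule1.
Qed.

End lattice_measurable.

Section lattice_sums.
Context (n : nat) (R : realType).
Local Notation cnt := (@lattice_count n R).

Lemma cmeas_lattice (f : lattice n -> R[i]) : cmeas f.
Proof. by []. Qed.

Lemma cmeas_lattice_prod d (T : measurableType d)
    (f : lattice n * T -> R[i]) :
  (forall k, cmeas (fun t => f (k, t))) -> cmeas f.
Proof.
by move=> mf; split; apply: measurable_lattice_prod => k; case: (mf k).
Qed.

Let rsumE (f : lattice n -> R) : rintegrable cnt f ->
  rsum (f : 'cV[int]_n -> R) = \int[cnt]_k f k.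
Proof.
move=> fi; rewrite /rsum /Rintegral integralE fineB; last 2 first.
- by apply: integrable_pos_fin_num.
- by apply: integrable_neg_fin_num.
rewrite !integral_lattice//; congr (_ - _); congr fine.
- apply: (@eq_esum _ ('cV[int]_n)) => k _.
  by rewrite funeposE /= -EFin_max.
- apply: (@eq_esum _ ('cV[int]_n)) => k _.
  by rewrite funenegE /= -EFin_max.
Qed.

(** Positive and negative parts are summed separately in [rsum], hence the
    hypothesis of absolute convergence. *)
Lemma csum_cint (f : lattice n -> R[i]) : cintegrable cnt f ->
  csum (f : 'cV[int]_n -> R[i]) = cint cnt f.
Proof.
by move=> /rintegrable_normc[f1 f2]; rewrite /csum !rsumE.
Qed.

End lattice_sums.

(** * Lebesgue measure on tuples *)

Section lebesgue_tuples.
Variable R : realType.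
Local Notation T n := (n.-tuple (measurableTypeR R)).
Local Notation leb1 := (@lebesgue_measure R).
Local Notation leb n := (@lebesgue_tuple R n).

Lemma ge0_integral_tupleS n (f : T n.+1 -> \bar R) :
  measurable_fun setT f -> (forall t, (0 <= f t)%E) ->
  (\int[leb n.+1]_t f t = \int[leb1 \x leb n]_z f (tcons z))%E.
Proof.
move=> mf f0.
rewrite (eq_measure_integral
  (pushforward (leb1 \x leb n)%E (@tcons R n)))//.
have mt : measurable_fun setT (@tcons R n) by exact: measurable_tcons.
by rewrite ge0_integral_pushforward.
Qed.

Lemma integral_tupleS n (f : T n.+1 -> \bar R) :
  measurable_fun setT f ->
  (\int[leb n.+1]_t f t = \int[leb1 \x leb n]_z f (tcons z))%E.
Proof.
move=> mf; rewrite integralE [RHS]integralE; congr (_ - _)%E.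
- rewrite ge0_integral_tupleS; [|exact: measurable_funepos|by []].
  by apply: eq_integral => z _; rewrite !funeposE.
- rewrite ge0_integral_tupleS; [|exact: measurable_funeneg|by []].
  by apply: eq_integral => z _; rewrite !funenegE.
Qed.

Lemma measurable_tconsE n : measurable_fun setT (@tcons R n).
Proof. exact: measurable_tcons. Qed.

Lemma cint_tupleS n (f : T n.+1 -> R[i]) : cmeas f ->
  cint (leb n.+1) f = cint (leb1 \x leb n)%E (fun z => f (tcons z)).
Proof.
move=> [f1 f2]; apply: complex_eqP; rewrite /= /Rintegral integral_tupleS//;
  exact/measurable_EFinP.
Qed.

Lemma rintegrable_tupleS n (f : T n.+1 -> R) : measurable_fun setT f ->
  rintegrable (leb1 \x leb n)%E (fun z => f (tcons z)) ->
  rintegrable (leb n.+1) f.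
Proof.
move=> mf /integrableP[_ fi]; apply/integrableP; split.
  exact/measurable_EFinP.
rewrite ge0_integral_tupleS//.
by apply: measurableT_comp => //; exact/measurable_EFinP.
Qed.

Lemma ge0_integral_shift1 (a : R) (f : measurableTypeR R -> \bar R) :
  measurable_fun setT f -> (forall t, (0 <= f t)%E) ->
  (\int[leb1]_t f (t + a)%R = \int[leb1]_t f t)%E.
Proof.
move=> mf f0.
pose sh (t : measurableTypeR R) : measurableTypeR R := t + a.
have msh : measurable_fun setT sh by exact: measurable_funD.
have e := ge0_integral_pushforward msh leb1 measurableT mf (fun t _ => f0 t).
rewrite preimage_setT in e; apply: (eq_trans (esym e)); symmetry.
pose mp := measure_function_pushforward__canonical__measure_function_Measure
  leb1 msh.
rewrite (@eq_measure_integral _ _ R setT mp leb1 f)// => A mA _.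
apply: lebesgue_measure_unique => // _ [[b c] _ <-] /=.
rewrite /pushforward.
have -> : sh @^-1` `]b, c] = `]b - a, c - a]%classic.
  by apply/seteqP; split => x /=; rewrite /sh /= !in_itv/= ltrBlDr lerBrDr.
rewrite /= !lebesgue_measure_itv/= !lte_fin ltrD2r.
by case: ifPn => // _; rewrite -!EFinB opprB addrA subrK.
Qed.

Lemma cint_shift1 (a : R) (f : measurableTypeR R -> R[i]) : cmeas f ->
  cint leb1 (fun t => f (t + a)) = cint leb1 f.
Proof.
have E (h : measurableTypeR R -> R) : measurable_fun setT h ->
    \int[leb1]_t h (t + a) = \int[leb1]_t h t.
  move=> mh; have mh' : measurable_fun setT (EFin \o h) by exact/measurable_EFinP.
  rewrite /Rintegral integralE [in RHS]integralE.
  rewrite -(ge0_integral_shift1 a (measurable_funepos mh') (fun=> funepos_ge0 _ _)).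
  rewrite -(ge0_integral_shift1 a (measurable_funeneg mh') (fun=> funeneg_ge0 _ _)).
  congr fine; congr (_ - _)%E; apply: eq_integral => t _.
  - by rewrite !funeposE.
  - by rewrite !funenegE.
by move=> [f1 f2]; apply: complex_eqP; rewrite ?Re_cint ?Im_cint; exact: E.
Qed.

Definition shift_tuple n (t a : n.-tuple R) : T n :=
  [tuple (tnth t i + tnth a i : measurableTypeR R) | i < n].

Lemma measurable_shift_tuple n (a : n.-tuple R) :
  measurable_fun setT (fun t : T n => shift_tuple t a).
Proof.
apply/measurable_fun_tnthP => i.
apply: (eq_measurable_fun
    (fun t : T n => tnth t i + tnth a i : measurableTypeR R)) => [t _|].
  by rewrite /= tnth_mktuple.
by apply: measurable_funD => //; exact: measurable_tnth.
Qed.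

Lemma tnth_tcons0 n (z : measurableTypeR R * T n) : tnth (tcons z) ord0 = z.1.
Proof. by rewrite (tnth_nth z.1). Qed.

Lemma tnth_tconsS n (z : measurableTypeR R * T n) (i : 'I_n) :
  tnth (tcons z) (lift ord0 i) = tnth z.2 i.
Proof. by rewrite !(tnth_nth z.1). Qed.

Lemma shift_tcons n (z : measurableTypeR R * T n) (a : n.+1.-tuple R) :
  shift_tuple (tcons z) a =
  tcons (z.1 + tnth a ord0, shift_tuple z.2 [tuple of behead a]).
Proof.
apply: eq_from_tnth => i; rewrite tnth_mktuple.
case: (unliftP ord0 i) => [j|] ->; last by rewrite !tnth_tcons0.
rewrite !tnth_tconsS tnth_mktuple; congr (_ + _).
by rewrite !(tnth_nth 0) /= nth_behead.
Qed.

Lemma ge0_integral_shift n (a : n.-tuple R) (f : T n -> \bar R) :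
  measurable_fun setT f -> (forall t, (0 <= f t)%E) ->
  (\int[leb n]_t f (shift_tuple t a) = \int[leb n]_t f t)%E.
Proof.
elim: n a f => [|n ih] a f mf f0.
  by apply: eq_integral => t _; congr f; rewrite [RHS]tuple0 [LHS]tuple0.
have mfs : measurable_fun setT (fun t : T n.+1 => f (shift_tuple t a)).
  exact: (measurableT_comp mf (measurable_shift_tuple a)).
have mft : measurable_fun setT (f \o @tcons R n).
  exact: (measurableT_comp mf (@measurable_tconsE n)).
rewrite !ge0_integral_tupleS//.
rewrite fubini_tonelli1//; last first.
  exact: (measurableT_comp mfs (@measurable_tconsE n)).
rewrite [RHS]fubini_tonelli1//.
rewrite -[RHS](ge0_integral_shift1 (tnth a ord0)); last 2 first.
- exact: (@measurable_fun_fubini_tonelli_F _ _ _ _ _ (leb n)).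
- by move=> t; exact: integral_ge0.
apply: eq_integral => x _; rewrite /fubini_F.
under eq_integral do rewrite shift_tcons/=.
apply: (ih _ (fun t => f (tcons (x + tnth a ord0, t)))) => //.
exact: (measurableT_comp mft (pair1_measurable _)).
Qed.

Lemma integral_shift n (a : n.-tuple R) (f : T n -> \bar R) :
  measurable_fun setT f ->
  (\int[leb n]_t f (shift_tuple t a) = \int[leb n]_t f t)%E.
Proof.
move=> mf; rewrite integralE [RHS]integralE; congr (_ - _)%E.
- rewrite -[RHS](ge0_integral_shift a); [|exact: measurable_funepos|by []].
  by apply: eq_integral => z _; rewrite !funeposE.
- rewrite -[RHS](ge0_integral_shift a); [|exact: measurable_funeneg|by []].
  by apply: eq_integral => z _; rewrite !funenegE.
Qed.

Lemma cint_shift n (a : n.-tuple R) (f : T n -> R[i]) : cmeas f ->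
  cint (leb n) (fun t => f (shift_tuple t a)) = cint (leb n) f.
Proof.
move=> [f1 f2]; apply: complex_eqP => /=; rewrite /Rintegral.
- rewrite -[in RHS](integral_shift a)//; exact/measurable_EFinP.
- rewrite -[in RHS](integral_shift a)//; exact/measurable_EFinP.
Qed.

End lebesgue_tuples.

(** * Gaussian weights and the cube *)

Section gauss_weight.
Variable R : realType.
Local Notation T n := (n.-tuple (measurableTypeR R)).
Local Notation leb1 := (@lebesgue_measure R).
Local Notation leb n := (@lebesgue_tuple R n).

Definition sqnorm n (z : 'cV[R]_n) : R := \sum_i z i 0 ^+ 2.

Definition gauss_weight (e : R) n (z : 'cV[R]_n) : R := expR (- (e * sqnorm z)).

Lemma sqnorm_ge0 n (z : 'cV[R]_n) : 0 <= sqnorm z.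
Proof. by apply: sumr_ge0 => i _; exact: sqr_ge0. Qed.

Lemma sqnorm_half n (a b : 'cV[R]_n) : sqnorm b / 2 - sqnorm a <= sqnorm (a + b).
Proof.
rewrite /sqnorm mulr_suml -sumrB; apply: ler_sum => i _; rewrite mxE.
by have := sqr_ge0 (2 * a i 0 + b i 0); rewrite !expr2; lra.
Qed.

Lemma sqnorm_col_mx m n (x : 'cV[R]_m) (y : 'cV[R]_n) :
  sqnorm (col_mx x y) = sqnorm x + sqnorm y.
Proof.
rewrite /sqnorm big_split_ord/=; congr (_ + _); apply: eq_bigr => i _.
- by rewrite col_mxEu.
- by rewrite col_mxEd.
Qed.

Lemma gauss_weight_gt0 e n (z : 'cV[R]_n) : 0 < gauss_weight e z.
Proof. exact: expR_gt0. Qed.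

Lemma gauss_weight_ge0 e n (z : 'cV[R]_n) : 0 <= gauss_weight e z.
Proof. exact: expR_ge0. Qed.

Lemma gauss_weightD e e' n (z : 'cV[R]_n) :
  gauss_weight (e + e') z = gauss_weight e z * gauss_weight e' z.
Proof. by rewrite /gauss_weight -expRD mulrDl opprD. Qed.

Lemma gauss_weight_half e n (z : 'cV[R]_n) :
  gauss_weight e z = gauss_weight (e / 2) z * gauss_weight (e / 2) z.
Proof. by rewrite -gauss_weightD -splitr. Qed.

Lemma gauss_weight_le e e' n (z : 'cV[R]_n) :
  e <= e' -> gauss_weight e' z <= gauss_weight e z.
Proof.
by move=> ee'; rewrite ler_expR lerN2 ler_wpM2r// sqnorm_ge0.
Qed.

Lemma gauss_weight_le1 e n (z : 'cV[R]_n) : 0 <= e -> gauss_weight e z <= 1.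
Proof.
by move=> e0; rewrite -expR0 ler_expR oppr_le0 mulr_ge0// sqnorm_ge0.
Qed.

(** Peetre-type inequality: displacing a Gaussian weight by a bounded vector
    costs a constant and half of the exponent. *)
Lemma gauss_weight_shift e n (a b : 'cV[R]_n) : 0 <= e ->
  gauss_weight e (a + b) <= expR (e * sqnorm a) * gauss_weight (e / 2) b.
Proof.
move=> e0; rewrite /gauss_weight -expRD ler_expR.
by have := ler_wpM2l e0 (sqnorm_half a b); lra.
Qed.

Lemma gauss_weight_col_mx e m n (x : 'cV[R]_m) (y : 'cV[R]_n) :
  gauss_weight e (col_mx x y) = gauss_weight e x * gauss_weight e y.
Proof. by rewrite /gauss_weight -expRD sqnorm_col_mx mulrDr opprD. Qed.

Definition mcol d (X : measurableType d) n (f : X -> 'cV[R]_n) :=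
  forall i, measurable_fun setT (fun t => f t i 0).

Lemma mcol_tuple n : mcol (fun t : T n => col_of_tuple t).
Proof.
move=> i; apply: (eq_measurable_fun (fun t : T n => tnth t i)) => [t _|].
  by rewrite mxE.
exact: measurable_tnth.
Qed.

Lemma mcol_comp d d' (X : measurableType d) (Y : measurableType d') n
    (f : Y -> 'cV[R]_n) (g : X -> Y) :
  mcol f -> measurable_fun setT g -> mcol (fun t => f (g t)).
Proof. by move=> mf mg i; exact: (measurableT_comp (mf i) mg). Qed.

Lemma mcolD d (X : measurableType d) n (f g : X -> 'cV[R]_n) :
  mcol f -> mcol g -> mcol (fun t => f t + g t).
Proof.
move=> mf mg i; apply: (eq_measurable_fun (fun t => f t i 0 + g t i 0)).
  by move=> t _; rewrite mxE.
exact: measurable_funD.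
Qed.

Lemma mcol_cst d (X : measurableType d) n (a : 'cV[R]_n) : mcol (fun _ : X => a).
Proof. by move=> i; exact: measurable_cst. Qed.

Lemma mcol_col_mx d (X : measurableType d) m n
    (f : X -> 'cV[R]_m) (g : X -> 'cV[R]_n) :
  mcol f -> mcol g -> mcol (fun t => col_mx (f t) (g t)).
Proof.
move=> mf mg i; apply: (eq_measurable_fun (fun t =>
    match fintype.split i with inl j => f t j 0 | inr j => g t j 0 end)).
  move=> t _; case: splitP => j ij; symmetry.
  - by rewrite (_ : i = lshift n j) ?col_mxEu//; exact: val_inj.
  - by rewrite (_ : i = rshift m j) ?col_mxEd//; exact: val_inj.
by case: fintype.split.
Qed.

Lemma measurable_sqnorm d (X : measurableType d) n (f : X -> 'cV[R]_n) :
  mcol f -> measurable_fun setT (fun t => sqnorm (f t)).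
Proof.
move=> mf; rewrite /sqnorm.
elim: (index_enum _) => [|i r ih].
  by under eq_fun do rewrite big_nil; exact: measurable_cst.
under eq_fun do rewrite big_cons.
by apply: measurable_funD => //; apply: measurable_funX; exact: mf.
Qed.

Lemma measurable_gauss_weight d (X : measurableType d) e n (f : X -> 'cV[R]_n) :
  mcol f -> measurable_fun setT (fun t => gauss_weight e (f t)).
Proof.
move=> mf; apply: (measurableT_comp (@measurable_expR R)).
apply: measurable_funN.
by apply: measurable_funM => //; exact: measurable_sqnorm.
Qed.

Lemma col_tcons0 n (z : measurableTypeR R * T n) :
  col_of_tuple (tcons z) ord0 0 = z.1.
Proof. by rewrite mxE tnth_tcons0. Qed.

Lemma col_tconsS n (z : measurableTypeR R * T n) i :
  col_of_tuple (tcons z) (lift ord0 i) 0 = col_of_tuple z.2 i 0.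
Proof. by rewrite !mxE tnth_tconsS. Qed.

Lemma sqnorm_tcons n (z : measurableTypeR R * T n) :
  sqnorm (col_of_tuple (tcons z)) = z.1 ^+ 2 + sqnorm (col_of_tuple z.2).
Proof.
rewrite /sqnorm big_ord_recl col_tcons0; congr (_ + _).
by apply: eq_bigr => i _; rewrite col_tconsS.
Qed.

Lemma gauss_weight_tcons e n (z : measurableTypeR R * T n) :
  gauss_weight e (col_of_tuple (tcons z)) =
  expR (- (e * z.1 ^+ 2)) * gauss_weight e (col_of_tuple z.2).
Proof. by rewrite /gauss_weight sqnorm_tcons -expRD mulrDr opprD. Qed.

Lemma normal_gauss (e : R) : 0 < e -> exists2 c : R, 0 < c &
  normal_pdf 0 (Num.sqrt e^-1) = (fun x : R => c * expR (- (e / 2 * x ^+ 2))).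
Proof.
move=> e0; have s0 : Num.sqrt e^-1 != 0 by rewrite gt_eqF// sqrtr_gt0 invr_gt0.
exists (normal_peak (Num.sqrt e^-1)); first exact: normal_peak_gt0.
apply/funext => x; rewrite /normal_pdf (negbTE s0) /normal_fun; congr (_ * expR _).
rewrite subr0 sqr_sqrtr ?invr_ge0 ?ltW// -mulr_natr.
by field; rewrite gt_eqF.
Qed.

Lemma rintegrable_gauss1 (e : R) : 0 < e ->
  rintegrable leb1 (fun x => expR (- (e * x ^+ 2))).
Proof.
move=> e0; have e20 : 0 < e * 2 by rewrite mulr_gt0.
have [c c0 E] := normal_gauss e20.
have := @integrable_normal_pdf R 0 (Num.sqrt (e * 2)^-1).
rewrite E => i.
have -> : (fun x : R => expR (- (e * x ^+ 2))) =
    (fun x : R => c^-1 * (c * expR (- (e * 2 / 2 * x ^+ 2)))).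
  by apply/funext => x; rewrite mulKf ?gt_eqF// mulfK// pnatr_eq0.
exact: rintegrableZ.
Qed.

Lemma rintegrable_cst0 (c : R) : rintegrable (leb 0) (fun=> c).
Proof.
apply/integrableP; split; first by apply/measurable_EFinP; exact: measurable_cst.
rewrite (eq_integral (cst (`|c|%:E))) => [|t _ //].
by rewrite integral_cst//= diracT mule1 ltry.
Qed.

Lemma rintegrable_gauss_weight n (e : R) : 0 < e ->
  rintegrable (leb n) (fun t => gauss_weight e (col_of_tuple t)).
Proof.
move=> e0; elim: n => [|n ih].
  apply: (rintegrable_le (a := cst 1)) => [|t|].
  - by apply: measurable_gauss_weight; exact: mcol_tuple.
  - by rewrite ger0_norm ?gauss_weight_ge0// gauss_weight_le1// ltW.
  exact: rintegrable_cst0.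
apply: rintegrable_tupleS.
  by apply: measurable_gauss_weight; exact: mcol_tuple.
have := rintegrable_tensor (rintegrable_gauss1 e0) ih
  (fun x => expR_ge0 _) (fun t => gauss_weight_ge0 _ _).
by apply: eq_integrable => // z _; rewrite /= gauss_weight_tcons.
Qed.

Definition chi n (t : T n) : R := \1_(@cube R n) t.

Lemma chi_ge0 n (t : T n) : 0 <= chi t.
Proof. by rewrite /chi indicE. Qed.

Lemma measurable_forall_ord d (X : measurableType d) n (A : 'I_n -> set X) :
  (forall i, measurable (A i)) -> measurable [set t | forall i, A i t].
Proof.
move=> mA; have -> : [set t | forall i, A i t] = \bigcap_(i in [set: 'I_n]) A i.
  by apply/seteqP; split => [t At i _|t At i]; exact: At.
by apply: fin_bigcap_measurable => //; exact: finite_finset.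
Qed.

Lemma measurable_tuple_box n (I : 'I_n -> interval R) :
  measurable [set t : T n | forall i, [set` I i] (tnth t i)].
Proof.
apply: measurable_forall_ord => i; rewrite -[X in measurable X]setTI.
exact: (measurable_tnth i).
Qed.

Lemma cubeE n : @cube R n =
  [set t : T n | forall i, [set` `[0, 2 * pi]] (tnth t i)].
Proof. by apply/seteqP; split => t /= ct i; have := ct i; rewrite /= in_itv. Qed.

Lemma measurable_cube n : measurable (@cube R n).
Proof. by rewrite cubeE; exact: measurable_tuple_box. Qed.

Lemma measurable_chi n : measurable_fun setT (@chi n).
Proof. by apply: measurable_indic; exact: measurable_cube. Qed.

Lemma box_tcons n (A : set R) (z : measurableTypeR R * T n) :
  \1_[set t : T n.+1 | forall i, A (tnth t i)] (tcons z) =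
  \1_A (z.1 : R) * \1_[set t : T n | forall i, A (tnth t i)] z.2 :> R.
Proof.
rewrite !indicE -natrM mulnb; congr (_ %:R); congr nat_of_bool.
apply/idP/andP => [|[]]; rewrite !inE /=.
- move=> At; split; rewrite ?inE/=; first by have := At ord0; rewrite tnth_tcons0.
  by move=> i; have := At (lift ord0 i); rewrite tnth_tconsS.
- move=> A1 At i.
  by case: (unliftP ord0 i) => [j|] ->; rewrite ?tnth_tcons0// tnth_tconsS.
Qed.

Lemma chi_tcons n (z : measurableTypeR R * T n) :
  chi (tcons z) = \1_`[0, 2 * pi]%classic z.1 * chi z.2.
Proof. by rewrite /chi !cubeE (box_tcons `[0, 2 * pi]%classic). Qed.

Lemma chi0 (t : T 0) : chi t = 1.
Proof. by rewrite /chi indicE mem_set// => -[]. Qed.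

Lemma rintegrable_indic1 (a b : R) : rintegrable leb1 (\1_`[a, b]%classic).
Proof. exact: integrable_indic_itv. Qed.

Lemma rintegrable_chi n : rintegrable (leb n) (@chi n).
Proof.
elim: n => [|n ih].
  apply: (rintegrable_le (a := cst 1)) => [|t|].
  - exact: measurable_chi.
  - by rewrite chi0 normr1.
  exact: rintegrable_cst0.
apply: rintegrable_tupleS; first exact: measurable_chi.
have := rintegrable_tensor (rintegrable_indic1 0 (2 * pi)) ih _ (@chi_ge0 n).
move=> /(_ (fun x => ltac:(by rewrite indicE))).
by apply: eq_integrable => // z _; rewrite /= chi_tcons.
Qed.

End gauss_weight.

(** * Characters of the torus *)

Section cube_fourier.
Variable R : realType.
Local Notation leb1 := (@lebesgue_measure R).
Local Notation ex a := (cexp (0 +i* (a : R))).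

Lemma normc_ex (a : R) : normc (ex a) = 1.
Proof. by rewrite normc_cexp expR0. Qed.

Lemma exD (a b : R) : ex (a + b) = ex a * ex b.
Proof. by rewrite -cexpD; congr cexp; apply: complex_eqP; rewrite /= ?addr0. Qed.

Lemma sin_intpi (k : int) : sin (k%:~R * (2 * pi)) = 0 :> R.
Proof.
rewrite [2 * pi]mulr_natl; have sn (n : nat) : sin (n%:R * (pi *+ 2)) = 0 :> R.
  elim: n => [|n ih]; first by rewrite mul0r sin0.
  by rewrite -natr1 mulrDl mul1r sinD2pi.
case: k => n; first exact: sn.
by rewrite NegzE mulrNz mulNr sinN -pmulrn sn oppr0.
Qed.

Lemma cos_intpi (k : int) : cos (k%:~R * (2 * pi)) = 1 :> R.
Proof.
rewrite [2 * pi]mulr_natl; have cn (n : nat) : cos (n%:R * (pi *+ 2)) = 1 :> R.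
  elim: n => [|n ih]; first by rewrite mul0r cos0.
  by rewrite -natr1 mulrDl mul1r cosD2pi.
case: k => n; first exact: cn.
by rewrite NegzE mulrNz mulNr cosN -pmulrn cn.
Qed.

Lemma ex_intpi (k : int) : ex (k%:~R * (2 * pi)) = 1.
Proof. by rewrite /cexp /= expR0 sin_intpi cos_intpi !mul1r. Qed.

Let I := `[(0 : R), 2 * pi]%classic.

Let pi2_gt0 : 0 < 2 * pi :> R.
Proof. by rewrite mulr_gt0// pi_gt0. Qed.

Let Rint_indic (f : R -> R) :
  \int[leb1]_x (\1_I x * f x) = \int[leb1]_(x in I) f x.
Proof.
rewrite [RHS]Rintegral_mkcond; apply: eq_Rintegral => x _.
by rewrite indicE patchE; case: ifPn; rewrite ?mul1r ?mul0r.
Qed.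

Lemma cint_interval_exp (k : int) :
  cint leb1 (fun x => (\1_I x)%:C * ex (k%:~R * x)) =
  if k == 0 then (2 * pi)%:C else 0.
Proof.
have mI : measurable (I : set (measurableTypeR R)) by exact: measurable_itv.
have Ere : complex.Re (cint leb1 (fun x => (\1_I x)%:C * ex (k%:~R * x))) =
    \int[leb1]_(x in I) cos (k%:~R * x).
  rewrite Re_cint -Rint_indic; apply: eq_Rintegral => x _.
  by rewrite ReM /= expR0 mul1r mul0r subr0.
have Eim : complex.Im (cint leb1 (fun x => (\1_I x)%:C * ex (k%:~R * x))) =
    \int[leb1]_(x in I) sin (k%:~R * x).
  rewrite Im_cint -Rint_indic; apply: eq_Rintegral => x _.
  by rewrite ImM /= expR0 mul1r mul0r addr0.
case: eqP => [k0|/eqP k0].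
  apply: complex_eqP; rewrite ?Ere ?Eim k0.
  - under eq_Rintegral do rewrite mul0r cos0.
    rewrite Rintegral_cst//= mul1r lebesgue_measure_itv/= lte_fin.
    by rewrite pi2_gt0 -EFinB subr0.
  - under eq_Rintegral do rewrite mul0r sin0.
    by rewrite Rintegral_cst//= mul0r.
have kR0 : k%:~R != 0 :> R by rewrite intr_eq0.
have dk (f : R -> R) (F : R -> R) :
    (forall x : R, is_derive x 1 F (f x)) -> continuous f ->
    \int[leb1]_(x in I) f x = F (2 * pi) - F 0.
  move=> dF cf; rewrite /Rintegral (continuous_FTC2 (F := F))//.
  - exact: continuous_subspaceT.
  - have cF : continuous F.
      move=> x; apply/differentiable_continuous/derivable1_diffP.
      by have [] := dF x.
    split.
    + by move=> x _; have [] := dF x.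
    + exact/cvg_at_right_filter/cF.
    + exact/cvg_at_left_filter/cF.
  - by move=> x _; rewrite derive1E; have [_ ->] := dF x.
have cm : continuous (fun x : R => k%:~R * x).
  by move=> x; apply: mulrl_continuous.
apply: complex_eqP; rewrite ?Ere ?Eim.
- have D (x : R) : is_derive x 1 (fun x => k%:~R^-1 * sin (k%:~R * x) : R)
      (cos (k%:~R * x)).
    apply: is_derive_eq; rewrite /GRing.scale /=.
    by rewrite mulr1; field.
  rewrite (dk _ _ D) ?sin_intpi ?mulr0 ?sin0 ?mulr0 ?subr0//.
  by move=> x; apply: continuous_comp; [exact: cm|exact: continuous_cos].
- have D (x : R) : is_derive x 1 (fun x => - (k%:~R^-1 * cos (k%:~R * x)) : R)
      (sin (k%:~R * x)).
    apply: is_derive_eq; rewrite /GRing.scale /=.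
    by rewrite mulr1; field.
  rewrite (dk _ _ D) ?cos_intpi ?mulr0 ?cos0 ?subrr//.
  by move=> x; apply: continuous_comp; [exact: cm|exact: continuous_sin].
Qed.

End cube_fourier.

Section tiling.
Variable R : realType.
Local Notation T n := (n.-tuple (measurableTypeR R)).
Local Notation leb1 := (@lebesgue_measure R).
Local Notation leb n := (@lebesgue_tuple R n).
Local Notation ex a := (cexp (0 +i* (a : R))).

Let pi2_gt0 : 0 < 2 * pi :> R.
Proof. by rewrite mulr_gt0// pi_gt0. Qed.

Lemma dotv_sum n (x y : 'cV[R]_n) : dotv x y = \sum_i x i 0 * y i 0.
Proof. by rewrite /dotv mxE; apply: eq_bigr => i _; rewrite mxE. Qed.

Lemma measurable_dotv d (X : measurableType d) n (f g : X -> 'cV[R]_n) :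
  mcol f -> mcol g -> measurable_fun setT (fun t => dotv (f t) (g t)).
Proof.
move=> mf mg; under eq_fun do rewrite dotv_sum.
elim: (index_enum _) => [|i r ih].
  by under eq_fun do rewrite big_nil; exact: measurable_cst.
under eq_fun do rewrite big_cons.
by apply: measurable_funD => //; apply: measurable_funM.
Qed.

Lemma cmeas_ex_dotv d (X : measurableType d) n (f g : X -> 'cV[R]_n) :
  mcol f -> mcol g -> cmeas (fun t => ex (dotv (f t) (g t))).
Proof.
by move=> mf mg; apply/cmeas_cexp/cmeas_imag; exact: measurable_dotv.
Qed.

Lemma cint_tuple0 (f : T 0 -> R[i]) : cint (leb 0) f = f [tuple].
Proof.
have E (g : T 0 -> R) : \int[leb 0]_t g t = g [tuple].
  have -> : \int[leb 0]_t g t = \int[leb 0]_(t in setT) g [tuple].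
    by apply: eq_Rintegral => t _; rewrite [t]tuple0.
  rewrite (Rintegral_cst _ measurableT) [X in fine X](_ : _ = 1%E) ?mulr1//.
  exact: diracT.
by apply: complex_eqP; rewrite ?Re_cint ?Im_cint E.
Qed.

(** Orthogonality of the characters, one coordinate at a time. *)
Lemma cint_cube_exp n (k : 'cV[int]_n) :
  cint (leb n) (fun t => (chi t)%:C * ex (dotv (intv R k) (col_of_tuple t))) =
  if k == 0 then ((2 * pi) ^+ n)%:C else 0.
Proof.
elim: n k => [|n ih] k.
  rewrite cint_tuple0 chi0 dotv_sum big_ord0 [k]flatmx0 eqxx mul1r.
  by rewrite (_ : 0 +i* 0 = 0 :> R[i])// cexp0 expr0.
pose k' : 'cV[int]_n := \col_i k (lift ord0 i) 0.
have kE : (k == 0) = (k ord0 0 == 0) && (k' == 0).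
  apply/eqP/andP => [k0|[/eqP k0 /eqP k'0]].
    by rewrite k0 mxE; split=> //; apply/eqP/colP => i; rewrite !mxE k0 mxE.
  apply/colP => i; rewrite mxE; case: (unliftP ord0 i) => [j|] ->//.
  by have /colP/(_ j) := k'0; rewrite !mxE.
have mf : cmeas (fun t : T n.+1 =>
    (chi t)%:C * ex (dotv (intv R k) (col_of_tuple t))).
  apply: cmeasM; first by apply: cmeas_real; exact: measurable_chi.
  by apply: cmeas_ex_dotv; [exact: mcol_cst|exact: mcol_tuple].
pose g (k0 : int) (x : measurableTypeR R) : R[i] :=
  (\1_`[0, 2 * pi]%classic (x : R))%:C * ex (k0%:~R * x).
pose h (t : T n) : R[i] := (chi t)%:C * ex (dotv (intv R k') (col_of_tuple t)).
have fE z : (chi (tcons z))%:C * ex (dotv (intv R k) (col_of_tuple (tcons z))) =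
    g (k ord0 0) z.1 * h z.2.
  rewrite chi_tcons rmorphM/= /g /h mulrACA -exD; congr (_ * ex _).
  rewrite !dotv_sum big_ord_recl col_tcons0 mxE; congr (_ + _).
  by apply: eq_bigr => i _; rewrite col_tconsS !mxE.
have mfz : cmeas (fun z : measurableTypeR R * T n => g (k ord0 0) z.1 * h z.2).
  have := cmeas_comp mf (@measurable_tconsE R n).
  by under [X in cmeas X -> _]eq_fun do rewrite fE.
rewrite cint_tupleS//; under eq_fun do rewrite fE.
have hle t : normc (h t) <= chi t.
  by rewrite /h normcM normc_ex normc_real mulr1 ger0_norm// chi_ge0.
have gle x : normc (g (k ord0 0) x) <= \1_`[0, 2 * pi]%classic (x : R).
  by rewrite /g normcM normc_ex normc_real mulr1 ger0_norm// indicE.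
have i0 (x : measurableTypeR R) : 0 <= \1_`[0, 2 * pi]%classic (x : R) :> R.
  by rewrite indicE.
have gh x t : normc (g (k ord0 0) x * h t) <= \1_`[0, 2 * pi]%classic (x : R) * chi t.
  by rewrite normcM ler_pM ?normc_ge0.
rewrite (cint_fubini1 (rintegrable_indic1 0 (2 * pi)) (@rintegrable_chi R n)
  i0 (@chi_ge0 R n) mfz gh) /=.
have mh : cmeas h.
  apply: cmeasM; first by apply: cmeas_real; exact: measurable_chi.
  by apply: cmeas_ex_dotv; [exact: mcol_cst|exact: mcol_tuple].
have ih_ := cintegrable_le mh hle (@rintegrable_chi R n).
under eq_fun do rewrite cintZ// ih.
have ig : cintegrable leb1 (g (k ord0 0)).
  apply: cintegrable_le gle (rintegrable_indic1 0 (2 * pi)).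
  apply: cmeasM; first by apply: cmeas_real; exact: measurable_indic.
  by apply/cmeas_cexp/cmeas_imag; exact: measurable_funM.
under eq_fun do rewrite mulrC.
rewrite cintZ// cint_interval_exp kE.
by case: ifP; case: ifP => _ _; rewrite ?mulr0 ?mul0r// -rmorphM -exprSr.
Qed.

Lemma Rint_chi n : \int[leb n]_t chi t = (2 * pi) ^+ n.
Proof.
have := cint_cube_exp (0 : 'cV[int]_n).
rewrite eqxx => /(congr1 (@complex.Re R)); rewrite Re_cint => E.
rewrite -[RHS]/(complex.Re ((2 * pi) ^+ n)%:C) -E.
apply: eq_Rintegral => t _; rewrite ReM /= mul0r subr0 expR0 mul1r.
rewrite dotv_sum big1 ?cos0 ?mulr1// => i _.
by rewrite /intv !mxE mul0r.
Qed.

(** The half-open cube, whose translates by the periods are disjoint. *)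
Definition hcube n : set (T n) := [set t | forall i, [set` `[0, 2 * pi[] (tnth t i)].

Definition chih n (t : T n) : R := \1_(@hcube n) t.

Lemma measurable_chih n : measurable_fun setT (@chih n).
Proof. by apply: measurable_indic; exact: measurable_tuple_box. Qed.

Lemma chih_ge0 n (t : T n) : 0 <= chih t.
Proof. by rewrite /chih indicE. Qed.

(** The faces of the cube are negligible: in each coordinate the two intervals
    differ by a point. *)
Lemma ge0_integral_hcube n (f : T n -> \bar R) :
  measurable_fun setT f -> (forall t, (0 <= f t)%E) ->
  (\int[leb n]_t ((chih t)%:E * f t) = \int[leb n]_t ((chi t)%:E * f t))%E.
Proof.
elim: n f => [|n ih] f mf f0.
  apply: eq_integral => t _; congr (_%:E * _)%E.
  by rewrite chi0 /chih indicE mem_set// => -[].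
have mft : measurable_fun setT (f \o @tcons R n).
  exact: (measurableT_comp mf (@measurable_tconsE R n)).
have mchi k : measurable_fun setT (fun t : T k => (chi t)%:E).
  by apply/measurable_EFinP; exact: measurable_chi.
have mchih k : measurable_fun setT (fun t : T k => (chih t)%:E).
  by apply/measurable_EFinP; exact: measurable_chih.
have m1 : measurable_fun setT (fun t => (chih t)%:E * f t)%E.
  exact: (emeasurable_funM (mchih _) mf).
have m2 : measurable_fun setT (fun t => (chi t)%:E * f t)%E.
  exact: (emeasurable_funM (mchi _) mf).
have p1 k (g : T k -> \bar R) t : (0 <= g t -> 0 <= (chih t)%:E * g t)%E.
  by move=> gt; apply: mule_ge0 => //; rewrite lee_fin chih_ge0.
have p2 k (g : T k -> \bar R) t : (0 <= g t -> 0 <= (chi t)%:E * g t)%E.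
  by move=> gt; apply: mule_ge0 => //; rewrite lee_fin chi_ge0.
rewrite (ge0_integral_tupleS m1 (fun t => p1 _ _ t (f0 t))).
rewrite (ge0_integral_tupleS m2 (fun t => p2 _ _ t (f0 t))).
rewrite (fubini_tonelli1 _ (measurableT_comp m1 (@measurable_tconsE R n))
  (fun z => p1 _ _ _ (f0 (tcons z)))).
rewrite (fubini_tonelli1 _ (measurableT_comp m2 (@measurable_tconsE R n))
  (fun z => p2 _ _ _ (f0 (tcons z)))).
pose G x := (\int[leb n]_t ((chi t)%:E * f (tcons (x, t))))%E.
have mG : measurable_fun setT G.
  apply: (measurable_fun_fubini_tonelli_F
    (fun z : measurableTypeR R * T n => (chi z.2)%:E * f (tcons z))%E).
    apply: emeasurable_funM => //; apply/measurable_EFinP.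
    exact: (measurableT_comp (@measurable_chi R n)).
  by move=> z; rewrite mule_ge0// lee_fin ?chih_ge0 ?chi_ge0.
have mfx x : measurable_fun setT (fun t => f (tcons (x, t))).
  exact: (measurableT_comp mft (pair1_measurable x)).
have E1 x : fubini_F (leb n) (fun z => (chih (tcons z))%:E * f (tcons z))%E x =
    ((\1_`[0%R, (2 * pi)%R[%classic x)%:E * G x)%E.
  rewrite /fubini_F /G -(ih (fun t => f (tcons (x, t))))//.
  rewrite -ge0_integralZl//; last 2 first.
  - exact: (emeasurable_funM (mchih _) (mfx x)).
  - by move=> t _; rewrite mule_ge0// lee_fin ?chih_ge0 ?chi_ge0.
  apply: eq_integral => t _; rewrite /chih /hcube.
  by rewrite (box_tcons `[0, 2 * pi[%classic)/= EFinM muleA.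
have E2 x : fubini_F (leb n) (fun z => (chi (tcons z))%:E * f (tcons z))%E x =
    ((\1_`[0%R, (2 * pi)%R]%classic x)%:E * G x)%E.
  rewrite /fubini_F /G -ge0_integralZl//; last 2 first.
  - exact: (emeasurable_funM (mchi _) (mfx x)).
  - by move=> t _; rewrite mule_ge0// lee_fin ?chih_ge0 ?chi_ge0.
  by apply: eq_integral => t _; rewrite chi_tcons/= EFinM muleA.
under eq_integral do rewrite E1.
under [RHS]eq_integral do rewrite E2.
have E3 (A : set R) : measurable (A : set (measurableTypeR R)) ->
    (\int[leb1]_x ((\1_A x)%:E * G x) = \int[leb1]_(x in A) G x)%E.
  move=> mA; rewrite [RHS]integral_mkcond; apply: eq_integral => x _.
  by rewrite patchE indicE; case: ifPn; rewrite ?mul1e ?mul0e.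
rewrite !E3//; apply: integral_itv_bndo_bndc.
exact: measurable_funTS.
Qed.

End tiling.

(** * Tiling by the period lattice *)

Section lattice_tiling.
Variable R : realType.
Local Notation T n := (n.-tuple (measurableTypeR R)).
Local Notation leb n := (@lebesgue_tuple R n).
Local Notation cnt n := (@lattice_count n R).

Let pi2_gt0 : 0 < 2 * pi :> R.
Proof. by rewrite mulr_gt0// pi_gt0. Qed.

Lemma cint_hcube n (f : T n -> R[i]) : cmeas f ->
  cint (leb n) (fun t => (chih t)%:C * f t) =
  cint (leb n) (fun t => (chi t)%:C * f t).
Proof.
have E (g : T n -> R) : measurable_fun setT g ->
    \int[leb n]_t (chih t * g t) = \int[leb n]_t (chi t * g t).
  move=> mg; rewrite /Rintegral integralE [in RHS]integralE.
  have mg' : measurable_fun setT (EFin \o g) by exact/measurable_EFinP.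
  have pos (c : T n -> R) : (forall t, 0 <= c t) ->
      (fun t => (c t * g t)%:E)^\+%E = (fun t => (c t)%:E * (EFin \o g)^\+ t)%E.
    move=> c0; apply/funext => t; rewrite !funeposE /= -!EFin_max -EFinM.
    by congr EFin; rewrite maxr_pMr// mulr0.
  have neg (c : T n -> R) : (forall t, 0 <= c t) ->
      (fun t => (c t * g t)%:E)^\-%E = (fun t => (c t)%:E * (EFin \o g)^\- t)%E.
    move=> c0; apply/funext => t; rewrite !funenegE /= -!EFin_max -EFinM.
    by congr EFin; rewrite maxr_pMr// mulr0 mulrN.
  rewrite !(pos _ (@chih_ge0 R n), pos _ (@chi_ge0 R n)).
  rewrite !(neg _ (@chih_ge0 R n), neg _ (@chi_ge0 R n)).
  rewrite (ge0_integral_hcube (measurable_funepos mg') (fun=> funepos_ge0 _ _)).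
  by rewrite (ge0_integral_hcube (measurable_funeneg mg') (fun=> funeneg_ge0 _ _)).
move=> [f1 f2]; apply: complex_eqP; rewrite ?Re_cint ?Im_cint.
- under eq_Rintegral do rewrite ReM/= mul0r subr0.
  by rewrite E//; apply: eq_Rintegral => t _; rewrite ReM/= mul0r subr0.
- under eq_Rintegral do rewrite ImM/= mul0r addr0.
  by rewrite E//; apply: eq_Rintegral => t _; rewrite ImM/= mul0r addr0.
Qed.

Lemma integral_lattice_single n (f : lattice n -> \bar R) (k0 : lattice n) :
  (forall k, k <> k0 -> f k = 0%E) -> (\int[cnt n]_k f k = f k0)%E.
Proof.
move=> f0; have -> : (\int[cnt n]_k f k = \int[cnt n]_(k in [set k0]) f k)%E.
  rewrite [RHS]integral_mkcond; apply: eq_integral => k _.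
  rewrite patchE; case: ifPn => //; rewrite notin_setE => /= /f0 ->//.
rewrite (eq_integral (cst (f k0))) => [|l]; last by rewrite inE => /= ->.
rewrite integral_cst//= /lattice_count /counting/= asboolT//=.
by rewrite fset_set1 finmap.cardfs1 mule1.
Qed.

Lemma cint_lattice_single n (f : lattice n -> R[i]) (k0 : lattice n) :
  (forall k, k <> k0 -> f k = 0) -> cint (cnt n) f = f k0.
Proof.
move=> f0; apply: complex_eqP; rewrite ?Re_cint ?Im_cint /Rintegral;
  by rewrite (@integral_lattice_single _ _ k0)// => k /f0 ->.
Qed.

(** The translates of the half-open cube by the period lattice. *)
Let cell n (k : lattice n) : set (T n) :=
  [set t | forall i, [set` `[2 * pi * (k i 0)%:~R, 2 * pi * (k i 0 + 1)%:~R[]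
     (tnth t i)].

Let w n (k : lattice n) (t : T n) : R := \1_(cell k) t.

Let w_ge0 n (k : lattice n) t : 0 <= w k t.
Proof. by rewrite /w indicE. Qed.

Let measurable_w n (k : lattice n) : measurable_fun setT (w k).
Proof. by apply: measurable_indic; exact: measurable_tuple_box. Qed.

Definition period_tuple n (k : 'cV[int]_n) : n.-tuple R :=
  [tuple period R k i 0 | i < n].

Lemma col_shift n (k : 'cV[int]_n) (t : T n) :
  col_of_tuple (shift_tuple t (period_tuple k)) = col_of_tuple t + period R k.
Proof. by apply/colP => i; rewrite !mxE !tnth_mktuple !mxE. Qed.

Let w_shift n (k : lattice n) t : w k (shift_tuple t (period_tuple k)) = chih t.
Proof.
rewrite /w /chih !indicE; congr (_ %:R); congr nat_of_bool.
have E i : [set` `[2 * pi * (k i 0)%:~R, 2 * pi * (k i 0 + 1)%:~R[]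
    (tnth (shift_tuple t (period_tuple k)) i) =
    [set` `[0, 2 * pi[] (tnth t i : R).
  rewrite /= !in_itv/= !tnth_mktuple !mxE intrD mulr1z [_ * ((k i 0)%:~R + _)]mulrDr mulr1.
  by rewrite lerDr [X in _ < X]addrC ltrD2r.
apply/idP/idP => /set_mem H; apply/mem_set => i; [rewrite -E|rewrite E];
  exact: H.
Qed.

Let cell_coord (x : R) (j : int) :
  (x \in `[2 * pi * j%:~R, 2 * pi * (j + 1)%:~R[) =
  (j%:~R <= x / (2 * pi) < (j + 1)%:~R).
Proof.
by rewrite in_itv/= ler_pdivlMr// ltr_pdivrMr// !(mulrC (2 * pi)).
Qed.

Let cell_exists n (t : T n) : exists k, cell k t.
Proof.
exists (\col_i Num.floor (tnth t i / (2 * pi) : R)) => i.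
by rewrite /= cell_coord mxE floor_le floorD1_gt.
Qed.

Let cell_unique n (k l : lattice n) t : cell k t -> cell l t -> k = l.
Proof.
move=> kt lt; apply/colP => i; have := kt i; have := lt i.
by rewrite /= !cell_coord => /floor_def <- /floor_def <-.
Qed.

Let cell_near n (k : lattice n) t : cell k t ->
  sqnorm (col_of_tuple t - period R k) <= n%:R * (2 * pi) ^+ 2.
Proof.
move=> kt; rewrite /sqnorm mulr_natl -[n in leRHS]card_ord -sumr_const.
apply: ler_sum => i _; have := kt i; rewrite /= in_itv/= !mxE intrD => /andP[].
rewrite mulr1z [_ * ((k i 0)%:~R + _)]mulrDr mulr1 => h1 h2.
by rewrite ler_sqr ?nnegrE ?subr_ge0 ?(ltW pi2_gt0)// lerBlDl ltW.
Qed.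

Let bnd n (e : R) : R := expR (e * (n%:R * (2 * pi) ^+ 2)).

Let gauss_near n (k : lattice n) t e : 0 <= e -> cell k t ->
  gauss_weight e (period R k) <= bnd n e * gauss_weight (e / 2) (col_of_tuple t).
Proof.
move=> e0 kt.
rewrite -[X in gauss_weight e X](subrK (col_of_tuple t)).
apply: (le_trans (gauss_weight_shift _ _ e0)).
rewrite ler_wpM2r ?gauss_weight_ge0// ler_expR ler_wpM2l//.
rewrite (le_trans _ (cell_near kt))// -(opprB (col_of_tuple t)) /sqnorm.
by apply: ler_sum => i _; rewrite mxE sqrrN.
Qed.

Let gauss_near' n (k : lattice n) t e : 0 <= e -> cell k t ->
  gauss_weight e (col_of_tuple t) <= bnd n e * gauss_weight (e / 2) (period R k).
Proof.
move=> e0 kt.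
rewrite -[X in gauss_weight e X](subrK (period R k)).
apply: (le_trans (gauss_weight_shift _ _ e0)).
by rewrite ler_wpM2r ?gauss_weight_ge0// ler_expR ler_wpM2l// cell_near.
Qed.

Let integral_w n (k : lattice n) : (\int[leb n]_t (w k t)%:E = ((2 * pi) ^+ n)%:E)%E.
Proof.
have mw : measurable_fun setT (fun t => (w k t)%:E).
  by apply/measurable_EFinP; exact: (measurable_w k).
rewrite -(ge0_integral_shift (period_tuple k) mw); last first.
  by move=> t; rewrite lee_fin w_ge0.
under eq_integral do rewrite w_shift.
transitivity (\int[leb n]_t ((chih t)%:E * 1))%E.
  by apply: eq_integral => t _; rewrite mule1.
rewrite (@ge0_integral_hcube R n (fun=> 1%E) (@measurable_cst _ _ _ _ _ 1%E)
  (fun=> lee01)).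
transitivity (\int[leb n]_t (chi t)%:E)%E.
  by apply: eq_integral => t _; rewrite mule1.
rewrite -Rint_chi /Rintegral fineK//.
exact: (integrable_fin_num _ (@rintegrable_chi R n)).
Qed.

(** Gaussian lattice sums converge, by comparison with the Gaussian integral
    over the cells. *)
Lemma rintegrable_lattice n (e : R) : 0 < e ->
  rintegrable (cnt n) (fun k => gauss_weight e (period R k)).
Proof.
move=> e0; have p0 : 0 < (2 * pi) ^+ n :> R by rewrite exprn_gt0.
pose H (z : lattice n * T n) : \bar R :=
  (gauss_weight e (period R z.1) * w z.1 z.2)%:E.
have mH : measurable_fun setT H.
  apply: measurable_lattice_prod => k.
  have mgw : measurable_fun setT
      (fun t : T n => gauss_weight e (period R k) * w k t).
    by apply: measurable_funM; [exact: measurable_cst|exact: measurable_w].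
  exact/measurable_EFinP.
have H0 z : (0 <= H z)%E by rewrite lee_fin mulr_ge0 ?gauss_weight_ge0 ?w_ge0.
have E1 k : (\int[leb n]_t H (k, t) =
    ((2 * pi) ^+ n * gauss_weight e (period R k))%:E)%E.
  have mwk : measurable_fun setT (fun t => (w k t)%:E).
    by apply/measurable_EFinP; exact: (measurable_w k).
  have w0 (t : T n) : setT t -> (0 <= (w k t)%:E)%E by rewrite lee_fin w_ge0.
  rewrite mulrC EFinM -(integral_w k) -ge0_integralZl// lee_fin.
  exact: gauss_weight_ge0.
have E2 : (\int[leb n]_t \int[cnt n]_k H (k, t) < +oo)%E.
  have e2 : 0 < e / 2 by rewrite divr_gt0.
  have := rintegrableZ (bnd n e) (rintegrable_gauss_weight n e2).
  move=> /integrableP[_].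
  apply: le_lt_trans; apply: ge0_le_integral => //.
  - by move=> t _; exact: integral_ge0.
  - exact: (measurable_fun_fubini_tonelli_G (m1 := cnt n) H mH H0).
  - apply: measurableT_comp => //; apply/measurable_EFinP/measurable_funM => //.
    by apply: measurable_gauss_weight; exact: mcol_tuple.
  - move=> t _; have [k kt] := cell_exists t.
    rewrite (@integral_lattice_single _ _ k) => [|l lk]; last first.
      rewrite /H /= /w indicE memNset ?mulr0// => lt.
      by apply: lk; exact: cell_unique lt kt.
    rewrite /H /= /w indicE mem_set// mulr1 lee_fin.
    by rewrite (le_trans (gauss_near (ltW e0) kt))// ler_norm.
have : rintegrable (cnt n) (fun k => (2 * pi) ^+ n * gauss_weight e (period R k)).
  apply/integrableP; split=> //.
  apply: le_lt_trans E2; rewrite -(fubini_tonelli _ mH H0).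
  rewrite le_eqVlt; apply/orP; left; apply/eqP; apply: eq_integral => k _.
  by rewrite E1 /= ger0_norm// mulr_ge0 ?ltW// gauss_weight_gt0.
move=> /(rintegrableZ ((2 * pi) ^+ n)^-1); apply: eq_integrable => // k _ /=.
by rewrite mulKf// gt_eqF.
Qed.

(** A bound by [gauss_weight e] splits into two halves: one makes the sum over
    the cells converge, the other is integrable over the whole space. *)
Lemma cint_tile n (f : 'cV[R]_n -> R[i]) (c e : R) :
  cmeas (fun t : T n => f (col_of_tuple t)) -> 0 < e ->
  (forall z, normc (f z) <= c * gauss_weight e z) ->
  cint (leb n) (fun t => f (col_of_tuple t)) =
  cint (cnt n) (fun k => cint (leb n)
    (fun t => (chi t)%:C * f (col_of_tuple t + period R k))).
Proof.
move=> mf e0 fe; have e2 : 0 < e / 2 by rewrite divr_gt0.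
have e4 : 0 < e / 2 / 2 by rewrite divr_gt0.
have c0 : 0 <= c.
  by have := le_trans (normc_ge0 _) (fe 0); rewrite pmulr_lge0 ?gauss_weight_gt0.
pose H (z : lattice n * T n) := (w z.1 z.2)%:C * f (col_of_tuple z.2).
have mH : cmeas H.
  apply: cmeas_lattice_prod => k; apply: cmeasM => //.
  by apply: cmeas_real; exact: (measurable_w k).
have leH k t : normc (H (k, t)) <= bnd n (e / 2) * gauss_weight (e / 2 / 2) (period R k) *
    (c * gauss_weight (e / 2) (col_of_tuple t)).
  rewrite /H normcM normc_real ger0_norm ?w_ge0//= /w indicE.
  have [kt|nkt] := pselect (cell k t); last first.
    rewrite memNset// mul0r; apply: mulr_ge0; apply: mulr_ge0 => //.
    - exact: expR_ge0.
    - exact: gauss_weight_ge0.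
    - exact: gauss_weight_ge0.
  rewrite mem_set// mul1r (le_trans (fe _))// gauss_weight_half mulrCA.
  rewrite ler_wpM2r ?mulr_ge0 ?gauss_weight_ge0//.
  exact: (gauss_near' (ltW e2) kt).
have ia := rintegrableZ (bnd n (e / 2)) (rintegrable_lattice n e4).
have ib := rintegrableZ c (rintegrable_gauss_weight n e2).
have := cint_swap ia ib _ _ mH leH.
move=> /(_ (fun k => mulr_ge0 (expR_ge0 _) (gauss_weight_ge0 _ _))).
move=> /(_ (fun t => mulr_ge0 c0 (gauss_weight_ge0 _ _))) sw.
transitivity (cint (leb n) (fun t => cint (cnt n) (fun k => H (k, t)))).
  apply: eq_cint => t; have [k kt] := cell_exists t.
  rewrite (@cint_lattice_single _ _ k) => [|l lk]; last first.
    rewrite /H /= /w indicE memNset ?mul0r// => lt.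
    by apply: lk; exact: cell_unique lt kt.
  by rewrite /H /= /w indicE mem_set// mul1r.
rewrite -sw; apply: eq_cint => k.
have mHk : cmeas (fun t => H (k, t)) := cmeas_comp mH (pair1_measurable k).
rewrite -(cint_shift (period_tuple k) mHk).
under eq_cint do rewrite /H /= w_shift col_shift.
rewrite cint_hcube//.
under eq_fun do rewrite -col_shift.
exact: (cmeas_comp mf (measurable_shift_tuple _)).
Qed.

End lattice_tiling.

(** * The Gaussian integral with complex coefficients *)

Section complex_derivative.
Variable R : realType.
Local Notation C := R[i].

Definition cder (f : R -> C) (x : R) (l : C) :=
  is_derive x (1 : R) (fun s => complex.Re (f s) : R) (complex.Re l) /\
  is_derive x (1 : R) (fun s => complex.Im (f s) : R) (complex.Im l).

Lemma cder_eq f x l l' : cder f x l -> l = l' -> cder f x l'.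
Proof. by move=> + <-. Qed.

Lemma cder_cst (c : C) x : cder (fun=> c) x 0.
Proof. by split => /=; exact: is_derive_cst. Qed.

Lemma cderD f g x a b : cder f x a -> cder g x b ->
  cder (fun s => f s + g s) x (a + b).
Proof.
move=> [f1 f2] [g1 g2]; split.
- by under eq_fun do rewrite ReD; rewrite ReD; exact: is_deriveD.
- by under eq_fun do rewrite ImD; rewrite ImD; exact: is_deriveD.
Qed.

Lemma cderM f g x a b : cder f x a -> cder g x b ->
  cder (fun s => f s * g s) x (a * g x + f x * b).
Proof.
move=> [f1 f2] [g1 g2]; split.
- under eq_fun do rewrite ReM; apply: is_derive_eq.
  by rewrite /GRing.scale/= ReD !ReM; ring.
- under eq_fun do rewrite ImM; apply: is_derive_eq.
  by rewrite /GRing.scale/= ImD !ImM; ring.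
Qed.

Lemma cderZ c f x a : cder f x a -> cder (fun s => c * f s) x (c * a).
Proof. by move=> fa; apply: (cder_eq (cderM (cder_cst c x) fa)); ring. Qed.

Lemma cder_id x : cder (fun s => s%:C) x 1.
Proof. by split => /=; [exact: is_derive_id|exact: is_derive_cst]. Qed.

Lemma cder_cexp f x a : cder f x a ->
  cder (fun s => cexp (f s)) x (cexp (f x) * a).
Proof.
move=> [f1 f2]; split; rewrite /cexp /=; apply: is_derive_eq;
  rewrite /GRing.scale/= ?ReM ?ImM /=; ring.
Qed.

Lemma cder0_cst f : (forall x, cder f x 0) -> forall x y, f x = f y.
Proof.
move=> f0 x y; apply: complex_eqP.
- apply: (@is_derive_0_is_cst _ (fun s => complex.Re (f s))) => s.
  by have [] := f0 s.
- apply: (@is_derive_0_is_cst _ (fun s => complex.Im (f s))) => s.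
  by have [] := f0 s.
Qed.

Section under_integral.
Context d (T : measurableType d) (mu : {measure set T -> \bar R}).

Lemma is_derive_Rintegral (f f' : R -> T -> R) (G H : T -> R) (x e : R) : 0 < e ->
  (forall s, measurable_fun setT (f s)) ->
  (forall s t, `|s - x| < e -> `|f s t| <= H t) -> rintegrable mu H ->
  (forall s t, is_derive s (1 : R) (f^~ t : R -> R) (f' s t)) ->
  (forall s t, `|s - x| < e -> `|f' s t| <= G t) -> rintegrable mu G ->
  is_derive x (1 : R) (fun s => \int[mu]_t f s t) (\int[mu]_t f' x t).
Proof.
move=> e0 mf fH iH df fG iG.
have IE s : `](x - e), (x + e)[%classic s -> `|s - x| < e.
  by rewrite /= in_itv/= ltr_distl => /andP[-> ->].
have xx : `](x - e), (x + e)[%classic x.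
  by rewrite /= in_itv/= ltrDl e0 ltrBlDr ltrDl e0.
have d1E s t : partial1of2 f s t = f' s t.
  by rewrite partial1of2E; have [_ ->] := df s t.
have G0 t : 0 <= G t.
  by apply: le_trans (fG x t _) => //; rewrite subrr normr0.
have intf s : `](x - e), (x + e)[%classic s -> mu.-integrable setT (EFin \o f s).
  by move=> /IE sx; apply: (rintegrable_le (mf s) _ iH) => t; exact: fH.
have derf s t : `](x - e), (x + e)[%classic s -> setT t -> derivable (f^~ t) s 1.
  by move=> _ _; have [] := df s t.
have Gub s t : `](x - e), (x + e)[%classic s -> setT t ->
    `|partial1of2 f s t| <= G t.
  by move=> /IE sx _; rewrite d1E fG.
apply: DeriveDef.
  exact: (derivable_under_integral measurableT xx intf derf G0 iG Gub).
rewrite -derive1E.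
rewrite (differentiation_under_integral measurableT xx intf derf G0 iG Gub).
by apply: eq_Rintegral => t _; rewrite d1E.
Qed.

Lemma cder_cint (f f' : R -> T -> C) (G H : T -> R) (x : R) :
  (forall s, cmeas (f s)) ->
  (forall s t, `|s - x| < 1 -> normc (f s t) <= H t) -> rintegrable mu H ->
  (forall s t, cder (f^~ t) s (f' s t)) ->
  (forall s t, `|s - x| < 1 -> normc (f' s t) <= G t) -> rintegrable mu G ->
  cder (fun s => cint mu (f s)) x (cint mu (f' x)).
Proof.
move=> mf fH iH df fG iG; split; rewrite ?Re_cint ?Im_cint /=.
- apply: (@is_derive_Rintegral (fun s t => complex.Re (f s t))
    (fun s t => complex.Re (f' s t)) G H x 1) => //.
  + by move=> s; case: (mf s).
  + by move=> s t sx; apply: le_trans (fH s t sx); exact: normc_Re.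
  + by move=> s t; case: (df s t).
  + by move=> s t sx; apply: le_trans (fG s t sx); exact: normc_Re.
- apply: (@is_derive_Rintegral (fun s t => complex.Im (f s t))
    (fun s t => complex.Im (f' s t)) G H x 1) => //.
  + by move=> s; case: (mf s).
  + by move=> s t sx; apply: le_trans (fH s t sx); exact: normc_Im.
  + by move=> s t; case: (df s t).
  + by move=> s t sx; apply: le_trans (fG s t sx); exact: normc_Im.
Qed.

End under_integral.

End complex_derivative.

Lemma poly_absorb (R : realType) (e y : R) : 0 < e -> 0 <= y ->
  (1 + y) * expR (- (e * y)) <= (1 + 2 / e) * expR (- (e / 2 * y)).
Proof.
move=> e0 y0.
have -> : expR (- (e * y)) = expR (- (e / 2 * y)) * expR (- (e / 2 * y)).
  by rewrite -expRD; congr expR; lra.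
rewrite mulrA ler_pM2r ?expR_gt0// expRN ler_pdivrMr ?expR_gt0//.
have h1 := expR_ge1Dx (e / 2 * y).
have i0 : 0 < 2 / e by rewrite divr_gt0.
have e20 : 0 <= e / 2 * y by rewrite mulr_ge0// divr_ge0// ltW.
apply: le_trans (_ : (1 + 2 / e) * (1 + e / 2 * y) <= _).
  have -> : (1 + 2 / e) * (1 + e / 2 * y) = 1 + y + (2 / e + e / 2 * y).
    by field; rewrite gt_eqF.
  by rewrite lerDl addr_ge0// ltW.
by rewrite ler_wpM2l// addr_ge0// ltW.
Qed.

Section gauss1.
Variable R : realType.
Local Notation C := R[i].
Local Notation leb1 := (@lebesgue_measure R).

Let wt (e : R) (t : R) : R := expR (- (e * t ^+ 2)).

(** Integrals of derivatives vanish: differentiate the translation-invariant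
    integral of [t |-> f (t + s)] in [s]. *)
Lemma cint_derivative (f f' : R -> C) (c e : R) : 0 < e ->
  cmeas (f : measurableTypeR R -> C) ->
  (forall t, cder f t (f' t)) ->
  (forall t, normc (f t) <= c * wt e t) ->
  (forall t, normc (f' t) <= c * wt e t) ->
  cint leb1 f' = 0.
Proof.
move=> e0 mf df fb f'b.
have c0 : 0 <= c.
  by have := le_trans (normc_ge0 _) (fb 0); rewrite pmulr_lge0 ?expR_gt0.
pose B t := c * expR e * wt (e / 2) t.
have iB : rintegrable leb1 B.
  by apply/rintegrableZ/rintegrable_gauss1; rewrite divr_gt0.
have wB s t : `|s - 0| < 1 -> c * wt e (t + s) <= B t.
  rewrite subr0 => s1; rewrite /B -mulrA ler_wpM2l// /wt -expRD ler_expR.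
  have s2 : s ^+ 2 <= 1 by rewrite -real_normK ?num_real// expr_le1// ltW.
  have h : t ^+ 2 / 2 - s ^+ 2 <= (t + s) ^+ 2.
    by have := sqr_ge0 (t + 2 * s); rewrite !expr2; lra.
  have := ler_wpM2l (ltW e0) h; have := ler_wpM2l (ltW e0) s2; lra.
pose g (s t : R) := f (t + s).
have dg : cder (fun s => cint leb1 (g s)) 0 (cint leb1 (fun t => f' (t + 0))).
  apply: (@cder_cint _ _ _ leb1 g (fun s t => f' (t + s)) B B) => //.
  - move=> s; apply: (cmeas_comp mf).
    by apply: measurable_funD.
  - by move=> s t /(wB s t); apply: le_trans; rewrite ?fb ?f'b.
  - move=> s t; have [d1 d2] := df (t + s); rewrite /g.
    have h : is_derive s (1 : R) (fun s => t + s : R) 1.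
      have -> : (fun s => t + s) = shift t by apply/funext => y; rewrite addrC.
      exact: is_derive_shift.
    split.
    + have := is_derive1_comp d1 h.
      by rewrite mulr1.
    + have := is_derive1_comp d2 h.
      by rewrite mulr1.
  - by move=> s t /(wB s t); apply: le_trans; rewrite ?fb ?f'b.
have sh s : cint leb1 (g s) = cint leb1 f by exact: cint_shift1.
have [d1 d2] := dg.
have cc (h : R -> R) l : (forall s, h s = h 0) -> is_derive (0 : R) (1 : R) h l -> l = 0.
  move=> hc [_ <-]; have -> : h = cst (h 0) by apply/funext.
  by rewrite derive_cst.
have -> : f' = (fun t => f' (t + 0)) by apply/funext => t; rewrite addr0.
apply: complex_eqP.
- by apply: cc d1 => s; rewrite !sh.
- by apply: cc d2 => s; rewrite !sh.
Qed.

Definition gauss1 (a u : C) (t : R) : C :=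
  cexp (- (a / 2) * (t ^+ 2)%:C + u * t%:C).

Lemma Re_gauss1_exponent (a u : C) (t : R) :
  complex.Re (- (a / 2) * (t ^+ 2)%:C + u * t%:C) =
  - (complex.Re a / 2 * t ^+ 2) + complex.Re u * t.
Proof.
have -> : a / 2 = (2^-1)%:C * a by rewrite mulrC rmorphV ?unitfE// rmorph_nat.
rewrite ReD !ReM ReN /= !ReM/=; ring.
Qed.

Lemma normc_gauss1 (a u : C) (t : R) : 0 < complex.Re a ->
  normc (gauss1 a u t) <=
  expR (complex.Re u ^+ 2 / complex.Re a) * wt (complex.Re a / 4) t.
Proof.
move=> a0; rewrite /gauss1 normc_cexp Re_gauss1_exponent /wt -expRD ler_expR.
move: (complex.Re a) (complex.Re u) a0 => a1 u1 a0.
have -> : u1 ^+ 2 / a1 = a1^-1 * (u1 - a1 / 2 * t) ^+ 2 + (u1 * t - a1 / 4 * t ^+ 2).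
  by field; rewrite gt_eqF.
have : 0 <= a1^-1 * (u1 - a1 / 2 * t) ^+ 2.
  by rewrite mulr_ge0 ?sqr_ge0// invr_ge0 ltW.
lra.
Qed.

Lemma cmeas_gauss1 (a u : C) : cmeas (gauss1 a u : measurableTypeR R -> C).
Proof.
apply/cmeas_cexp/cmeasD; apply: cmeasM; try exact: cmeas_cst;
  by apply: cmeas_real => //; exact: measurable_funX.
Qed.

Lemma cmeas_id : cmeas (fun t : measurableTypeR R => (t : R)%:C).
Proof. by apply: cmeas_real; exact: measurable_id. Qed.

Let absorb (e t : R) (j : nat) : 0 < e -> (j <= 2)%N ->
  `|t| ^+ j * wt e t <= (1 + 2 / e) * wt (e / 2) t.
Proof.
move=> e0 j2; apply: le_trans (poly_absorb e0 (sqr_ge0 t)).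
rewrite ler_wpM2r ?expR_ge0//; case: j j2 => [|[|[|//]]] _.
- by rewrite expr0 lerDl sqr_ge0.
- have := sqr_ge0 (`|t| - 1); rewrite sqrrB1 real_normK ?num_real// expr1.
  by have := sqr_ge0 t; have := normr_ge0 t; lra.
- by rewrite real_normK ?num_real// lerDr.
Qed.

(** The bound sees [u] only through [U], which makes it locally uniform in a
    parameter. *)
Lemma normc_mono_gauss1 (a u b : C) (t : R) (j : nat) (U : R) :
  0 < complex.Re a -> (j <= 2)%N -> complex.Re u ^+ 2 <= U ->
  normc (b * (t ^+ j)%:C * gauss1 a u t) <=
  normc b * expR (U / complex.Re a) * (1 + 2 / (complex.Re a / 4)) *
    wt (complex.Re a / 4 / 2) t.
Proof.
move=> a0 j2 uU; have a4 : 0 < complex.Re a / 4 by rewrite divr_gt0.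
rewrite !normcM normc_real normrX -!mulrA ler_wpM2l ?normc_ge0//.
apply: le_trans (ler_wpM2l _ (normc_gauss1 u t a0)) _; first exact: exprn_ge0.
rewrite mulrCA; apply: ler_pM; rewrite ?expR_ge0 ?mulr_ge0 ?exprn_ge0 ?expR_ge0//.
  by rewrite ler_expR ler_wpM2r// invr_ge0 ltW.
by have := absorb t a4 j2; rewrite -[_ / 4 / 2]mulrA.
Qed.

Let d_gauss1 (a u : C) (t : R) :
  cder (gauss1 a u) t (gauss1 a u t * (u - a * t%:C)).
Proof.
have d2 : cder (fun t => (t ^+ 2)%:C) t (2 * t%:C).
  have -> : (fun t => (t ^+ 2)%:C) = (fun t : R => t%:C * t%:C).
    by apply/funext => y; rewrite expr2 rmorphM.
  by apply: (cder_eq (cderM (cder_id t) (cder_id t))); ring.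
apply: (cder_eq (cder_cexp (cderD (cderZ _ d2) (cderZ _ (cder_id t))))).
by rewrite /gauss1; congr (_ * _); field.
Qed.

Let iwt (e c : R) : 0 < e -> rintegrable leb1 (fun t => c * wt e t).
Proof. by move=> e0; apply/rintegrableZ/rintegrable_gauss1. Qed.

Section fixed.
Variables a u : C.
Hypothesis a0 : 0 < complex.Re a.

Let a80 : 0 < complex.Re a / 4 / 2.
Proof. by rewrite !divr_gt0. Qed.

Lemma cintegrable_mono_gauss1 (b : C) (j : nat) : (j <= 2)%N ->
  cintegrable leb1 (fun t => b * (t ^+ j)%:C * gauss1 a u t).
Proof.
move=> j2; apply: cintegrable_le (iwt _ a80).
- apply: cmeasM; last exact: cmeas_gauss1.
  apply: cmeasM; first exact: cmeas_cst.
  by apply: cmeas_real => //; exact: measurable_funX.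
- by move=> t; exact: normc_mono_gauss1.
Qed.

(** Integration of the derivative of [gauss1 a u], which is
    [gauss1 a u t * (u - a t)]. *)
Lemma gauss1_moment1 :
  cint leb1 (fun t => t%:C * gauss1 a u t) = u / a * cint leb1 (gauss1 a u).
Proof.
have an0 : a != 0 by apply/eqP => a_0; move: a0; rewrite a_0 ltxx.
have e0 t : gauss1 a u t = 1 * (t ^+ 0)%:C * gauss1 a u t.
  by rewrite expr0 !mul1r.
have e1 t : t%:C * gauss1 a u t = 1 * (t ^+ 1)%:C * gauss1 a u t.
  by rewrite expr1 mul1r.
have i0 := cintegrable_mono_gauss1 1 (isT : (0 <= 2)%N).
have i1 := cintegrable_mono_gauss1 1 (isT : (1 <= 2)%N).
rewrite -(funext e0) in i0; rewrite -(funext e1) in i1.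
pose c (b : C) (U : R) :=
  normc b * expR (U / complex.Re a) * (1 + 2 / (complex.Re a / 4)).
have c0 b U : 0 <= c b U.
  by rewrite !mulr_ge0 ?normc_ge0 ?expR_ge0// addr_ge0// divr_ge0// ltW// divr_gt0.
pose K := c 1 (complex.Re u ^+ 2) +
  (c u (complex.Re u ^+ 2) + c a (complex.Re u ^+ 2)).
have b0 t : normc (gauss1 a u t) <= K * wt (complex.Re a / 4 / 2) t.
  rewrite e0; apply: le_trans (normc_mono_gauss1 1 t a0 _ (lexx _)) _ => //.
  by rewrite ler_wpM2r ?expR_ge0// lerDl addr_ge0.
have Z : (fun t => gauss1 a u t * (u - a * t%:C)) =
    (fun t => u * gauss1 a u t + - a * (t%:C * gauss1 a u t)).
  by apply/funext => t; ring.
have b1 t : normc (gauss1 a u t * (u - a * t%:C)) <=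
    K * wt (complex.Re a / 4 / 2) t.
  rewrite [X in normc X](congr1 (fun f => f t) Z).
  apply: le_trans (le_normcD _ _) _; rewrite /K mulrDl.
  apply: ler_wpDl; first by rewrite mulr_ge0 ?expR_ge0.
  rewrite mulrDl; apply: lerD.
  + have -> : u * gauss1 a u t = u * (t ^+ 0)%:C * gauss1 a u t by rewrite expr0 mulr1.
    exact: normc_mono_gauss1.
  + rewrite mulNr normcN mulrA -[t in t%:C]expr1.
    exact: normc_mono_gauss1.
have := cint_derivative a80 (cmeas_gauss1 a u) (@d_gauss1 a u) b0 b1.
rewrite Z cintD ?cintZ//; [|exact: cintegrableZ..] => /eqP.
rewrite mulNr subr_eq0 => /eqP h.
by rewrite mulrAC h mulrC mulKf.
Qed.

End fixed.

(** Integration of the derivative of [t |-> t gauss1 a 0 t]. *)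
Lemma gauss1_moment2 (a : C) : 0 < complex.Re a ->
  cint leb1 (fun t => (t ^+ 2)%:C * gauss1 a 0 t) = a^-1 * cint leb1 (gauss1 a 0).
Proof.
move=> a0; have a80 : 0 < complex.Re a / 4 / 2 by rewrite !divr_gt0.
have an0 : a != 0 by apply/eqP => a_0; move: a0; rewrite a_0 ltxx.
have u0 : complex.Re (0 : C) ^+ 2 <= 0 :> R by rewrite expr0n.
pose c (b : C) :=
  normc b * expR (0 / complex.Re a) * (1 + 2 / (complex.Re a / 4)).
have c0 b : 0 <= c b.
  by rewrite !mulr_ge0 ?normc_ge0 ?expR_ge0// addr_ge0// divr_ge0// ltW// divr_gt0.
have M b j t : (j <= 2)%N -> normc (b * (t ^+ j)%:C * gauss1 a 0 t) <=
    c b * wt (complex.Re a / 4 / 2) t.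
  by move=> j2; exact: normc_mono_gauss1.
pose F t := t%:C * gauss1 a 0 t.
pose F' t := 1 * (t ^+ 0)%:C * gauss1 a 0 t + (- a) * (t ^+ 2)%:C * gauss1 a 0 t.
have dF t : cder F t (F' t).
  apply: (cder_eq (cderM (cder_id t) (d_gauss1 a 0 t))).
  by rewrite /F' expr0 rmorphXn/=; ring.
have F0 t : normc (F t) <= (c 1 + c (- a)) * wt (complex.Re a / 4 / 2) t.
  have -> : F t = 1 * (t ^+ 1)%:C * gauss1 a 0 t by rewrite mul1r.
  by apply: le_trans (M _ _ _ _) _; rewrite ?ler_wpM2r ?expR_ge0// lerDl.
have F1 t : normc (F' t) <= (c 1 + c (- a)) * wt (complex.Re a / 4 / 2) t.
  by apply: le_trans (le_normcD _ _) _; rewrite mulrDl lerD// M.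
have mF : cmeas (F : measurableTypeR R -> C).
  by apply: cmeasM; [exact: cmeas_id|exact: cmeas_gauss1].
have := cint_derivative a80 mF dF F0 F1.
rewrite cintD; [|exact: cintegrable_mono_gauss1..] => E.
have E2 : cint leb1 (fun t => - a * (t ^+ 2)%:C * gauss1 a 0 t) =
    - a * cint leb1 (fun t => (t ^+ 2)%:C * gauss1 a 0 t).
  rewrite -cintZ.
    by apply: eq_cint => t; rewrite mulrA.
  have := cintegrable_mono_gauss1 0 a0 1 (leqnn 2).
  by under eq_fun do rewrite mul1r.
have E0 : cint leb1 (fun t => 1 * (t ^+ 0)%:C * gauss1 a 0 t) =
    cint leb1 (gauss1 a 0).
  by apply: eq_cint => t; rewrite expr0 !mul1r.
move: E; rewrite E0 E2 mulNr => /eqP; rewrite subr_eq0 => /eqP ->.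
by rewrite mulKf.
Qed.

(** The linear term: [s |-> cint (gauss1 a (s u)) * exp (- s^2 u^2 / 2a)] has
    derivative zero by the first moment identity. *)
Lemma cint_gauss1_linear (a u : C) : 0 < complex.Re a ->
  cint leb1 (gauss1 a u) = cint leb1 (gauss1 a 0) * cexp (u ^+ 2 / (2 * a)).
Proof.
move=> a0; have a80 : 0 < complex.Re a / 4 / 2 by rewrite !divr_gt0.
have an0 : a != 0 by apply/eqP => a_0; move: a0; rewrite a_0 ltxx.
pose M (s : R) := cint leb1 (gauss1 a (s%:C * u)).
have dM s : cder M s (u * (s%:C * u / a * M s)).
  pose U := (`|s| + 1) ^+ 2 * complex.Re u ^+ 2.
  have hU r : `|r - s| < 1 -> complex.Re (r%:C * u) ^+ 2 <= U.
    move=> rs; rewrite ReM /= mul0r subr0 exprMn ler_wpM2r ?sqr_ge0//.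
    rewrite -real_normK ?num_real// ler_sqr ?nnegrE ?addr_ge0//.
    rewrite -lerBlDl ltW//; apply: le_lt_trans rs; exact: lerB_dist.
  pose c (b : C) :=
    normc b * expR (U / complex.Re a) * (1 + 2 / (complex.Re a / 4)).
  rewrite -gauss1_moment1// -cintZ; last first.
    have := cintegrable_mono_gauss1 (s%:C * u) a0 1 (isT : (1 <= 2)%N).
    by under eq_fun do rewrite mul1r.
  apply: (@cder_cint _ _ _ leb1 (fun s t => gauss1 a (s%:C * u) t)
    (fun s t => u * (t%:C * gauss1 a (s%:C * u) t))
    (fun t => c u * wt (complex.Re a / 4 / 2) t)
    (fun t => c 1 * wt (complex.Re a / 4 / 2) t)).
  - by move=> r; exact: cmeas_gauss1.
  - move=> r t /hU rU; have -> : gauss1 a (r%:C * u) t =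
      1 * (t ^+ 0)%:C * gauss1 a (r%:C * u) t by rewrite expr0 !mul1r.
    exact: normc_mono_gauss1.
  - exact: iwt.
  - move=> r t; have h : cder (fun r : R => r%:C * u * t%:C) r (u * t%:C).
      have -> : (fun r : R => r%:C * u * t%:C) = (fun r : R => u * t%:C * r%:C).
        by apply/funext => y; ring.
      by apply: (cder_eq (cderZ _ (cder_id r))); rewrite mulr1.
    apply: (cder_eq (cder_cexp (cderD (cder_cst (- (a / 2) * (t ^+ 2)%:C) r) h))).
    by rewrite /gauss1; ring.
  - move=> r t /hU rU; rewrite mulrA -[t in t%:C]expr1.
    exact: normc_mono_gauss1.
  - exact: iwt.
pose N s := M s * cexp (- (u ^+ 2 / (2 * a)) * (s%:C * s%:C)).
have dN s : cder N s 0.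
  have d2 := cderM (cder_id s) (cder_id s).
  apply: (cder_eq (cderM (dM s) (cder_cexp (cderZ (- (u ^+ 2 / (2 * a))) d2)))).
  by field.
have := cder0_cst dN 1 0.
rewrite /N /M rmorph0 rmorph1 !mul0r !mulr0 cexp0 !mul1r !mulr1 => <-.
by rewrite -mulrA -cexpD addNr cexp0 mulr1.
Qed.

(** The total mass of the normal density of variance [1 / a]. *)
Lemma cint_gauss1_real (a : R) : 0 < a ->
  cint leb1 (gauss1 a%:C 0) ^+ 2 * a%:C = (2 * pi)%:C.
Proof.
move=> a0; have s0 : Num.sqrt a^-1 != 0 by rewrite gt_eqF// sqrtr_gt0 invr_gt0.
have := @integral_normal_pdf R 0 (Num.sqrt a^-1).
have gE x : gauss1 a%:C 0 x = cexp (- (a / 2 * x ^+ 2))%:C.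
  rewrite /gauss1 mul0r addr0; congr cexp.
  by rewrite rmorphN !rmorphM/= rmorphV ?unitfE//= rmorph_nat mulNr.
have E x : normal_pdf 0 (Num.sqrt a^-1) x =
    normal_peak (Num.sqrt a^-1) * complex.Re (gauss1 a%:C 0 x).
  rewrite /normal_pdf (negbTE s0); congr (_ * _).
  rewrite gE /cexp/= cos0 mulr1 /normal_fun; congr expR.
  rewrite subr0 sqr_sqrtr ?invr_ge0 ?ltW// -mulr_natr.
  by field; rewrite gt_eqF.
move=> /(congr1 fine); rewrite -/(Rintegral _ _ _).
have -> : normal_pdf 0 (Num.sqrt a^-1) =
    (fun x => normal_peak (Num.sqrt a^-1) * complex.Re (gauss1 a%:C 0 x)).
  exact/funext.
have ig : cintegrable leb1 (gauss1 a%:C 0).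
  have := cintegrable_mono_gauss1 0 (a0 : 0 < complex.Re a%:C) 1 (leq0n 2).
  by under eq_fun do rewrite expr0 !mul1r.
have [ig1 _] := rintegrable_normc ig.
rewrite RintegralZl// -Re_cint => P.
have I0 : complex.Im (cint leb1 (gauss1 a%:C 0)) = 0.
  rewrite Im_cint; transitivity (\int[leb1]_(x in setT) (0 : R)).
    by apply: eq_Rintegral => x _; rewrite gE /= sin0 mulr0.
  by rewrite Rintegral_cst//= mul0r.
have p0 := normal_peak_gt0 s0.
have r0 : complex.Re (cint leb1 (gauss1 a%:C 0)) = (normal_peak (Num.sqrt a^-1))^-1.
  by apply: (mulfI (lt0r_neq0 p0)); rewrite P /= mulfV// gt_eqF.
have -> : cint leb1 (gauss1 a%:C 0) = ((normal_peak (Num.sqrt a^-1))^-1)%:C.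
  exact: complex_eqP.
rewrite -rmorphXn/= -rmorphM/=; congr (_ %:C).
rewrite /normal_peak invrK sqr_sqrtr; last first.
  by rewrite mulrn_wge0// mulr_ge0 ?sqr_ge0 ?pi_ge0.
rewrite sqr_sqrtr ?invr_ge0 ?ltW// -mulr_natr.
by field; rewrite gt_eqF.
Qed.

(** Along the segment from [Re a] to [a], the second moment identity makes the
    product of the parameter by the square of the integral constant. Taking the
    square leaves the choice of a branch to [cint_ggauss_det]. *)
Lemma cint_gauss1_sqr (a : C) : 0 < complex.Re a ->
  cint leb1 (gauss1 a 0) ^+ 2 * a = (2 * pi)%:C.
Proof.
move=> a0; pose p (s : R) : C := (complex.Re a)%:C + (0 +i* complex.Im a) * s%:C.
have p1 : p 1 = a by apply: complex_eqP; rewrite /p ?ReD ?ImD ?ReM ?ImM /=; ring.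
have Rp s : complex.Re (p s) = complex.Re a.
  by rewrite /p ReD ReM /=; ring.
have p0 s : p s != 0 by apply/eqP => ps; move: a0; rewrite -(Rp s) ps ltxx.
have dp s : cder p s (0 +i* complex.Im a).
  apply: (cder_eq (cderD (cder_cst _ s) (cderZ _ (cder_id s)))).
  by rewrite add0r mulr1.
pose M (s : R) := cint leb1 (gauss1 (p s) 0).
have u0 : complex.Re (0 : C) ^+ 2 <= 0 :> R by rewrite expr0n.
have a80 : 0 < complex.Re a / 4 / 2 by rewrite !divr_gt0.
pose c (b : C) :=
  normc b * expR (0 / complex.Re a) * (1 + 2 / (complex.Re a / 4)).
have B s b j t : (j <= 2)%N -> normc (b * (t ^+ j)%:C * gauss1 (p s) 0 t) <=
    c b * wt (complex.Re a / 4 / 2) t.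
  move=> j2; rewrite /c -(Rp s); apply: normc_mono_gauss1 => //.
  by rewrite Rp.
pose b : C := - ((0 +i* complex.Im a) / 2).
have dM s : cder M s (b * ((p s)^-1 * M s)).
  rewrite -gauss1_moment2 ?Rp// -cintZ; last first.
    have ps0 : 0 < complex.Re (p s) by rewrite Rp.
    have := cintegrable_mono_gauss1 0 ps0 1 (leqnn 2).
    by under eq_fun do rewrite mul1r.
  apply: (@cder_cint _ _ _ leb1 (fun s t => gauss1 (p s) 0 t)
    (fun s t => b * ((t ^+ 2)%:C * gauss1 (p s) 0 t))
    (fun t => c b * wt (complex.Re a / 4 / 2) t)
    (fun t => c 1 * wt (complex.Re a / 4 / 2) t)).
  - by move=> r; exact: cmeas_gauss1.
  - move=> r t _; have -> : gauss1 (p r) 0 t =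
      1 * (t ^+ 0)%:C * gauss1 (p r) 0 t by rewrite expr0 !mul1r.
    exact: B.
  - exact: iwt.
  - move=> r t; have h : cder (fun r : R => - (p r / 2) * (t ^+ 2)%:C + 0 * t%:C) r
        (b * (t ^+ 2)%:C).
      have -> : (fun r : R => - (p r / 2) * (t ^+ 2)%:C + 0 * t%:C) =
          (fun r : R => - (2^-1 * (t ^+ 2)%:C) * p r).
        by apply/funext => y; ring.
      by apply: (cder_eq (cderZ _ (dp r))); rewrite /b; ring.
    by apply: (cder_eq (cder_cexp h)); rewrite /gauss1; ring.
  - by move=> r t _; rewrite mulrA; exact: B.
  - exact: iwt.
pose Q s := M s * M s * p s.
have dQ s : cder Q s 0.
  apply: (cder_eq (cderM (cderM (dM s) (dM s)) (dp s))).
  by rewrite /b; field.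
have := cder0_cst dQ 1 0.
rewrite /Q /M -!expr2 p1 => ->.
have -> : p 0 = (complex.Re a)%:C by rewrite /p mulr0 addr0.
exact: cint_gauss1_real.
Qed.

End gauss1.

(** * Quadratic forms and Schur complements *)

Section quadratic_forms.
Variable R : realType.
Local Notation C := R[i].

Definition qform n (T : 'M[C]_n) (z : 'cV[R]_n) : C :=
  \sum_i \sum_j T i j * ((z i 0)%:C * (z j 0)%:C).

Definition lform n (u : 'cV[C]_n) (z : 'cV[R]_n) : C :=
  \sum_i u i 0 * (z i 0)%:C.

Definition coercive n (e : R) (T : 'M[C]_n) :=
  forall z, e * sqnorm z <= complex.Re (qform T z).

Lemma half_formE n (S : 'M[C]_n) z : half_form S z = qform S z / 2.
Proof.
rewrite /half_form /qform -mulmxA mxE; congr (_ / _); apply: eq_bigr => i _.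
rewrite !mxE mulr_sumr; apply: eq_bigr => j _.
by rewrite !mxE mulrCA.
Qed.

Lemma Re_qform n (T : 'M[C]_n) z :
  complex.Re (qform T z) = (z^T *m map_mx (@complex.Re R) T *m z) 0 0.
Proof.
rewrite -mulmxA mxE Re_sum; apply: eq_bigr => i _.
rewrite Re_sum !mxE mulr_sumr; apply: eq_bigr => j _.
by rewrite !mxE !ReM /=; ring.
Qed.

Lemma continuous_sumf (V : topologicalType) (I : Type) (r : seq I)
    (F : I -> V -> R) : (forall i, continuous (F i)) ->
  continuous (fun v => \sum_(i <- r) F i v).
Proof.
move=> cF v; elim: r => [|i r ih].
  by under eq_fun do rewrite big_nil; exact: cvg_cst.
under eq_fun do rewrite big_cons.
by apply: cvgD => //; exact: cF.
Qed.

Lemma continuous_mulf (V : topologicalType) (f g : V -> R) :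
  continuous f -> continuous g -> continuous (fun v => f v * g v).
Proof. by move=> cf cg v; exact: (continuousM (cf v) (cg v)). Qed.

Lemma continuous_addf (V : topologicalType) (f g : V -> R) :
  continuous f -> continuous g -> continuous (fun v => f v + g v).
Proof. by move=> cf cg v; exact: (continuousD (cf v) (cg v)). Qed.

(** A positive form is bounded below on the unit sphere, by compactness. *)
Lemma coercive_posdef n (T : 'M[C]_n) :
  (forall v : 'cV[R]_n, v != 0 ->
    0 < (v^T *m map_mx (@complex.Re R) T *m v) 0 0) ->
  exists2 e : R, 0 < e & coercive e T.
Proof.
move=> pT; pose f (v : 'rV[R]_n) : R :=
  \sum_i \sum_j complex.Re (T i j) * (v 0 i * v 0 j).
have fE z : complex.Re (qform T z) = f z^T.
  rewrite /qform /f Re_sum; apply: eq_bigr => i _; rewrite Re_sum.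
  by apply: eq_bigr => j _; rewrite !mxE !ReM /=; ring.
have cf : continuous f.
  apply: continuous_sumf => i; apply: continuous_sumf => j.
  apply: continuous_mulf; first exact: cst_continuous.
  by apply: continuous_mulf; exact: coord_continuous.
pose g (v : 'rV[R]_n) : R := \sum_i v 0 i ^+ 2.
have gE z : sqnorm z = g z^T.
  by apply: eq_bigr => i _; rewrite mxE.
have cg : continuous g.
  apply: continuous_sumf => j; under eq_fun do rewrite expr2.
  by apply: continuous_mulf; exact: coord_continuous.
pose K := [set v | g v = 1].
have Kcpt : compact K.
  apply: bounded_closed_compact.
    exists 1; split; first exact: num_real.
    move=> M M1 v Kv /=; rewrite [leLHS]/Num.norm /= mx_normrE.
    apply/bigmax_leP; split => [|[i j] _ /=]; first by rewrite (le_trans ler01)// ltW.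
    rewrite (le_trans _ (ltW M1))// -(@ler_pXn2r _ 2)// ?nnegrE//.
    rewrite expr1n real_normK ?num_real// -Kv /g (bigD1 j)//= ord1 lerDl.
    by apply: sumr_ge0 => k _; exact: sqr_ge0.
  have -> : K = g @^-1` [set 1] by [].
  by apply: closed_comp => [v _|]; [exact: cg|exact: closed_eq].
have fpos v : K v -> 0 < f v.
  move=> Kv; have := pT v^T; rewrite -Re_qform fE trmxK; apply.
  apply/eqP => /(congr1 trmx); rewrite trmxK trmx0 => v0.
  move: Kv; rewrite /K /= /g v0 big1 => [/eqP|i _]; last by rewrite mxE expr0n.
  by rewrite eq_sym oner_eq0.
have [M [_ Mub]] : bounded_set ((fun v => (f v)^-1) @` K).
  apply: compact_bounded; apply: continuous_compact => //.
  apply: continuous_in_subspaceT => v /set_mem Kv.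
  have fv0 : f v != 0 by rewrite lt0r_neq0// fpos.
  exact: (cvgV fv0 (cf v)).
pose N := `|M| + 1.
have N0 : 0 < N by rewrite ltr_pwDr.
have fN v : K v -> N^-1 <= f v.
  move=> Kv; have fv := fpos v Kv.
  have MN : M < N by rewrite (le_lt_trans (ler_norm M))// ltrDl.
  have /= := Mub N MN (f v)^-1 (ex_intro2 _ _ v Kv erefl).
  rewrite ger0_norm ?invr_ge0 ?(ltW fv)// => h.
  by rewrite -[leRHS]invrK lef_pV2 ?posrE ?invr_gt0.
exists N^-1; first by rewrite invr_gt0.
move=> z; rewrite fE gE; have [z0|z0] := eqVneq (g z^T) 0.
  rewrite z0 mulr0.
  have zz i : z^T 0 i = 0.
    have := psumr_eq0P (fun i _ => sqr_ge0 (z^T 0 i)) z0 => /(_ i isT)/eqP.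
    by rewrite sqrf_eq0 => /eqP.
  by rewrite /f big1// => i _; rewrite big1// => j _; rewrite zz mul0r mulr0.
have gz : 0 < g z^T.
  by rewrite lt_neqAle eq_sym z0/=; apply: sumr_ge0 => i _; exact: sqr_ge0.
pose s := (Num.sqrt (g z^T))^-1.
have s2 : s ^+ 2 = (g z^T)^-1 by rewrite exprVn sqr_sqrtr// ltW.
have := fN (s *: z^T); rewrite /K /=.
have -> : g (s *: z^T) = s ^+ 2 * g z^T.
  by rewrite /g mulr_sumr; apply: eq_bigr => i _; rewrite !mxE exprMn.
have -> : f (s *: z^T) = s ^+ 2 * f z^T.
  rewrite /f mulr_sumr; apply: eq_bigr => i _; rewrite mulr_sumr.
  by apply: eq_bigr => j _; rewrite !mxE; ring.
rewrite s2 mulVf// => /(_ erefl).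
by rewrite mulrC ler_pdivlMr.
Qed.

Definition tailc (K : Type) n (z : 'cV[K]_n.+1) : 'cV[K]_n :=
  \col_i z (lift ord0 i) 0.

Lemma tailc_tcons n (z : measurableTypeR R * n.-tuple (measurableTypeR R)) :
  tailc (col_of_tuple (tcons z)) = col_of_tuple z.2.
Proof. by apply/colP => i; rewrite mxE col_tconsS. Qed.

Lemma sqnorm_recl n (z : 'cV[R]_n.+1) :
  sqnorm z = z ord0 0 ^+ 2 + sqnorm (tailc z).
Proof.
rewrite /sqnorm big_ord_recl; congr (_ + _).
by apply: eq_bigr => i _; rewrite mxE.
Qed.

Definition first_row n (T : 'M[C]_n.+1) : 'cV[C]_n :=
  \col_j T ord0 (lift ord0 j).

Definition schur n (T : 'M[C]_n.+1) : 'M[C]_n :=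
  \matrix_(i, j) (T (lift ord0 i) (lift ord0 j) -
    T (lift ord0 i) ord0 * T ord0 (lift ord0 j) / T ord0 ord0).

Lemma lform_recl n (u : 'cV[C]_n.+1) z :
  lform u z = u ord0 0 * (z ord0 0)%:C + lform (tailc u) (tailc z).
Proof.
rewrite /lform big_ord_recl; congr (_ + _).
by apply: eq_bigr => i _; rewrite !mxE.
Qed.

(** Completion of the square in the first coordinate. *)
Lemma qform_recl n (T : 'M[C]_n.+1) (z : 'cV[R]_n.+1) : symmetric_mx T -> T ord0 ord0 != 0 ->
  let a := T ord0 ord0 in let x := (z ord0 0)%:C in
  let r := lform (first_row T) (tailc z) in
  qform T z = a * x ^+ 2 + 2 * (x * r) + r ^+ 2 / a + qform (schur T) (tailc z).
Proof.
move=> sT a0 a x r.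
have sym i j : T i j = T j i by rewrite -[in LHS]sT mxE.
rewrite /qform big_ord_recl big_ord_recl -/a -/x.
have E1 : \sum_(i < n) T ord0 (lift ord0 i) * (x * (z (lift ord0 i) 0)%:C) = x * r.
  rewrite /r /lform mulr_sumr; apply: eq_bigr => i _; rewrite !mxE; ring.
rewrite E1.
have -> : \sum_(i < n) \sum_j T (lift ord0 i) j *
      ((z (lift ord0 i) 0)%:C * (z j 0)%:C) =
    x * r + \sum_(i < n) \sum_(j < n) T (lift ord0 i) (lift ord0 j) *
      ((z (lift ord0 i) 0)%:C * (z (lift ord0 j) 0)%:C).
  rewrite -E1 -big_split; apply: eq_bigr => i _.
  rewrite big_ord_recl; congr (_ + _).
  by rewrite sym -/x; ring.
have -> : r ^+ 2 / a = \sum_(i < n) \sum_(j < n)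
    (T (lift ord0 i) ord0 * T ord0 (lift ord0 j) / a) *
      ((z (lift ord0 i) 0)%:C * (z (lift ord0 j) 0)%:C).
  rewrite expr2 /r /lform big_distrlr/= mulr_suml; apply: eq_bigr => i _.
  rewrite mulr_suml; apply: eq_bigr => j _; rewrite !mxE [T (lift _ _) ord0]sym.
  ring.
rewrite expr2 -!addrA; congr (_ + _).
rewrite [x * r + (x * r + _)]addrA; congr (_ + _); first by ring.
rewrite -big_split; apply: eq_bigr => i _.
rewrite -big_split; apply: eq_bigr => j _.
by rewrite !mxE /=; ring.
Qed.

Lemma det_schur n (T : 'M[C]_n.+1) : T ord0 ord0 != 0 ->
  \det T = T ord0 ord0 * \det (schur T).
Proof.
move=> a0; pose a := T ord0 ord0; pose T' : 'M[C]_(1 + n) := T.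
have ul i j : ulsubmx T' i j = a.
  rewrite !mxE /a !ord1; congr (T _ _); exact: val_inj.
pose L : 'M[C]_(1 + n) := block_mx 1%:M 0 (a^-1 *: dlsubmx T') 1%:M.
pose U : 'M[C]_(1 + n) := block_mx a%:M (ursubmx T') 0 (schur T).
have dL : \det L = 1 by rewrite /L det_lblock !det1 mul1r.
have dU : \det U = a * \det (schur T) by rewrite /U det_ublock det_scalar1.
have TE : T = L *m U.
  apply: (etrans (esym (@submxK _ 1 n 1 n T'))).
  rewrite /L /U mulmx_block !mul0mx !mul1mx !addr0; congr (block_mx _ _ _ _).
  - by apply/matrixP => i j; rewrite ul mxE !ord1 eqxx.
  - by rewrite -scalemxAl mul_mx_scalar scalerA mulVf// scale1r.
  - apply/matrixP => i j; rewrite -scalemxAl !mxE big_ord1 !mxE.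
    have -> : rshift 1 i = lift ord0 i by exact: val_inj.
    have -> : rshift 1 j = lift ord0 j by exact: val_inj.
    have -> : lshift n (0 : 'I_1) = ord0 by exact: val_inj.
    by rewrite -/a; field.
by rewrite [in LHS]TE det_mulmx; apply: (etrans (congr2 *%R dL dU)); rewrite mul1r.
Qed.

Lemma symmetric_schur n (T : 'M[C]_n.+1) : symmetric_mx T -> symmetric_mx (schur T).
Proof.
move=> sT; have sym i j : T i j = T j i by rewrite -[in LHS]sT mxE.
apply/matrixP => i j; rewrite !mxE (sym (lift ord0 j)) (sym (lift ord0 j) ord0).
by rewrite (sym ord0 (lift ord0 i)); ring.
Qed.

Lemma coercive_top n (T : 'M[C]_n.+1) e : coercive e T ->
  e <= complex.Re (T ord0 ord0).
Proof.
move=> cT; have := cT (delta_mx ord0 0).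
have -> : sqnorm (delta_mx ord0 0 : 'cV[R]_n.+1) = 1.
  rewrite /sqnorm (bigD1 ord0)//= big1 ?mxE ?eqxx ?expr1n ?addr0// => i i0.
  by rewrite mxE (negbTE i0) expr0n.
have -> : qform T (delta_mx ord0 0) = T ord0 ord0.
  rewrite /qform (bigD1 ord0)//= [X in _ + X]big1 => [|i i0]; last first.
    by rewrite big1// => j _; rewrite !mxE (negbTE i0) mul0r mulr0.
  rewrite addr0 (bigD1 ord0)//= [X in _ + X]big1 => [|i i0]; last first.
    by rewrite !mxE (negbTE i0) !mulr0.
  by rewrite !mxE eqxx !mulr1 addr0.
by rewrite mulr1.
Qed.

(** Minimizing over the first variable keeps coercivity; the inequality
    [Re (r^2 / a) <= (Re r)^2 / Re a] takes care of the imaginary parts. *)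
Lemma coercive_schur n (T : 'M[C]_n.+1) e : symmetric_mx T -> 0 < e ->
  coercive e T -> coercive e (schur T).
Proof.
move=> sT e0 cT z.
have a1 : 0 < complex.Re (T ord0 ord0) by rewrite (lt_le_trans e0)// coercive_top.
have a0 : T ord0 ord0 != 0 by apply/eqP => a_0; move: a1; rewrite a_0 ltxx.
pose r := lform (first_row T) z.
(* the minimum of the real quadratic polynomial in the first coordinate *)
pose x := - (complex.Re r / complex.Re (T ord0 ord0)).
pose zz : 'cV[R]_n.+1 := \col_i (if unlift ord0 i is Some j then z j 0 else x).
have zt : tailc zz = z by apply/colP => i; rewrite !mxE liftK.
have z0 : zz ord0 0 = x by rewrite mxE unlift_none.
have := cT zz; rewrite qform_recl// sqnorm_recl zt z0 -/r.
rewrite !ReD mulrDr => h.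
have {}h := le_trans (ler_wpDl (mulr_ge0 (ltW e0) (sqr_ge0 x)) (lexx _)) h.
apply: le_trans h _; rewrite gerDr.
have F1 (y : R) : complex.Re (T ord0 ord0 * y%:C ^+ 2) =
    complex.Re (T ord0 ord0) * y ^+ 2.
  by rewrite -rmorphXn ReM /= mulr0 subr0.
have F2 (y : R) : complex.Re (2 * (y%:C * r)) = 2 * (y * complex.Re r).
  by rewrite -(rmorph_nat (real_complex R) 2) !ReM /=; ring.
rewrite F1 F2 /x; clear zz zt z0 x F1 F2; clearbody r.
move: (T ord0 ord0) a1 => [a b] /= a1.
case: r => r s /=.
have ab : 0 < a ^+ 2 + b ^+ 2 by rewrite ltr_wpDr ?sqr_ge0 ?exprn_gt0.
have -> : a * (- (r / a)) ^+ 2 + 2 * (- (r / a) * r) +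
  ((r * r - s * s) * (a / (a ^+ 2 + b ^+ 2)) -
    (r * s + s * r) * - (b / (a ^+ 2 + b ^+ 2))) =
  - ((r * b - s * a) ^+ 2 / (a * (a ^+ 2 + b ^+ 2))).
  by field; rewrite !gt_eqF.
by rewrite oppr_le0 divr_ge0 ?sqr_ge0// ltW// mulr_gt0.
Qed.

End quadratic_forms.

(** * Multivariate Gaussian integrals *)

Section multivariate_gauss.
Variable R : realType.
Local Notation C := R[i].
Local Notation T n := (n.-tuple (measurableTypeR R)).
Local Notation leb1 := (@lebesgue_measure R).
Local Notation leb n := (@lebesgue_tuple R n).

Definition ggauss n (A : 'M[C]_n) (u : 'cV[C]_n) (z : 'cV[R]_n) : C :=
  cexp (- (qform A z / 2) + lform u z).

Lemma Re_half (z : C) : complex.Re (z / 2) = complex.Re z / 2.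
Proof.
have -> : z / 2 = (2^-1)%:C * z by rewrite mulrC rmorphV ?unitfE// rmorph_nat.
by rewrite ReM /= mul0r subr0 mulrC.
Qed.

Lemma normc_ggauss n (A : 'M[C]_n) u z e : 0 < e -> coercive e A ->
  normc (ggauss A u z) <=
  expR (\sum_i (complex.Re (u i 0)) ^+ 2 / e) * gauss_weight (e / 4) z.
Proof.
move=> e0 cA; rewrite /ggauss normc_cexp -expRD ler_expR ReD ReN Re_half.
have h : complex.Re (lform u z) <=
    \sum_i (complex.Re (u i 0)) ^+ 2 / e + e / 4 * sqnorm z.
  rewrite /lform Re_sum /sqnorm mulr_sumr -big_split/=; apply: ler_sum => i _.
  rewrite ReM /= mulr0 subr0; set a := complex.Re _; set b := z i 0.
  have : 0 <= e^-1 * (a - e / 2 * b) ^+ 2.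
    by rewrite mulr_ge0 ?sqr_ge0// invr_ge0 ltW.
  have -> : e^-1 * (a - e / 2 * b) ^+ 2 = a ^+ 2 / e + e / 4 * b ^+ 2 - a * b.
    by field; rewrite gt_eqF.
  by rewrite subr_ge0.
by have := cA z; lra.
Qed.

Lemma cmeas_entry d (X : measurableType d) n (f : X -> 'cV[R]_n) i :
  mcol f -> cmeas (fun t => (f t i 0)%:C).
Proof. by move=> mf; apply: cmeas_real; exact: mf. Qed.

Lemma cmeas_qform d (X : measurableType d) n (A : 'M[C]_n) (f : X -> 'cV[R]_n) :
  mcol f -> cmeas (fun t => qform A (f t)).
Proof.
move=> mf; apply: cmeas_sum => i; apply: cmeas_sum => j.
by apply: cmeasM; [exact: cmeas_cst|apply: cmeasM; exact: cmeas_entry].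
Qed.

Lemma cmeas_lform d (X : measurableType d) n u (f : X -> 'cV[R]_n) :
  mcol f -> cmeas (fun t => lform u (f t)).
Proof.
move=> mf; apply: cmeas_sum => i.
by apply: cmeasM; [exact: cmeas_cst|exact: cmeas_entry].
Qed.

Lemma cmeas_ggauss d (X : measurableType d) n (A : 'M[C]_n) u (f : X -> 'cV[R]_n) :
  mcol f -> cmeas (fun t => ggauss A u (f t)).
Proof.
move=> mf; apply/cmeas_cexp/cmeasD; last exact: cmeas_lform.
have -> : (fun t => - (qform A (f t) / 2)) = (fun t => - 2^-1 * qform A (f t)).
  by apply/funext => t; rewrite mulNr mulrC.
by apply: cmeasM; [exact: cmeas_cst|exact: cmeas_qform].
Qed.

Let sqrt2pi : Num.sqrt (2 * pi) ^+ 2 = 2 * pi :> R.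
Proof. by rewrite sqr_sqrtr// mulr_ge0 ?pi_ge0. Qed.

Let sqrt2pi_neq0 : Num.sqrt (2 * pi) != 0 :> R.
Proof. by rewrite gt_eqF// sqrtr_gt0 mulr_gt0 ?pi_gt0. Qed.

(** Integrating out one variable at a time replaces the matrix by its Schur
    complement; completing the square is expressed through a solution [w] of
    [A w = u] so that no inverse matrix is involved. *)
Lemma cint_ggauss n (A : 'M[C]_n) e : symmetric_mx A -> 0 < e -> coercive e A ->
  exists2 c : C, c ^+ 2 * \det A = 1 & forall u w, A *m w = u ->
    cint (leb n) (fun t => ggauss A u (col_of_tuple t)) =
    (Num.sqrt (2 * pi) ^+ n)%:C * c * cexp ((\sum_i u i 0 * w i 0) / 2).
Proof.
elim: n A => [|n ih] A sA e0 cA.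
  exists 1 => [|u w _]; first by rewrite det_mx00 expr1n mulr1.
  rewrite cint_tuple0 /ggauss /qform /lform !big_ord0 mul0r oppr0 addr0.
  by rewrite cexp0 expr0 !mul1r.
have a0 : 0 < complex.Re (A ord0 ord0) by rewrite (lt_le_trans e0)// coercive_top.
have aN0 : A ord0 ord0 != 0 by apply/eqP => a_0; move: a0; rewrite a_0 ltxx.
have [c' c'1 IH] := ih _ (symmetric_schur sA) e0 (coercive_schur sA e0 cA).
pose a := A ord0 ord0; pose J := cint leb1 (gauss1 a 0).
have J2 : J ^+ 2 * a = (2 * pi)%:C := cint_gauss1_sqr a0.
have sC0 : (Num.sqrt (2 * pi))%:C != 0 :> C by rewrite fmorph_eq0.
exists (J / (Num.sqrt (2 * pi))%:C * c').
  rewrite det_schur// -/a.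
  have -> : (J / (Num.sqrt (2 * pi))%:C * c') ^+ 2 * (a * \det (schur A)) =
      (J ^+ 2 * a) / ((Num.sqrt (2 * pi))%:C ^+ 2) * (c' ^+ 2 * \det (schur A)).
    by field.
  rewrite J2 c'1 -rmorphXn/= sqrt2pi mulr1 mulfV// fmorph_eq0.
  by rewrite -sqrt2pi expf_neq0.
move=> u w Awu.
have mG : cmeas (fun t : T n.+1 => ggauss A u (col_of_tuple t)).
  by apply: cmeas_ggauss; exact: mcol_tuple.
rewrite cint_tupleS//.
have e4 : 0 < e / 4 by rewrite divr_gt0.
pose K := expR (\sum_i (complex.Re (u i 0)) ^+ 2 / e).
have bnd x t : normc (ggauss A u (col_of_tuple (tcons (x, t)))) <=
    (K * expR (- (e / 4 * x ^+ 2))) * gauss_weight (e / 4) (col_of_tuple t).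
  apply: le_trans (normc_ggauss _ _ e0 cA) _.
  by rewrite -mulrA gauss_weight_tcons.
rewrite (cint_fubini2 (rintegrableZ K (rintegrable_gauss1 e4))
  (rintegrable_gauss_weight n e4) _ _ (cmeas_comp mG (@measurable_tconsE R n)) bnd);
  last 2 first.
- by move=> x; rewrite mulr_ge0 ?expR_ge0.
- by move=> t; exact: gauss_weight_ge0.
(* the data left over when the square in the first coordinate is completed *)
pose u0 := u ord0 0.
pose u'' := tailc u - (u0 / a) *: first_row A.
have Ai0 (i : 'I_n.+1) : \sum_j A i j * w j 0 = u i 0 by rewrite -Awu mxE.
have sym i j : A i j = A j i by rewrite -[in LHS]sA mxE.
pose rw := \sum_j first_row A j 0 * tailc w j 0.
have rwE : rw = u0 - a * w ord0 0.
  rewrite /u0 -Ai0 big_ord_recl -/a addrC addKr.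
  by apply: eq_bigr => j _; rewrite !mxE.
have Bw : schur A *m tailc w = u''.
  apply/colP => i; rewrite !mxE -Ai0 big_ord_recl.
  have -> : \sum_j schur A i j * tailc w j 0 =
    \sum_(j < n) A (lift ord0 i) (lift ord0 j) * w (lift ord0 j) 0 -
    A (lift ord0 i) ord0 / a * rw.
    rewrite /rw mulr_sumr -sumrB; apply: eq_bigr => j _; rewrite !mxE -/a.
    by ring.
  by rewrite rwE (sym ord0 (lift ord0 i)); field.
have E t : cint leb1 (fun x => ggauss A u (col_of_tuple (tcons (x, t)))) =
    J * cexp (u0 ^+ 2 / (2 * a)) * ggauss (schur A) u'' (col_of_tuple t).
  pose z := col_of_tuple t; pose r := lform (first_row A) z.
  pose b := - (qform (schur A) z / 2) + lform (tailc u) z - r ^+ 2 / (2 * a).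
  have E1 x : ggauss A u (col_of_tuple (tcons (x, t))) =
      cexp b * gauss1 a (u0 - r) x.
    rewrite /ggauss qform_recl// lform_recl !tailc_tcons col_tcons0 /= -/z -/r -/a.
    rewrite -/u0 /gauss1 -cexpD /b; congr cexp; rewrite rmorphXn/=.
    by field.
  under eq_fun do rewrite E1.
  rewrite cintZ; last first.
    have := cintegrable_mono_gauss1 (u0 - r) a0 1 (leq0n 2).
    by under eq_fun do rewrite expr0 !mul1r.
  rewrite cint_gauss1_linear// -/J mulrCA -!mulrA; congr (_ * _).
  rewrite /ggauss -!cexpD; congr cexp; rewrite /b.
  have -> : lform u'' z = lform (tailc u) z - u0 / a * r.
    rewrite /r /lform mulr_sumr -sumrB; apply: eq_bigr => i _; rewrite !mxE.
    by ring.
  by field.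
under eq_fun do rewrite E.
rewrite cintZ; last first.
  have iB := rintegrableZ (expR (\sum_i (complex.Re (u'' i 0)) ^+ 2 / e))
    (rintegrable_gauss_weight n e4).
  apply: (cintegrable_le _ _ iB).
  - by apply: cmeas_ggauss; exact: mcol_tuple.
  - by move=> t; exact: (normc_ggauss _ _ e0 (coercive_schur sA e0 cA)).
rewrite (IH _ _ Bw).
have -> : \sum_i u i 0 * w i 0 =
    u0 ^+ 2 / a + \sum_i u'' i 0 * tailc w i 0.
  rewrite big_ord_recl -/u0.
  have -> : \sum_i u'' i 0 * tailc w i 0 =
      \sum_(i < n) u (lift ord0 i) 0 * w (lift ord0 i) 0 - u0 / a * rw.
    rewrite /rw mulr_sumr -sumrB; apply: eq_bigr => i _; rewrite !mxE.
    by ring.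
  by rewrite rwE; field.
rewrite [(_ + _) / 2]mulrDl cexpD.
have -> : u0 ^+ 2 / (2 * a) = u0 ^+ 2 / a / 2 by field.
rewrite [Num.sqrt _ ^+ _.+1]exprS rmorphM/=.
by field.
Qed.

End multivariate_gauss.

(** * The branch of the square root *)

Section branch.
Variable R : realType.
Local Notation C := R[i].
Local Notation leb n := (@lebesgue_tuple R n).

Lemma horner_char_poly n (A : 'M[C]_n) x : (char_poly A).[x] = \det (x%:M - A).
Proof.
rewrite /char_poly -horner_evalE -det_map_mx; congr (\det _).
apply/matrixP => i j; rewrite !mxE /= horner_evalE hornerD hornerN hornerC.
by rewrite hornerMn hornerX.
Qed.

Lemma char_poly_eigenvalues n (A : 'M[C]_n) :
  char_poly A = \prod_(a <- eigenvalues A) ('X - a%:P).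
Proof.
have h : char_poly A = lead_coef (char_poly A) *:
    \prod_(a <- eigenvalues A) ('X - a%:P).
  exact: svalP (closed_field_poly_normal (char_poly A)).
by rewrite (monicP (char_poly_monic A)) scale1r in h.
Qed.

Lemma size_eigenvalues n (A : 'M[C]_n) : size (eigenvalues A) = n.
Proof.
have := congr1 (fun p : {poly C} => size p) (char_poly_eigenvalues A).
by rewrite size_char_poly size_prod_XsubC => -[].
Qed.

(** The path from the identity to [A] has explicit eigenvalues, so that a
    continuous square root of its determinant can be written down. *)
Lemma det_affine n (A : 'M[C]_n) (s t : C) :
  \det (t%:M + s *: A) = \prod_(a <- eigenvalues A) (t + s * a).
Proof.
have [->|s0] := eqVneq s 0.
  rewrite scale0r addr0 det_scalar.
  under eq_bigr do rewrite mul0r addr0.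
  by rewrite big_const_seq count_predT size_eigenvalues iter_mulr_1.
have -> : t%:M + s *: A = (- s) *: ((- (t / s))%:M - A).
  apply/matrixP => i j; rewrite !mxE.
  by case: eqP => _; rewrite ?mulr1n ?mulr0n; field.
rewrite detZ -horner_char_poly char_poly_eigenvalues horner_prod.
have -> : (- s) ^+ n = \prod_(a <- eigenvalues A) (- s).
  by rewrite big_const_seq count_predT size_eigenvalues iter_mulr_1.
rewrite -big_split; apply: eq_bigr => a _ /=.
by rewrite hornerXsubC; field.
Qed.

(** In the Hermitian form of [A] at an eigenvector [p + i q], the symmetry of
    [A] cancels the terms in the imaginary part of [A], and what remains is the
    sum of the real parts of the quadratic form at [p] and [q]. *)
Lemma Re_eigenvalue_gt0 n (A : 'M[C]_n) e a : symmetric_mx A -> 0 < e ->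
  coercive e A -> a \in eigenvalues A -> 0 < complex.Re a.
Proof.
move=> sA e0 cA ea.
have : root (char_poly A) a by rewrite char_poly_eigenvalues root_prod_XsubC.
rewrite -eigenvalue_root_char => /eigenvalueP[v vA v0].
have sym i j : A i j = A j i by rewrite -[in LHS]sA mxE.
pose p : 'cV[R]_n := \col_i complex.Re (v 0 i).
pose q : 'cV[R]_n := \col_i complex.Im (v 0 i).
pose X := \sum_i \sum_j v 0 i * A i j * (v 0 j)^*.
have X1 : complex.Re X = complex.Re a * (sqnorm p + sqnorm q).
  have -> : X = a * (sqnorm p + sqnorm q)%:C.
    rewrite /X exchange_big /= /sqnorm -big_split rmorph_sum mulr_sumr.
    apply: eq_bigr => j _; rewrite -mulr_suml.
    have -> : \sum_i v 0 i * A i j = a * v 0 j.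
      by have := congr1 (fun M : 'rV[C]_n => M 0 j) vA; rewrite !mxE.
    rewrite -mulrA; congr (_ * _); rewrite !mxE; case: (v 0 j) => x y /=.
    by apply: complex_eqP; rewrite ?ReM ?ImM /=; ring.
  by rewrite ReM /= mulr0 subr0.
have X2 : complex.Re X = complex.Re (qform A p) + complex.Re (qform A q).
  pose Y := \sum_i \sum_j complex.Im (A i j) *
    (complex.Re (v 0 i) * complex.Im (v 0 j)).
  pose Z := \sum_i \sum_j complex.Im (A i j) *
    (complex.Im (v 0 i) * complex.Re (v 0 j)).
  have YZ : Y = Z.
    rewrite /Y exchange_big /=; apply: eq_bigr => i _; apply: eq_bigr => j _.
    by rewrite sym; ring.
  transitivity (complex.Re (qform A p) + complex.Re (qform A q) + (Y - Z)); last first.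
    by rewrite YZ subrr addr0.
  rewrite /X /qform !Re_sum -sumrB -!big_split; apply: eq_bigr => i _ /=.
  rewrite !Re_sum -sumrB -!big_split; apply: eq_bigr => j _ /=.
  rewrite !mxE; case: (v 0 i) (v 0 j) (A i j) => [x1 y1] [x2 y2] [x3 y3].
  by rewrite !ReM !ImM /=; ring.
have pq : 0 < sqnorm p + sqnorm q.
  rewrite lt_neqAle addr_ge0 ?sqnorm_ge0// andbT eq_sym.
  apply: contra v0; rewrite paddr_eq0 ?sqnorm_ge0// => /andP[/eqP p0 /eqP q0].
  apply/eqP/rowP => i; rewrite mxE.
  have /(_ i isT)/eqP := psumr_eq0P (fun i _ => sqr_ge0 (p i 0)) p0.
  have /(_ i isT)/eqP := psumr_eq0P (fun i _ => sqr_ge0 (q i 0)) q0.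
  rewrite !sqrf_eq0 !mxE => /eqP qi /eqP pi.
  exact: complex_eqP.
have : 0 < complex.Re X.
  rewrite X2; apply: lt_le_trans (lerD (cA p) (cA q)).
  by rewrite -mulrDr mulr_gt0.
by rewrite X1 pmulr_lgt0.
Qed.

Definition ccont (V : topologicalType) (f : V -> C) :=
  continuous (fun v => complex.Re (f v) : R) /\
  continuous (fun v => complex.Im (f v) : R).

Section ccont.
Variable V : topologicalType.
Implicit Types f g : V -> C.

Let contN (f : V -> R) : continuous f -> continuous (fun v => - f v).
Proof. by move=> cf v; exact: (continuousN (cf v)). Qed.

Lemma ccont_cst c : ccont (fun _ : V => c).
Proof. by split; exact: cst_continuous. Qed.

Lemma ccont_real (a : V -> R) : continuous a -> ccont (fun v => (a v)%:C).
Proof. by move=> ca; split => //=; exact: cst_continuous. Qed.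

Lemma ccont_imag (a : V -> R) : continuous a -> ccont (fun v => 0 +i* (a v)).
Proof. by move=> ca; split => //=; exact: cst_continuous. Qed.

Lemma ccontD f g : ccont f -> ccont g -> ccont (fun v => f v + g v).
Proof.
move=> [f1 f2] [g1 g2]; split.
- by under eq_fun do rewrite ReD; exact: continuous_addf.
- by under eq_fun do rewrite ImD; exact: continuous_addf.
Qed.

Lemma ccontM f g : ccont f -> ccont g -> ccont (fun v => f v * g v).
Proof.
move=> [f1 f2] [g1 g2]; split.
- under eq_fun do rewrite ReM; apply: continuous_addf; first exact: continuous_mulf.
  by apply: contN; exact: continuous_mulf.
- by under eq_fun do rewrite ImM; apply: continuous_addf; exact: continuous_mulf.
Qed.

Lemma ccont_sum (I : Type) (r : seq I) (F : I -> V -> C) :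
  (forall i, ccont (F i)) -> ccont (fun v => \sum_(i <- r) F i v).
Proof.
move=> cF; elim: r => [|i r ih].
  by under eq_fun do rewrite big_nil; exact: ccont_cst.
by under eq_fun do rewrite big_cons; exact: ccontD.
Qed.

Lemma ccont_prod (I : eqType) (r : seq I) (F : I -> V -> C) :
  (forall i, i \in r -> ccont (F i)) -> ccont (fun v => \prod_(i <- r) F i v).
Proof.
elim: r => [|i r ih] cF.
  by under eq_fun do rewrite big_nil; exact: ccont_cst.
under eq_fun do rewrite big_cons; apply: ccontM.
  by apply: cF; rewrite mem_head.
by apply: ih => j jr; apply: cF; rewrite inE jr orbT.
Qed.

Lemma ccont_cexp f : ccont f -> ccont (fun v => cexp (f v)).
Proof.
move=> [f1 f2].
have e1 : continuous (fun v => expR (complex.Re (f v))).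
  by move=> v; apply: continuous_comp; [exact: f1|exact: continuous_expR].
have e2 : continuous (fun v => cos (complex.Im (f v))).
  by move=> v; apply: continuous_comp; [exact: f2|exact: continuous_cos].
have e3 : continuous (fun v => sin (complex.Im (f v))).
  by move=> v; apply: continuous_comp; [exact: f2|exact: continuous_sin].
by split => /=; exact: continuous_mulf.
Qed.

Lemma Re_sqrtc_gt0 (z : C) : 0 < complex.Re z -> 0 < complex.Re (sqrtc z).
Proof.
by case: z => a b /= a0; rewrite sqrtr_gt0 divr_gt0// ltr_pwDr// sqrtr_ge0.
Qed.

Lemma ccont_sqrtc f : (forall v, 0 < complex.Re (f v)) -> ccont f ->
  ccont (fun v => sqrtc (f v)).
Proof.
move=> f0 [f1 f2].
have cR : continuous (fun v => complex.Re (sqrtc (f v)) : R).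
  have -> : (fun v => complex.Re (sqrtc (f v))) = (fun v =>
      Num.sqrt (2^-1 * (Num.sqrt (complex.Re (f v) * complex.Re (f v) +
        complex.Im (f v) * complex.Im (f v)) + complex.Re (f v)))).
    by apply/funext => v; case: (f v) => a b /=; rewrite !expr2 mulrC.
  move=> v; apply: continuous_comp; last exact: sqrt_continuous.
  apply: continuous_mulf; first exact: cst_continuous.
  apply: continuous_addf => // w; apply: continuous_comp; last exact: sqrt_continuous.
  by apply: continuous_addf; exact: continuous_mulf.
split=> //.
have -> : (fun v => complex.Im (sqrtc (f v))) =
    (fun v => complex.Im (f v) * (2^-1 * (complex.Re (sqrtc (f v)))^-1)).
  apply/funext => v; have r0 := Re_sqrtc_gt0 (f0 v).
  have := congr1 (@complex.Im R) (sqr_sqrtc (f v)); rewrite expr2 ImM => <-.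
  by field; rewrite gt_eqF.
apply: continuous_mulf => //; apply: continuous_mulf; first exact: cst_continuous.
move=> v; apply: cvgV; last exact: cR.
by rewrite lt0r_neq0// Re_sqrtc_gt0.
Qed.

End ccont.

Lemma ccont_cint d (X : measurableType d) (mu : {measure set X -> \bar R})
    (f : R -> X -> C) (g : X -> R) :
  (forall s, cmeas (f s)) -> (forall t, ccont (f^~ t)) ->
  rintegrable mu g -> (forall s t, normc (f s t) <= g t) ->
  ccont (fun s => cint mu (f s)).
Proof.
move=> mf cf ig fg.
have E (h : R -> X -> R) : (forall s, measurable_fun setT (h s)) ->
    (forall t, continuous (h^~ t)) -> (forall s t, `|h s t| <= g t) ->
    continuous (fun s => \int[mu]_t h s t).
  move=> mh ch hg s.
  have ss : s \in `](s - 1), (s + 1)[%classic.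
    by rewrite inE /= in_itv/= ltrDl ltr01 ltrBlDr ltrDl ltr01.
  apply: (continuity_under_integral measurableT _ _ ig _ ss).
  - by move=> r _; exact: rintegrable_le ig.
  - by apply: aeW => t _ r _; exact: ch.
  - by move=> r _; apply: aeW => t _; exact: hg.
split.
- apply: (E (fun s t => complex.Re (f s t))).
  + by move=> s; case: (mf s).
  + by move=> t; case: (cf t).
  + by move=> s t; apply: le_trans (fg s t); exact: normc_Re.
- apply: (E (fun s t => complex.Im (f s t))).
  + by move=> s; case: (mf s).
  + by move=> t; case: (cf t).
  + by move=> s t; apply: le_trans (fg s t); exact: normc_Im.
Qed.

(** Otherwise the real part, which is 1 or -1, would vanish somewhere. *)
Lemma ccont_sqr1 (f : R -> C) : ccont f -> (forall s, f s ^+ 2 = 1) ->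
  f 0 = 1 -> forall s, 0 <= s -> f s = 1.
Proof.
move=> [cf _] f2 f0 s s0.
have f1 t : f t = 1 \/ f t = - 1.
  have /eqP := f2 t; rewrite sqrf_eq1 => /orP[] /eqP; by [left|right].
case: (f1 s) => // fs.
have ci : {within `[0, s], continuous (fun s => complex.Re (f s))}.
  exact: continuous_subspaceT.
have mm : Num.min (complex.Re (f 0)) (complex.Re (f s)) <= 0 <=
    Num.max (complex.Re (f 0)) (complex.Re (f s)).
  by rewrite f0 fs /= ge_min le_max ler01 /= oppr_le0 ler01 orbT.
have [c _ fc] := IVT s0 ci mm.
by case: (f1 c) => fc1; move: fc; rewrite fc1 /= => /eqP;
  rewrite ?oppr_eq0 oner_eq0.
Qed.

(** [det_invsqrt] is the branch given by the Gaussian integral: both are square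
    roots of the inverse determinant along the segment from the identity to [A],
    parametrized by [sin ^ 2] in order to stay in the segment on the whole
    real line, and they agree at the identity. *)
Lemma cint_ggauss_det n (A : 'M[C]_n) e (u w : 'cV[C]_n) :
  symmetric_mx A -> 0 < e -> coercive e A -> A *m w = u ->
  cint (leb n) (fun t => ggauss A u (col_of_tuple t)) =
  (Num.sqrt (2 * pi) ^+ n)%:C * det_invsqrt A * cexp ((\sum_i u i 0 * w i 0) / 2).
Proof.
move=> sA e0 cA Aw.
pose s (t : R) := sin t * sin t.
have s0 t : 0 <= s t by rewrite /s -expr2 sqr_ge0.
have s1 t : 0 <= 1 - s t.
  by rewrite /s -expr2 -(cos2Dsin2 t) addrK sqr_ge0.
pose B t : 'M[C]_n := (1 - s t)%:C%:M + (s t)%:C *: A.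
have sB t : symmetric_mx (B t).
  have sym i j : A i j = A j i by rewrite -[in LHS]sA mxE.
  by apply/matrixP => i j; rewrite !mxE eq_sym sym.
have qB t z : qform (B t) z = (1 - s t)%:C * (sqnorm z)%:C + (s t)%:C * qform A z.
  rewrite /qform /sqnorm rmorph_sum !mulr_sumr -big_split; apply: eq_bigr => i _ /=.
  rewrite mulr_sumr (bigD1 i)//= [in RHS](bigD1 i)//= addrA; congr (_ + _).
    by rewrite !mxE eqxx mulr1n rmorphXn/=; ring.
  apply: eq_bigr => j ji; rewrite !mxE eq_sym (negbTE ji) mulr0n add0r.
  by rewrite -mulrA.
pose e' := Num.min e 1.
have e'0 : 0 < e' by rewrite lt_min e0 ltr01.
have cB t : coercive e' (B t).
  move=> z; rewrite qB ReD !ReM /= !mul0r !subr0.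
  have -> : e' * sqnorm z = (1 - s t) * (e' * sqnorm z) + s t * (e' * sqnorm z) by ring.
  apply: lerD; apply: ler_wpM2l => //.
    by rewrite -[leRHS]mul1r ler_wpM2r ?sqnorm_ge0// ge_min lexx orbT.
  apply: le_trans (cA z).
  by rewrite ler_wpM2r ?sqnorm_ge0// ge_min lexx.
pose N : C := (Num.sqrt (2 * pi) ^+ n)%:C.
have N0 : N != 0.
  by rewrite fmorph_eq0 expf_neq0// gt_eqF// sqrtr_gt0 mulr_gt0 ?pi_gt0.
pose J t := cint (leb n) (fun x => ggauss (B t) 0 (col_of_tuple x)).
have JE t (c : C) : (forall (u w : 'cV[C]_n), B t *m w = u ->
    cint (leb n) (fun x => ggauss (B t) u (col_of_tuple x)) =
    N * c * cexp ((\sum_i u i 0 * w i 0) / 2)) -> J t = N * c.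
  move=> /(_ 0 0 (mulmx0 _ _)); rewrite /J => ->.
  rewrite big1 ?mul0r ?cexp0 ?mulr1// => i _; by rewrite mxE mul0r.
pose D t := \prod_(a <- eigenvalues A) sqrtc ((1 - s t)%:C + (s t)%:C * a).
have D2 t : D t ^+ 2 = \det (B t).
  rewrite /B det_affine /D -prodrXl; apply: eq_bigr => a _; exact: sqr_sqrtc.
pose f t := N^-1 * J t * D t.
have f2 t : f t ^+ 2 = 1.
  have [c c1 /JE Jt] := cint_ggauss (sB t) e'0 (cB t).
  by rewrite /f Jt mulKf// exprMn D2.
have cs : continuous s by apply: continuous_mulf; exact: continuous_sin.
have cs' : continuous (fun t => 1 - s t).
  have -> : (fun t => 1 - s t) = (fun t => cos t * cos t).
    by apply/funext => t; rewrite /s -!expr2 -(cos2Dsin2 t) addrK.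
  by apply: continuous_mulf; exact: continuous_cos.
have cf : ccont f.
  apply: ccontM; [apply: ccontM; first exact: ccont_cst|].
  - have e4 : 0 < e' / 4 by rewrite divr_gt0.
    have ig := rintegrableZ (expR (\sum_(i < n) (complex.Re ((0 : 'cV[C]_n) i 0)) ^+ 2 / e'))
      (rintegrable_gauss_weight n e4).
    apply: (ccont_cint _ _ ig).
    + by move=> t; apply: cmeas_ggauss; exact: mcol_tuple.
    + move=> x; rewrite /ggauss; apply/ccont_cexp/ccontD; last exact: ccont_cst.
      have -> : (fun t => - (qform (B t) (col_of_tuple x) / 2)) = (fun t =>
          (1 - s t)%:C * (- ((sqnorm (col_of_tuple x))%:C / 2)) +
          (s t)%:C * (- (qform A (col_of_tuple x) / 2))).
        by apply/funext => t; rewrite qB; ring.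
      apply: ccontD; apply: ccontM; try exact: ccont_cst; exact: ccont_real.
    + by move=> t x; exact: normc_ggauss.
  - apply: ccont_prod => a ea; apply: ccont_sqrtc.
      move=> t; rewrite ReD ReM /= mul0r subr0.
      have ra := Re_eigenvalue_gt0 sA e0 cA ea.
      have [st0|st0] := eqVneq (s t) 0; first by rewrite st0 subr0 mul0r addr0.
      by apply: ltr_wpDl => //; rewrite mulr_gt0// lt_neqAle eq_sym st0 s0.
    apply: ccontD; first exact: ccont_real.
    by apply: ccontM; [exact: ccont_real|exact: ccont_cst].
have f0 : f 0 = 1.
  have D0 : D 0 = 1.
    rewrite /D big1// => a _; rewrite /s sin0 mul0r subr0 mul0r addr0.
    exact: sqrtc1.
  (* at the identity the integrand is positive, which excludes the sign -1 *)
  have /eqP := f2 0; rewrite /f D0 mulr1 sqrf_eq1 => /orP[/eqP //|/eqP h].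
  exfalso.
  have : J 0 = - N by rewrite -[LHS](mulVKf N0) h mulrN1.
  move=> /(congr1 (@complex.Re R)); rewrite /J Re_cint ReN => h1.
  have : 0 <= - complex.Re N.
    rewrite -h1; apply: Rintegral_ge0 => x _.
    rewrite /ggauss qB /s sin0 mul0r subr0 mul0r addr0 mul1r.
    rewrite [lform _ _]big1 => [|i _]; last by rewrite mxE mul0r.
    have -> : - ((sqnorm (col_of_tuple x))%:C / 2) + 0 =
        (- (sqnorm (col_of_tuple x) / 2))%:C :> C.
      by rewrite addr0 rmorphN rmorphM/= rmorphV ?unitfE//= rmorph_nat.
    by rewrite /cexp /= cos0 mulr1 expR_ge0.
  rewrite oppr_ge0 /= leNgt exprn_gt0// sqrtr_gt0 mulr_gt0 ?pi_gt0//.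
have f1 : f (pi / 2) = 1.
  by apply: ccont_sqr1 => //; rewrite divr_ge0 ?pi_ge0.
have B1 : B (pi / 2) = A.
  by rewrite /B /s sin_pihalf mulr1 subrr scale1r -scalemx1 scale0r add0r.
have [c c1 Hc] := cint_ggauss sA e0 cA.
rewrite (Hc _ _ Aw); congr (_ * _ * _).
have := JE (pi / 2) c; rewrite B1 => /(_ Hc) JA.
move: f1; rewrite /f JA mulKf// => cD.
have D1 : D (pi / 2) = \prod_(a <- eigenvalues A) sqrtc a.
  rewrite /D /s sin_pihalf mulr1 subrr; apply: eq_bigr => a _.
  by rewrite add0r mul1r.
rewrite /det_invsqrt prodfV -D1.
have Dn0 : D (pi / 2) != 0.
  by apply/eqP => D00; move/eqP: cD; rewrite D00 mulr0 eq_sym oner_eq0.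
by apply: (mulIf Dn0); rewrite cD mulVf.
Qed.

End branch.

(** * Smoothness of parameter integrals *)

Section smooth_integral.
Variables (R : realType) (V : normedModType R).

Lemma is_derive_line (f : V -> R) (p v : V) (s l : R) :
  is_derive (s *: v + p) v f l ->
  is_derive s (1 : R) (fun s => f (s *: v + p) : R) l.
Proof.
have E : (fun h : R => h^-1 *: (f ((h *: (1 : R) + s) *: v + p) - f (s *: v + p))) =
    (fun h => h^-1 *: (f (h *: v + (s *: v + p)) - f (s *: v + p))).
  by apply/funext => h; rewrite [h *: 1]mulr1 scalerDl addrA.
move=> [df dl]; split; first by rewrite /derivable E.
by rewrite /derive E.
Qed.

Lemma is_derive_line0 (f : V -> R) (p v : V) (l : R) :
  is_derive (0 : R) (1 : R) (fun s => f (s *: v + p) : R) l -> is_derive p v f l.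
Proof.
have E : (fun h : R => h^-1 *: (f ((h *: (1 : R) + 0) *: v + p) - f (0 *: v + p))) =
    (fun h => h^-1 *: (f (h *: v + p) - f p)).
  by apply/funext => h; rewrite [h *: 1]mulr1 addr0 scale0r add0r.
move=> [df dl]; split; first by move: df; rewrite /derivable E.
by move: dl; rewrite /derive E.
Qed.

Section class.
Context d (X : measurableType d) (mu : {measure set X -> \bar R}).
Variable cls : (V -> X -> R) -> Prop.
Hypothesis cls_derive : forall f, cls f -> forall v, exists2 g, cls g &
  forall p x, is_derive p v (f^~ x) (g p x).
Hypothesis cls_continuous : forall f, cls f -> forall x, continuous (f^~ x).
Hypothesis cls_measurable : forall f, cls f -> forall p, measurable_fun setT (f p).
Hypothesis cls_bound : forall f, cls f -> forall p, exists G : X -> R, exists2 e : R,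
  0 < e & rintegrable mu G /\
  forall p' x, `|p' - p| < e -> `|f p' x| <= G x.

Let F (f : V -> X -> R) (p : V) : R := \int[mu]_x f p x.

Let cls_integrable f p : cls f -> rintegrable mu (f p).
Proof.
move=> cf; have [G [e e0 [iG fG]]] := cls_bound cf p.
apply: (rintegrable_le (cls_measurable cf p) _ iG) => x.
by apply: fG; rewrite subrr normr0.
Qed.

Let F_continuous f : cls f -> continuous (F f).
Proof.
move=> cf p; have [G [e e0 [iG fG]]] := cls_bound cf p.
apply/cvgrPdist_lt => r r0; apply: contrapT => H.
have {}H n : exists q, `|q - p| < e / n.+1%:R /\ r <= `|F f p - F f q|.
  apply: contrapT => nq; apply: H.
  have en : 0 < e / n.+1%:R by rewrite divr_gt0.
  apply/nbhs_ballP; exists (e / n.+1%:R) => //= q; rewrite -ball_normE /= => pq.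
  rewrite ltNge; apply/negP => rq; apply: nq; exists q; split => //.
  by rewrite distrC.
have /choice[u Hu] := H.
have ue n : `|u n - p| < e.
  have [h _] := Hu n; apply: lt_le_trans h _.
  by rewrite ler_pdivrMr// ler_peMr ?ler1n// ltW.
have ucvg : u n @[n --> \oo] --> p.
  apply/cvgrPdist_lt => z z0; near=> n; rewrite distrC.
  have [h _] := Hu n; apply: lt_trans h _.
  rewrite ltr_pdivrMr// -ltr_pdivrMl//.
  rewrite (lt_le_trans (_ : _ < n%:R))// ?ler_nat//.
  near: n; exact: nbhs_infty_gtr.
have fcvg x : (f (u n) x)%:E @[n --> \oo] --> (f p x)%:E.
  have h : f (u n) x @[n --> \oo] --> f p x.
    exact: (continuous_cvg _ (@cls_continuous f cf x p) ucvg).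
  by apply: cvg_EFin; [exact: nearW|exact: h].
have Fcvg : F f (u n) @[n --> \oo] --> F f p.
  apply: fine_cvg; rewrite fineK; last first.
    exact: (integrable_fin_num _ (cls_integrable p cf)).
  apply: (@dominated_cvg _ _ _ mu setT measurableT
    (fun n x => (f (u n) x)%:E) _ (EFin \o G)) => //=.
  - by move=> n; exact/measurable_EFinP/cls_measurable.
  - by move=> n x _; rewrite lee_fin fG.
move/cvgrPdist_lt : Fcvg => /(_ _ r0)[N _ /(_ N (leqnn N))] /=.
by have [_ h] := Hu N; rewrite ltNge h.
Unshelve. all: end_near. Qed.

Let F_derive f v : cls f -> exists2 g, cls g & forall p, is_derive p v (F f) (F g p).
Proof.
move=> cf; have [g cg fg] := cls_derive cf v; exists g => // p.
have [G [e e0 [iG fG]]] := cls_bound cf p.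
have [G' [e' e'0 [iG' gG]]] := cls_bound cg p.
pose c := Num.min e e' / (`|v| + 1).
have v1 : 0 < `|v| + 1 by rewrite ltr_wpDl.
have c0 : 0 < c by rewrite divr_gt0// lt_min e0 e'0.
have near_p s : `|s - 0| < c -> `|s *: v + p - p| < Num.min e e'.
  rewrite subr0 addrK normrZ => sc.
  apply: (@le_lt_trans _ _ (`|s| * (`|v| + 1))); first by rewrite ler_wpM2l// lerDl.
  by rewrite -ltr_pdivlMr.
apply: is_derive_line0.
have -> : F g p = \int[mu]_x g (0 *: v + p) x by rewrite scale0r add0r.
apply: (@is_derive_Rintegral _ _ _ mu (fun s => f (s *: v + p))
  (fun s => g (s *: v + p)) G' G 0 c c0) => //.
- by move=> s; exact: cls_measurable.
- by move=> s x /near_p; rewrite lt_min => /andP[h _]; exact: fG.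
- by move=> s x; exact: is_derive_line.
- by move=> s x /near_p; rewrite lt_min => /andP[_ h]; exact: gG.
Qed.

(** A class of integrands that is stable under directional derivatives and has
    locally uniform integrable bounds can be differentiated any number of times
    under the integral. *)
Lemma Ck_integral k f : cls f -> Ck k (fun p => \int[mu]_x f p x).
Proof.
elim: k f => [|k ih] f cf; split => //; try exact: F_continuous.
move=> v; have [g cg fg] := F_derive v cf; split.
  by move=> p; have [] := fg p.
have -> : 'D_v (fun p => \int[mu]_x f p x) = F g.
  by apply/funext => p; have [_ <-] := fg p.
exact: ih.
Qed.

End class.

End smooth_integral.

(** * Smoothness of Gaussian lattice sums *)

Section theta_smooth.
Variable R : realType.
Local Notation C := R[i].
Local Notation phase n := ('cV[R]_n * 'cV[R]_n)%type.
Local Notation cnt n := (@lattice_count n R).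
Local Notation ex a := (cexp (0 +i* (a : R))).

Definition ekernel m n (S : 'M[C]_(m + n)) (x : 'cV[R]_m) (y : 'cV[R]_n) : C :=
  cexp (half_form S (col_mx x y)).

(** The only property of [S] that the analysis of the operators uses. For the
    matrix of a composition it comes out of the convolution formula, without a
    proof that the real part is negative definite. *)
Definition gauss_dominated m n (S : 'M[C]_(m + n)) :=
  exists c e : R, 0 < e /\ forall x y,
    normc (ekernel S x y) <= c * (gauss_weight e x * gauss_weight e y).

Lemma sqnorm_add n (a b : 'cV[R]_n) :
  sqnorm (a + b) <= 2 * sqnorm a + 2 * sqnorm b.
Proof.
rewrite /sqnorm !mulr_sumr -big_split; apply: ler_sum => i _; rewrite mxE /=.
by have := sqr_ge0 (a i 0 - b i 0); rewrite !expr2; lra.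
Qed.

Lemma dotv_le n (a y : 'cV[R]_n) :
  `|dotv a y| <= (\sum_i `|a i 0|) * (1 + sqnorm y).
Proof.
rewrite dotv_sum mulr_suml; apply: le_trans (ler_norm_sum _ _ _) _.
apply: ler_sum => i _; rewrite normrM ler_wpM2l//.
have h1 : `|y i 0| <= 1 + y i 0 ^+ 2.
  by have := sqr_ge0 (`|y i 0| - 1); rewrite sqrrB1 real_normK ?num_real//;
    have := normr_ge0 (y i 0); lra.
apply: le_trans h1 _; rewrite lerD2l /sqnorm (bigD1 i)//= lerDl.
by apply: sumr_ge0 => j _; exact: sqr_ge0.
Qed.

Lemma gauss_weight_poly e n (z : 'cV[R]_n) : 0 < e ->
  (1 + sqnorm z) * gauss_weight e z <= (1 + 2 / e) * gauss_weight (e / 2) z.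
Proof. by move=> e0; exact: (poly_absorb e0 (sqnorm_ge0 z)). Qed.

Lemma dotvC n (x y : 'cV[R]_n) : dotv x y = dotv y x.
Proof. by rewrite !dotv_sum; apply: eq_bigr => i _; rewrite mulrC. Qed.

Lemma dotv0 n (y : 'cV[R]_n) : dotv 0 y = 0.
Proof. by rewrite dotv_sum big1// => i _; rewrite mxE mul0r. Qed.

Lemma dotvDr n (a x y : 'cV[R]_n) : dotv a (x + y) = dotv a x + dotv a y.
Proof.
by rewrite !dotv_sum -big_split; apply: eq_bigr => i _; rewrite mxE mulrDr.
Qed.

Lemma dotvZr n (a x : 'cV[R]_n) c : dotv a (c *: x) = c * dotv a x.
Proof.
by rewrite !dotv_sum mulr_sumr; apply: eq_bigr => i _; rewrite mxE mulrCA.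
Qed.

Lemma dotvZl n (a x : 'cV[R]_n) c : dotv (c *: a) x = c * dotv a x.
Proof. by rewrite dotvC dotvZr dotvC. Qed.

Lemma cder_sum (I : Type) (r : seq I) (f : I -> R -> C) (x : R) (a : I -> C) :
  (forall i, cder (f i) x (a i)) ->
  cder (fun s => \sum_(i <- r) f i s) x (\sum_(i <- r) a i).
Proof.
move=> fa; elim: r => [|i r ih].
  by under eq_fun do rewrite big_nil; rewrite big_nil; exact: cder_cst.
by under eq_fun do rewrite big_cons; rewrite big_cons; exact: cderD.
Qed.

Lemma le_mx_norm_coord n (x : 'cV[R]_n) i : `|x i 0| <= `|x|.
Proof.
by rewrite [leRHS]/Num.norm /= mx_normrE; apply/bigmax_geP; right => /=;
  exists (i, 0).
Qed.

Lemma measurable_period d (X : measurableType d) n (f : X -> lattice n) :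
  measurable_fun setT f -> mcol (fun t => period R (f t)).
Proof.
move=> mf; apply: (mcol_comp (f := fun k : lattice n => period R k) _ mf).
by move=> i; exact: measurable_lattice.
Qed.

Lemma measurable_intv d (X : measurableType d) n (f : X -> lattice n) :
  measurable_fun setT f -> mcol (fun t => intv R (f t)).
Proof.
move=> mf; apply: (mcol_comp (f := fun k : lattice n => intv R k) _ mf).
by move=> i; exact: measurable_lattice.
Qed.

Lemma cmeas_half_form d (X : measurableType d) n (S : 'M[C]_n) (f : X -> 'cV[R]_n) :
  mcol f -> cmeas (fun t => half_form S (f t)).
Proof.
move=> mf; under eq_fun do rewrite half_formE.
by apply: cmeasM; [exact: cmeas_qform|exact: cmeas_cst].
Qed.

Lemma cmeas_ekernel d (X : measurableType d) m n (S : 'M[C]_(m + n))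
    (f : X -> 'cV[R]_m) (g : X -> 'cV[R]_n) :
  mcol f -> mcol g -> cmeas (fun t => ekernel S (f t) (g t)).
Proof.
by move=> mf mg; apply/cmeas_cexp/cmeas_half_form; exact: mcol_col_mx.
Qed.

Lemma periodE n (k : 'cV[int]_n) : intv R k = (2 * pi)^-1 *: period R k.
Proof.
by rewrite /period scalerA mulVf ?scale1r// mulf_neq0// gt_eqF// pi_gt0.
Qed.

Section source.
Variables (m n : nat) (S : 'M[C]_(m + n)).
Context d (W : measurableType d) (nu : {sigma_finite_measure set W -> \bar R}).
Variables (s : W -> 'cV[R]_n) (G : W -> C).
Hypothesis ms : mcol s.
Hypothesis mG : cmeas G.
Hypothesis iG : forall e : R, 0 < e ->
  rintegrable nu (fun t => gauss_weight e (s t) * normc (G t)).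
Hypothesis gS : gauss_dominated S.

Local Notation X := (lattice m * W)%type.

Let Z (p : phase m) (z : X) : 'cV[R]_(m + n) :=
  col_mx (p.1 + period R z.1) (s z.2).

Let Phi (p : phase m) (z : X) : C :=
  half_form S (Z p z) + 0 +i* dotv (intv R z.1) p.2.

Let lin (c : R) (a : 'cV[R]_(m + n)) (b : 'cV[R]_m) (p : phase m) (z : X) : R :=
  c + dotv a (Z p z) + dotv b (intv R z.1).

(** The derivatives in [p] of the summand: each one adds a factor that is affine
    in the exponent data [Z p z] and [intv R z.1]. *)
Inductive theta_class : (phase m -> X -> R) -> Prop :=
| Theta_exp c : theta_class (fun p z => complex.Re (c * cexp (Phi p z) * G z.2))
| Theta_lin c a b f : theta_class f -> theta_class (fun p z => lin c a b p z * f p z)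
| Theta_add f g : theta_class f -> theta_class g ->
    theta_class (fun p z => f p z + g p z).

Let Zv (v : phase m) : 'cV[R]_(m + n) := col_mx v.1 0.

Let ZE (v p : phase m) z (t : R) : Z (t *: v + p) z = t *: Zv v + Z p z.
Proof.
by rewrite /Z /Zv /= scale_col_mx add_col_mx scaler0 add0r addrA.
Qed.

Let dcoef (v : phase m) : 'cV[C]_(m + n) :=
  \col_j (2^-1 * \sum_i (S i j + S j i) * (Zv v i 0)%:C).

Let cder_Phi (v p : phase m) z :
  cder (fun t => Phi (t *: v + p) z) 0
    (lform (dcoef v) (Z p z) + 0 +i* dotv (intv R z.1) v.2).
Proof.
apply: cderD.
  have dZ i : cder (fun t : R => (Z (t *: v + p) z i 0)%:C) 0 (Zv v i 0)%:C.
    have -> : (fun t : R => (Z (t *: v + p) z i 0)%:C) =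
        (fun t : R => (Zv v i 0)%:C * t%:C + (Z p z i 0)%:C).
      apply/funext => t; rewrite ZE !mxE rmorphD rmorphM/=.
      by rewrite [X in X + _]mulrC.
    apply: (cder_eq (cderD (cderZ _ (cder_id 0)) (cder_cst _ 0))).
    by rewrite mulr1 addr0.
  have Z0 : Z (0 *: v + p) z = Z p z by rewrite scale0r add0r.
  under eq_fun do rewrite half_formE mulrC.
  apply: (cder_eq (cderZ _ (cder_sum _ (fun i => cder_sum _ (fun j =>
    cderZ (S i j) (cderM (dZ i) (dZ j))))))).
  rewrite Z0 /lform.
  have -> : \sum_i \sum_j S i j * ((Zv v i 0)%:C * (Z p z j 0)%:C +
      (Z p z i 0)%:C * (Zv v j 0)%:C) =
    \sum_i \sum_j S i j * ((Zv v i 0)%:C * (Z p z j 0)%:C) +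
    \sum_i \sum_j S j i * ((Zv v i 0)%:C * (Z p z j 0)%:C).
    rewrite [X in _ = _ + X]exchange_big -big_split; apply: eq_bigr => i _ /=.
    by rewrite -big_split; apply: eq_bigr => j _ /=; ring.
  have -> : \sum_i \sum_j S i j * ((Zv v i 0)%:C * (Z p z j 0)%:C) +
    \sum_i \sum_j S j i * ((Zv v i 0)%:C * (Z p z j 0)%:C) =
    \sum_j \sum_i (S i j + S j i) * (Zv v i 0)%:C * (Z p z j 0)%:C.
    rewrite [in RHS]exchange_big -big_split; apply: eq_bigr => i _ /=.
    by rewrite -big_split; apply: eq_bigr => j _ /=; ring.
  rewrite mulr_sumr; apply: eq_bigr => j _ /=.
  by rewrite [dcoef v j 0]mxE -mulr_suml mulrA.
have -> : (fun t : R => 0 +i* dotv (intv R z.1) (t *: v + p).2) =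
    (fun t : R => (0 +i* dotv (intv R z.1) v.2) * t%:C +
      0 +i* dotv (intv R z.1) p.2).
  apply/funext => t; rewrite /= dotvDr dotvZr.
  by apply: complex_eqP; rewrite ?ReD ?ImD ?ReM ?ImM /=; ring.
apply: (cder_eq (cderD (cderZ _ (cder_id 0)) (cder_cst _ 0))).
by rewrite mulr1 addr0.
Qed.

Let lin_derive (v p : phase m) z c a b :
  is_derive (0 : R) (1 : R) (fun t => lin c a b (t *: v + p) z : R) (dotv a (Zv v)).
Proof.
have -> : (fun t : R => lin c a b (t *: v + p) z) =
    (fun t => dotv a (Zv v) * t + lin c a b p z).
  by apply/funext => t; rewrite /lin ZE dotvDr dotvZr; ring.
apply: is_derive_eq; rewrite /GRing.scale/=; ring.
Qed.

Let Re_lform (u : 'cV[C]_(m + n)) y :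
  complex.Re (lform u y) = dotv (\col_j complex.Re (u j 0)) y.
Proof.
rewrite /lform Re_sum dotv_sum; apply: eq_bigr => i _.
by rewrite mxE ReM /= mulr0 subr0.
Qed.

Let Im_lform (u : 'cV[C]_(m + n)) y :
  complex.Im (lform u y) = dotv (\col_j complex.Im (u j 0)) y.
Proof.
rewrite /lform Im_sum dotv_sum; apply: eq_bigr => i _.
by rewrite mxE ImM /= mulr0 add0r.
Qed.

Let theta_derive f : theta_class f -> forall v, exists2 g, theta_class g &
  forall p z, is_derive p v (f^~ z) (g p z).
Proof.
move=> cf v; elim: cf => {f} [c|c a b f cf [g cg fg]|f1 f2 c1 [g1 cg1 fg1] c2 [g2 cg2 fg2]].
(* a factor ['i] in the constant exchanges real and imaginary parts *)
- pose ar := \col_j complex.Re (dcoef v j 0).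
  pose ai := \col_j complex.Im (dcoef v j 0).
  exists (fun p z =>
    lin 0 ar 0 p z * complex.Re (c * cexp (Phi p z) * G z.2) +
    lin 0 ai v.2 p z * complex.Re ((c * 'i) * cexp (Phi p z) * G z.2)).
    by apply: Theta_add; apply: Theta_lin; exact: Theta_exp.
  move=> p z; apply: is_derive_line0.
  have dE := cderM (cderZ c (cder_cexp (cder_Phi v p z))) (cder_cst (G z.2) 0).
  have [d1 _] := dE; apply: (is_derive_eq d1).
  rewrite scale0r add0r mulr0 addr0 /lin !add0r dotv0 addr0.
  rewrite -Re_lform -Im_lform [dotv v.2 _]dotvC.
  set L := lform _ _; set q := dotv _ _; set E := cexp _; move: (G z.2) => g.
  have -> : c * (E * (L + 0 +i* q)) * g = (c * E * g) * (L + 0 +i* q) by ring.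
  have -> : c * 'i * E * g = (c * E * g) * 'i by ring.
  by rewrite ![complex.Re (c * E * g * _)]ReM ReD ImD /=; ring.
- exists (fun p z => lin (dotv a (Zv v)) 0 0 p z * f p z + lin c a b p z * g p z).
    by apply: Theta_add; apply: Theta_lin.
  move=> p z; apply: is_derive_line0.
  have d1 := lin_derive v p z c a b.
  have d2 : is_derive (0 : R) (1 : R) (fun t => f (t *: v + p) z : R) (g p z).
    have -> : g p z = g (0 *: v + p) z. by rewrite scale0r add0r.
    exact: is_derive_line.
  apply: is_derive_eq; rewrite scale0r add0r /GRing.scale/=.
  by rewrite /lin !dotv0; ring.
- exists (fun p z => g1 p z + g2 p z); first exact: Theta_add.
  by move=> p z; have := fg1 p z; have := fg2 p z => h2 h1; exact: is_deriveD.
Qed.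

Let cont_fst i : continuous (fun p : phase m => p.1 i 0 : R).
Proof.
move=> p; apply: (continuous_comp (f := fst) (g := fun x : 'cV[R]_m => x i 0)).
  exact: cvg_fst.
exact: coord_continuous.
Qed.

Let cont_snd i : continuous (fun p : phase m => p.2 i 0 : R).
Proof.
move=> p; apply: (continuous_comp (f := snd) (g := fun x : 'cV[R]_m => x i 0)).
  exact: cvg_snd.
exact: coord_continuous.
Qed.

Let cont_Z z j : continuous (fun p => Z p z j 0).
Proof.
case: (split_ordP j) => i ->.
- have -> : (fun p => Z p z (lshift n i) 0) = (fun p => p.1 i 0 + period R z.1 i 0).
    by apply/funext => p; rewrite /Z col_mxEu mxE.
  by apply: continuous_addf; [exact: cont_fst|exact: cst_continuous].
- have -> : (fun p => Z p z (rshift m i) 0) = (fun=> s z.2 i 0).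
    by apply/funext => p; rewrite /Z col_mxEd.
  exact: cst_continuous.
Qed.

Let ccont_Phi z : ccont (fun p => Phi p z).
Proof.
apply: ccontD.
  under eq_fun do rewrite half_formE.
  apply: ccontM; last exact: ccont_cst.
  apply: ccont_sum => i; apply: ccont_sum => j; apply: ccontM; first exact: ccont_cst.
  by apply: ccontM; apply: ccont_real; exact: cont_Z.
apply: ccont_imag; under eq_fun do rewrite dotv_sum.
apply: continuous_sumf => i; apply: continuous_mulf; first exact: cst_continuous.
exact: cont_snd.
Qed.

Let theta_continuous f : theta_class f -> forall z, continuous (f^~ z).
Proof.
elim=> {f} [c z|c a b f _ ih z|f g _ ihf _ ihg z].
- have [] // : ccont (fun p => c * cexp (Phi p z) * G z.2).
  apply: ccontM; last exact: ccont_cst.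
  by apply: ccontM; [exact: ccont_cst|exact: ccont_cexp].
- apply: continuous_mulf => //.
  have cd : continuous (fun p => dotv a (Z p z)).
    under eq_fun do rewrite dotv_sum.
    apply: continuous_sumf => i; apply: continuous_mulf; first exact: cst_continuous.
    exact: cont_Z.
  apply: continuous_addf; last exact: cst_continuous.
  by apply: continuous_addf; [exact: cst_continuous|exact: cd].
- exact: continuous_addf.
Qed.

Let mcol_Z p : mcol (fun z : X => Z p z).
Proof.
apply: mcol_col_mx; last exact: mcol_comp.
by apply: mcolD; [exact: mcol_cst|exact: measurable_period].
Qed.

Let cmeas_Phi p : cmeas (fun z => Phi p z).
Proof.
apply: cmeasD; first exact: cmeas_half_form.
apply/cmeas_imag/measurable_dotv; last exact: mcol_cst.
exact: measurable_intv.
Qed.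

Let theta_measurable f : theta_class f -> forall p, measurable_fun setT (f p).
Proof.
elim=> {f} [c p|c a b f _ ih p|f g _ ihf _ ihg p].
- have [] // : cmeas (fun z => c * cexp (Phi p z) * G z.2).
  apply: cmeasM; last exact: cmeas_comp.
  by apply: cmeasM; [exact: cmeas_cst|exact: cmeas_cexp].
- apply: measurable_funM => //; rewrite /lin.
  apply: measurable_funD; first apply: measurable_funD.
  + exact: measurable_cst.
  + by apply: measurable_dotv; [exact: mcol_cst|exact: mcol_Z].
  + by apply: measurable_dotv; [exact: mcol_cst|exact: measurable_intv].
- exact: measurable_funD.
Qed.

Let wgt (e : R) (z : X) : R :=
  gauss_weight e (period R z.1) * (gauss_weight e (s z.2) * normc (G z.2)).

Let wgt_ge0 e z : 0 <= wgt e z.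
Proof. by rewrite !mulr_ge0 ?gauss_weight_ge0 ?normc_ge0. Qed.

Let rintegrable_wgt e : 0 < e -> rintegrable (cnt m \x nu)%E (wgt e).
Proof.
move=> e0.
have g0 t : 0 <= gauss_weight e (s t) * normc (G t).
  by rewrite mulr_ge0 ?gauss_weight_ge0 ?normc_ge0.
exact: (rintegrable_tensor (rintegrable_lattice m e0) (iG e0)
  (fun k => gauss_weight_ge0 _ _) g0).
Qed.

Let lin_le c a b (r : R) : 0 <= r -> exists2 K : R, 0 <= K & forall p z,
  sqnorm p.1 <= r ->
  `|lin c a b p z| <= K * ((1 + sqnorm (period R z.1)) * (1 + sqnorm (s z.2))).
Proof.
move=> r0; pose A := \sum_i `|a i 0|.
pose B := \sum_i `|((2 * pi)^-1 *: b) i 0|.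
have A0 : 0 <= A by apply: sumr_ge0.
have B0 : 0 <= B by apply: sumr_ge0.
exists (`|c| + A * (2 + 2 * r) + B).
  by rewrite !addr_ge0// mulr_ge0// addr_ge0// mulr_ge0.
move=> p z pr; have u0 := sqnorm_ge0 (period R z.1); have v0 := sqnorm_ge0 (s z.2).
have h1 : `|dotv a (Z p z)| <= A * (1 + sqnorm (Z p z)) := dotv_le _ _.
have h2 : `|dotv b (intv R z.1)| <= B * (1 + sqnorm (period R z.1)).
  by rewrite periodE dotvZr -dotvZl; exact: dotv_le.
have h3 : 1 + sqnorm (Z p z) <=
    (2 + 2 * r) * ((1 + sqnorm (period R z.1)) * (1 + sqnorm (s z.2))).
  rewrite /Z sqnorm_col_mx; have := sqnorm_add p.1 (period R z.1).
  move: (sqnorm (period R z.1)) (sqnorm (s z.2)) u0 v0 => u v u0 v0 h.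
  have h4 := mulr_ge0 r0 u0; have h5 := mulr_ge0 r0 v0.
  have h6 := mulr_ge0 u0 v0; have h7 := mulr_ge0 r0 h6.
  by lra.
have uv1 : 1 + sqnorm (period R z.1) <=
    (1 + sqnorm (period R z.1)) * (1 + sqnorm (s z.2)) by nra.
have uv2 : 1 <= (1 + sqnorm (period R z.1)) * (1 + sqnorm (s z.2)) by nra.
rewrite /lin; apply: le_trans (ler_normD _ _) _; rewrite mulrDl; apply: lerD.
  apply: le_trans (ler_normD _ _) _; rewrite mulrDl; apply: lerD.
    by rewrite ler_peMr.
  by apply: le_trans h1 _; rewrite -mulrA ler_wpM2l.
by apply: le_trans h2 _; rewrite ler_wpM2l.
Qed.

(** Half of the Gaussian exponent is spent to absorb each affine factor. *)
Let theta_wgt f : theta_class f -> forall r, 0 <= r ->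
  exists K e : R, [/\ 0 <= K, 0 < e & forall p z, sqnorm p.1 <= r ->
    `|f p z| <= K * wgt e z].
Proof.
elim=> {f} [c r r0|c a b f _ ih r r0|f g _ ihf _ ihg r r0].
- have [c0 [e [e0 Se]]] := gS; have e2 : 0 < e / 2 by rewrite divr_gt0.
  pose K := `|c0| * expR (e * r).
  have K0 : 0 <= K by rewrite mulr_ge0 ?expR_ge0.
  exists (normc c * K), (e / 2); split => //; first by rewrite mulr_ge0 ?normc_ge0.
  move=> p z pr; apply: le_trans (normc_Re _) _.
  have h : normc (ekernel S (p.1 + period R z.1) (s z.2)) <=
      K * (gauss_weight (e / 2) (period R z.1) * gauss_weight (e / 2) (s z.2)).
    apply: le_trans (Se _ _) _; rewrite /K -mulrA.
    apply: (@le_trans _ _ (`|c0| * (gauss_weight e (p.1 + period R z.1) *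
        gauss_weight e (s z.2)))).
      by rewrite ler_wpM2r ?ler_norm// mulr_ge0 ?gauss_weight_ge0.
    rewrite ler_wpM2l// mulrA; apply: ler_pM; rewrite ?gauss_weight_ge0//.
      apply: le_trans (gauss_weight_shift _ _ (ltW e0)) _.
      by rewrite ler_wpM2r ?gauss_weight_ge0// ler_expR ler_wpM2l// ltW.
    by apply: gauss_weight_le; rewrite ler_pdivrMr// ler_peMr ?ler1n// ltW.
  rewrite !normcM /Phi cexpD normcM normc_ex mulr1 -[cexp _]/(ekernel S _ _).
  rewrite /wgt [X in _ <= _ * X]mulrA [leRHS]mulrA ler_wpM2r ?normc_ge0//.
  by rewrite -mulrA ler_wpM2l ?normc_ge0.
- have [K1 K10 hK1] := lin_le c a b r0.
  have [K [e [K0 e0 hK]]] := ih r r0; have e2 : 0 < e / 2 by rewrite divr_gt0.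
  have q0 : 0 <= 1 + 2 / e by rewrite addr_ge0// divr_ge0// ltW.
  exists (K1 * K * ((1 + 2 / e) * (1 + 2 / e))), (e / 2); split => //.
    by rewrite !mulr_ge0.
  move=> p z pr; rewrite normrM; set u := sqnorm (period R z.1).
  have u1 : 0 <= 1 + u by rewrite addr_ge0// sqnorm_ge0.
  set v := sqnorm (s z.2); have v1 : 0 <= 1 + v by rewrite addr_ge0// sqnorm_ge0.
  apply: (@le_trans _ _ ((K1 * ((1 + u) * (1 + v))) * (K * wgt e z))).
    by apply: ler_pM => //; [exact: hK1|exact: hK].
  have h : ((1 + u) * (1 + v)) * wgt e z <=
      (1 + 2 / e) * (1 + 2 / e) * wgt (e / 2) z.
    rewrite /wgt.
    have -> : (1 + u) * (1 + v) * (gauss_weight e (period R z.1) *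
        (gauss_weight e (s z.2) * normc (G z.2))) =
      ((1 + u) * gauss_weight e (period R z.1)) *
        (((1 + v) * gauss_weight e (s z.2)) * normc (G z.2)) by ring.
    have -> : (1 + 2 / e) * (1 + 2 / e) * (gauss_weight (e / 2) (period R z.1) *
        (gauss_weight (e / 2) (s z.2) * normc (G z.2))) =
      ((1 + 2 / e) * gauss_weight (e / 2) (period R z.1)) *
        (((1 + 2 / e) * gauss_weight (e / 2) (s z.2)) * normc (G z.2)) by ring.
    apply: ler_pM.
    + by rewrite mulr_ge0 ?gauss_weight_ge0.
    + by rewrite !mulr_ge0 ?gauss_weight_ge0 ?normc_ge0.
    + exact: gauss_weight_poly.
    + by rewrite ler_wpM2r ?normc_ge0//; exact: gauss_weight_poly.
  rewrite mulrACA -!mulrA ler_wpM2l// ler_wpM2l// mulrA.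
  by rewrite [leRHS]mulrA.
- have [K1 [e1 [K10 e10 h1]]] := ihf r r0.
  have [K2 [e2 [K20 e20 h2]]] := ihg r r0.
  have wle (e e' : R) z : e <= e' -> wgt e' z <= wgt e z.
    move=> ee; rewrite /wgt; apply: ler_pM; rewrite ?mulr_ge0 ?gauss_weight_ge0 ?normc_ge0//.
      exact: gauss_weight_le.
    by rewrite ler_wpM2r ?normc_ge0//; exact: gauss_weight_le.
  exists (K1 + K2), (Num.min e1 e2); split; first exact: addr_ge0.
    by rewrite lt_min e10.
  move=> p z pr; apply: le_trans (ler_normD _ _) _; rewrite mulrDl; apply: lerD.
  + apply: le_trans (h1 p z pr) _; rewrite ler_wpM2l//.
    by apply: wle; rewrite ge_min lexx.
  + apply: le_trans (h2 p z pr) _; rewrite ler_wpM2l//.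
    by apply: wle; rewrite ge_min lexx orbT.
Qed.

Let theta_bound f : theta_class f -> forall p, exists F : X -> R, exists2 e : R,
  0 < e & rintegrable (cnt m \x nu)%E F /\
  forall p' z, `|p' - p| < e -> `|f p' z| <= F z.
Proof.
move=> cf p; pose r : R := m%:R * (`|p| + 1) ^+ 2.
have r0 : 0 <= r by rewrite mulr_ge0// sqr_ge0.
have [K [e [K0 e0 h]]] := theta_wgt cf r0.
exists (fun z => K * wgt e z), 1 => //; split; first exact/rintegrableZ/rintegrable_wgt.
move=> p' z pp; apply: h; rewrite /r mulr_natl.
have -> : (`|p| + 1) ^+ 2 *+ m = \sum_(i < m) (`|p| + 1) ^+ 2.
  by rewrite sumr_const card_ord.
apply: ler_sum => i _; rewrite -real_normK ?num_real// ler_sqr ?nnegrE ?addr_ge0//.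
apply: le_trans (le_mx_norm_coord _ _) _.
have h1 : `|p'.1| <= `|p'| by rewrite [leRHS]prod_normE le_max lexx.
apply: le_trans h1 _; rewrite -[p'](subrK p) addrC.
by apply: le_trans (ler_normD _ _) _; rewrite lerD2l ltW.
Qed.

(** The operator of a Gaussian kernel, as a lattice sum over the first index. *)
Definition theta_transform (p : phase m) : C :=
  cint (cnt m \x nu)%E (fun z : X => ex (dotv (intv R z.1) p.2) *
    (ekernel S (p.1 + period R z.1) (s z.2) * G z.2)).

Lemma smooth_theta_transform : smooth theta_transform.
Proof.
have E p : theta_transform p = cint (cnt m \x nu)%E (fun z : X =>
    cexp (Phi p z) * G z.2).
  apply: eq_cint => z; rewrite /Phi cexpD /ekernel /Z; ring.
have CK f k := Ck_integral theta_derive theta_continuous theta_measurable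
  theta_bound k (f := f).
move=> k; split.
- have -> : (fun p => complex.Re (theta_transform p)) =
      (fun p => \int[(cnt m \x nu)%E]_z complex.Re (1 * cexp (Phi p z) * G z.2)).
    apply/funext => p; rewrite E Re_cint; apply: eq_Rintegral => z _.
    by rewrite mul1r.
  by apply: CK; exact: Theta_exp.
- have -> : (fun p => complex.Im (theta_transform p)) =
      (fun p => \int[(cnt m \x nu)%E]_z complex.Re (- 'i * cexp (Phi p z) * G z.2)).
    apply/funext => p; rewrite E Im_cint; apply: eq_Rintegral => z _.
    by rewrite -mulrA ReM /=; ring.
  by apply: CK; exact: Theta_exp.
Qed.

End source.

End theta_smooth.

(** * Continuous functions of a phase variable *)

Section continuous_phase.
Variable R : realType.
Local Notation C := R[i].
Local Notation phase n := ('cV[R]_n * 'cV[R]_n)%type.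
Local Notation T n := (n.-tuple (measurableTypeR R)).

Lemma measurable_to_lattice d (X : measurableType d) n (f : X -> lattice n) :
  (forall k, measurable (f @^-1` [set k])) -> measurable_fun setT f.
Proof.
move=> mf _ Y _; rewrite setTI.
have -> : f @^-1` Y = \bigcup_i (if unpickle i is Some k then
    f @^-1` [set k] `&` [set _ | Y k] else set0).
  apply/seteqP; split => [x Yx|x [i _]].
    by exists (pickle (f x)) => //; rewrite pickleK.
  by case: (unpickle i) => // k [/= <-].
apply: bigcup_measurable => i _; case: (unpickle i) => [k|//].
have [Yk|nYk] := pselect (Y k).
  by rewrite (_ : [set _ | Y k] = setT) ?setIT//; apply/seteqP; split.
by rewrite (_ : [set _ | Y k] = set0) ?setI0//; apply/seteqP; split.
Qed.

Let grid_floor j n (z : 'cV[R]_n) : lattice n :=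
  \col_i Num.floor (j.+1%:R * z i 0).

Let grid j n (k : lattice n) : 'cV[R]_n := \col_i ((k i 0)%:~R / j.+1%:R).

Let measurable_grid_floor d (X : measurableType d) j n (f : X -> 'cV[R]_n) :
  mcol f -> measurable_fun setT (fun t => grid_floor j (f t)).
Proof.
move=> mf; apply: measurable_to_lattice => k.
have -> : (fun t => grid_floor j (f t)) @^-1` [set k] =
    [set t | forall i, ((fun t => j.+1%:R * f t i 0) @^-1`
      [set` `[(k i 0)%:~R, (k i 0 + 1)%:~R[]) t].
  apply/seteqP; split => t /=.
    move=> <- i; rewrite in_itv/= mxE; apply/andP; split.
    - exact: floor_le.
    - exact: floorD1_gt.
  move=> h; apply/colP => i; rewrite mxE; apply: floor_def.
  by have := h i; rewrite in_itv.
apply: measurable_forall_ord => i; rewrite -[X in measurable X]setTI.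
have mm : measurable_fun setT (fun t => j.+1%:R * f t i 0).
  by apply: measurable_funM; [exact: measurable_cst|exact: mf].
by apply: mm => //; exact: measurable_itv.
Qed.

Let grid_near j n (z : 'cV[R]_n) : `|z - grid j (grid_floor j z)| <= j.+1%:R^-1.
Proof.
rewrite [leLHS]/Num.norm /= mx_normrE; apply/bigmax_leP; split => [|[i o] _ /=].
  by rewrite invr_ge0.
rewrite !mxE ord1; set x := z i 0.
have j0 : 0 < j.+1%:R :> R by [].
have h1 := floor_le (j.+1%:R * x); have h2 := floorD1_gt (j.+1%:R * x).
have -> : x - (Num.floor (j.+1%:R * x))%:~R / j.+1%:R =
    (j.+1%:R * x - (Num.floor (j.+1%:R * x))%:~R) / j.+1%:R.
  by field; rewrite gt_eqF// ltr_pwDr.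
rewrite normrM [`|_^-1|]ger0_norm ?invr_ge0// ler_piMl ?invr_ge0//.
by rewrite ger0_norm ?subr_ge0// lerBlDl ltW// -intrD1.
Qed.

Let grid_cvg n (z : 'cV[R]_n) : grid j (grid_floor j z) @[j --> \oo] --> z.
Proof.
apply/cvgrPdist_lt => e e0; near=> j; apply: le_lt_trans (grid_near j z) _.
rewrite invf_plt ?posrE// (lt_trans (_ : _ < j%:R))// ?ltr_nat//.
by near: j; exact: nbhs_infty_gtr.
Unshelve. all: end_near. Qed.

(** Approximation by grid functions: they factor through a countable set. *)
Lemma measurable_continuous_phase d (X : measurableType d) n (F : phase n -> R)
    (f g : X -> 'cV[R]_n) : continuous F -> mcol f -> mcol g ->
  measurable_fun setT (fun t => F (f t, g t)).
Proof.
move=> cF mf mg.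
apply: (@measurable_fun_cvg _ _ _ setT
  (fun j t => F (grid j (grid_floor j (f t)), grid j (grid_floor j (g t))))).
- move=> j.
  have mk : measurable_fun setT
      (fun z : lattice n * lattice n => F (grid j z.1, grid j z.2)).
    by apply: measurable_lattice_prod => k; exact: measurable_lattice.
  have mp : measurable_fun setT (fun t => (grid_floor j (f t), grid_floor j (g t))).
    by apply: measurable_fun_pair; exact: measurable_grid_floor.
  exact: (measurableT_comp mk mp).
- move=> t _.
  have cF2 : F (z.1, z.2) @[z --> (f t, g t)] --> F (f t, g t).
    by apply: cvg_trans (cF (f t, g t)); rewrite (_ : (fun z => _) = F)//;
      apply/funext => -[].
  exact: (continuous2_cvg _ (h := fun a b => F (a, b)) cF2
    (@grid_cvg n (f t)) (@grid_cvg n (g t))).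
Qed.

Let trmx_continuous n : continuous (@trmx R 1 n).
Proof.
move=> x; apply/(@cvgrPdist_le R 'cV[R]_n _ _ (nbhs_filter x)) => e e0.
apply: (@filterS _ (nbhs x) (nbhs_filter x) _ _ _
  (@nbhs_ball_norm R 'rV[R]_n x (PosNum e0))) => y /ltW xy.
rewrite -linearB /= [leLHS]/Num.norm /= mx_normrE.
apply/bigmax_leP; split => [|[i j] _ /=]; first exact: ltW.
rewrite mxE; apply: le_trans xy; rewrite [leRHS]/Num.norm /= mx_normrE.
by apply/bigmax_geP; right; exists (j, i).
Qed.

Lemma bounded_on_cube n (F : phase n -> R) : continuous F ->
  exists M : R, forall t u : T n, cube t -> cube u ->
    `|F (col_of_tuple t, col_of_tuple u)| <= M.
Proof.
move=> cF.
pose K := [set v : 'rV[R]_n | forall i, `[0, 2 * pi]%classic (v 0 i)].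
have cK : @compact 'rV[R]_n K.
  exact: (@rV_compact R n _ (fun=> @segment_compact R 0 (2 * pi))).
pose h (z : 'rV[R]_n * 'rV[R]_n) := F (z.1^T, z.2^T).
have ch : continuous h.
  move=> z.
  have cF2 : F (w.1, w.2) @[w --> (z.1^T, z.2^T)] --> F (z.1^T, z.2^T).
    by apply: cvg_trans (cF (z.1^T, z.2^T)); rewrite (_ : (fun w => _) = F)//;
      apply/funext => -[].
  have c1 : x.1^T @[x --> z] --> z.1^T.
    apply: (@cvg_comp _ _ _ fst (@trmx R 1 n) _ (nbhs z.1) _ _ (@trmx_continuous n z.1)).
    exact: cvg_fst.
  have c2 : x.2^T @[x --> z] --> z.2^T.
    apply: (@cvg_comp _ _ _ snd (@trmx R 1 n) _ (nbhs z.2) _ _ (@trmx_continuous n z.2)).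
    exact: cvg_snd.
  exact: (continuous2_cvg _ (h := fun a b => F (a, b)) cF2 c1 c2).
have [M [_ hM]] : bounded_set (h @` (K `*` K)).
  apply: compact_bounded; apply: continuous_compact; last exact: compact_setX.
  exact: continuous_subspaceT.
exists (M + 1) => t u ct cu; apply: (hM (M + 1)); first by rewrite ltrDl.
exists ((col_of_tuple t)^T, (col_of_tuple u)^T); last by rewrite /h /= !trmxK.
by split => i /=; rewrite in_itv/= !mxE.
Qed.

Lemma sqnorm_cube n (t : T n) : cube t ->
  sqnorm (col_of_tuple t) <= n%:R * (2 * pi) ^+ 2.
Proof.
move=> ct; rewrite /sqnorm mulr_natl.
have -> : (2 * pi) ^+ 2 *+ n = \sum_(i < n) (2 * pi) ^+ 2 :> R.
  by rewrite sumr_const card_ord.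
apply: ler_sum => i _; rewrite mxE; have /andP[h1 h2] := ct i.
by rewrite ler_sqr ?nnegrE// (le_trans h1).
Qed.

Lemma chi_cube n (t : T n) : chi t = 0 \/ cube t /\ chi t = 1.
Proof.
rewrite /chi indicE; have [ct|nct] := pselect (cube t).
  by right; rewrite mem_set.
by left; rewrite memNset.
Qed.

Lemma cint_lattice_shift n (k0 : lattice n) (f : lattice n -> C) :
  cint (@lattice_count n R) (fun k => f (k + k0 : 'cV[int]_n)) =
  cint (@lattice_count n R) f.
Proof.
have E (h : lattice n -> R) : \int[@lattice_count n R]_k h (k + k0 : 'cV[int]_n) =
    \int[@lattice_count n R]_k h k.
  rewrite /Rintegral integralE [in RHS]integralE.
  rewrite !integral_lattice//.
  have B : set_bij [set: lattice n] [set: lattice n]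
      (fun k => k + k0 : 'cV[int]_n).
    split => //; first by move=> x y _ _; exact: addIr.
    by move=> y _; exists (y - k0 : 'cV[int]_n) => //; rewrite subrK.
  congr (fine (_ - _)); rewrite [RHS](reindex_esum _ _ _ _ B);
    by apply: eq_esum => k _; rewrite ?funeposE ?funenegE.
apply: complex_eqP.
- exact: (E (fun k => complex.Re (f k))).
- exact: (E (fun k => complex.Im (f k))).
Qed.

End continuous_phase.

(** * Quasi-periodicity of Gaussian lattice sums *)

Section source_integral.
Variable R : realType.
Local Notation C := R[i].
Local Notation phase n := ('cV[R]_n * 'cV[R]_n)%type.
Local Notation T n := (n.-tuple (measurableTypeR R)).
Local Notation cnt n := (@lattice_count n R).
Local Notation ex a := (cexp (0 +i* (a : R))).

Lemma ex_dotv_period n (k l : 'cV[int]_n) : ex (dotv (intv R k) (period R l)) = 1.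
Proof.
rewrite -[RHS](ex_intpi R (\sum_i k i 0 * l i 0)) dotv_sum.
congr (cexp (0 +i* _)); rewrite rmorph_sum mulr_suml; apply: eq_bigr => i _.
by rewrite !mxE rmorphM /=; ring.
Qed.

Lemma intvD n (k l : 'cV[int]_n) : intv R (k + l) = intv R k + intv R l.
Proof. exact: (map_mxD intr). Qed.

Lemma periodD n (k l : 'cV[int]_n) : period R (k + l) = period R k + period R l.
Proof. by rewrite /period intvD scalerDr. Qed.

Lemma dotvDl n (a b x : 'cV[R]_n) : dotv (a + b) x = dotv a x + dotv b x.
Proof. by rewrite dotvC dotvDr !(dotvC x). Qed.

Variables (m n : nat) (S : 'M[C]_(m + n)).
Context d (W : measurableType d) (nu : {sigma_finite_measure set W -> \bar R}).
Variables (s : W -> 'cV[R]_n) (G : W -> C).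
Hypothesis ms : mcol s.
Hypothesis mG : cmeas G.
Hypothesis iG : forall e : R, 0 < e ->
  rintegrable nu (fun t => gauss_weight e (s t) * normc (G t)).
Hypothesis gS : gauss_dominated S.

(** The operator with the bare Gaussian kernel, from which [theta_transform] is
    obtained by summing over the periods. *)
Definition source_integral (z : 'cV[R]_m) : C :=
  cint nu (fun t => ekernel S z (s t) * G t).

Let src_ge0 e t : 0 <= gauss_weight e (s t) * normc (G t).
Proof. by rewrite mulr_ge0 ?gauss_weight_ge0 ?normc_ge0. Qed.

Let dom_ge0 (c e : R) : (forall x y,
    normc (ekernel S x y) <= c * (gauss_weight e x * gauss_weight e y)) -> 0 <= c.
Proof.
move=> /(_ 0 0) /(le_trans (normc_ge0 _)); rewrite pmulr_lge0//.
by rewrite mulr_gt0 ?gauss_weight_gt0.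
Qed.

Let src_le c e z t : (forall x y,
    normc (ekernel S x y) <= c * (gauss_weight e x * gauss_weight e y)) ->
  normc (ekernel S z (s t) * G t) <=
  (c * gauss_weight e z) * (gauss_weight e (s t) * normc (G t)).
Proof. by move=> h; rewrite normcM mulrA ler_wpM2r ?normc_ge0// -mulrA. Qed.

Lemma cintegrable_source z : cintegrable nu (fun t => ekernel S z (s t) * G t).
Proof.
have [c [e [e0 h]]] := gS.
have iB := rintegrableZ (c * gauss_weight e z) (iG e0).
apply: (cintegrable_le _ _ iB) => [|t]; last exact: src_le.
by apply: cmeasM => //; apply: cmeas_ekernel => //; exact: mcol_cst.
Qed.

Lemma cmeas_source_integral : cmeas (fun t : T m => source_integral (col_of_tuple t)).
Proof.
have [c [e [e0 h]]] := gS; have c0 := dom_ge0 h.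
have ia := rintegrableZ c (rintegrable_gauss_weight m e0).
apply: (cmeas_cint1 ia (iG e0) _ (src_ge0 e)
  (f := fun z => ekernel S (col_of_tuple z.1) (s z.2) * G z.2)).
- by move=> t; rewrite mulr_ge0 ?gauss_weight_ge0.
- apply: cmeasM; last exact: cmeas_comp.
  by apply: cmeas_ekernel; apply: mcol_comp => //; exact: mcol_tuple.
- by move=> x y; exact: src_le.
Qed.

Lemma source_integral_le : exists c e : R, 0 < e /\
  forall z, normc (source_integral z) <= c * gauss_weight e z.
Proof.
have [c [e [e0 h]]] := gS.
exists (2 * (\int[nu]_t (gauss_weight e (s t) * normc (G t))) * c), e; split => // z.
have iB := rintegrableZ (c * gauss_weight e z) (iG e0).
have mF : cmeas (fun t => ekernel S z (s t) * G t).
  by apply: cmeasM => //; apply: cmeas_ekernel => //; exact: mcol_cst.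
apply: le_trans (normc_cint mF (fun t => src_le z t h) iB) _.
rewrite RintegralZl//; last exact: iG.
by rewrite le_eqVlt; apply/orP; left; apply/eqP; ring.
Qed.

Lemma theta_transform_sum (p : phase m) : theta_transform S nu s G p =
  cint (cnt m) (fun k => ex (dotv (intv R k) p.2) * source_integral (p.1 + period R k)).
Proof.
have [c [e [e0 h]]] := gS; have c0 := dom_ge0 h.
have e20 : 0 < e / 2 by rewrite divr_gt0.
pose K := c * expR (e * sqnorm p.1).
have K0 : 0 <= K by rewrite mulr_ge0// expR_ge0.
have ia := rintegrableZ K (rintegrable_lattice m e20).
rewrite /theta_transform (cint_fubini1 ia (iG e0) _ (src_ge0 e)); last 3 first.
- by move=> t; rewrite mulr_ge0 ?gauss_weight_ge0.
- apply: cmeas_lattice_prod => k /=; apply: cmeasM; first exact: cmeas_cst.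
  by apply: cmeasM => //; apply: cmeas_ekernel => //; exact: mcol_cst.
- move=> k t /=; rewrite normcM normc_ex mul1r.
  apply: le_trans (src_le _ _ h) _; rewrite ler_wpM2r// -mulrA ler_wpM2l//.
  exact: gauss_weight_shift (ltW e0).
apply: eq_cint => k /=; rewrite /source_integral -cintZ//.
exact: cintegrable_source.
Qed.

Lemma cintegrable_theta_transform_sum (p : phase m) : cintegrable (cnt m)
  (fun k => ex (dotv (intv R k) p.2) * source_integral (p.1 + period R k)).
Proof.
have [c [e [e0 h]]] := source_integral_le.
have c0 : 0 <= c.
  have := le_trans (normc_ge0 _) (h 0).
  by rewrite pmulr_lge0 ?gauss_weight_gt0.
have e20 : 0 < e / 2 by rewrite divr_gt0.
have ia := rintegrableZ (c * expR (e * sqnorm p.1)) (rintegrable_lattice m e20).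
apply: (cintegrable_le _ _ ia) => // k.
rewrite normcM normc_ex mul1r; apply: le_trans (h _) _; rewrite -mulrA ler_wpM2l//.
exact: gauss_weight_shift (ltW e0).
Qed.

(** The characters are trivial on the periods, and a translation of [x] by a
    period amounts to a translation of the summation index. *)
Lemma theta_space_transform : theta_space (theta_transform S nu s G).
Proof.
split; first exact: smooth_theta_transform.
move=> k0 x xi; split.
  rewrite !theta_transform_sum; apply: eq_cint => k /=.
  by rewrite dotvDr exD ex_dotv_period mulr1.
rewrite !theta_transform_sum -[in RHS](cint_lattice_shift k0).
have E k : ex (dotv (intv R (k + k0)) xi) * source_integral (x + period R (k + k0)) =
    ex (dotv (intv R k0) xi) * (ex (dotv (intv R k) xi) *
      source_integral (x + period R k0 + period R k)).
  by rewrite intvD dotvDl exD periodD addrA addrAC [X in X * _]mulrC mulrA.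
under [in RHS]eq_cint do rewrite E.
rewrite (cintZ _ (cintegrable_theta_transform_sum (x + period R k0, xi))) mulrA.
by rewrite -exD addNr cexp0 mul1r.
Qed.

End source_integral.

(** * The operators as Gaussian lattice sums *)

Section sigma_finite_product.
Context d1 d2 (T1 : measurableType d1) (T2 : measurableType d2) (R : realType).
Variables (mu : {sigma_finite_measure set T1 -> \bar R})
          (nu : {sigma_finite_measure set T2 -> \bar R}).

Let sigma_finite_product : sigma_finite setT (mu \x nu)%E.
Proof.
have /sigma_finiteP[F [FT ndF mF]] := sigma_finiteT mu.
have /sigma_finiteP[G [GT ndG mG]] := sigma_finiteT nu.
exists (fun i => F i `*` G i).
  apply/esym; rewrite -subTset => -[x y] _.
  have [i _ Fi] : (\bigcup_i F i) x by rewrite -FT.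
  have [j _ Gj] : (\bigcup_i G i) y by rewrite -GT.
  exists (maxn i j) => //; split => /=.
  - by move: Fi; exact/subsetPset/ndF/leq_maxl.
  - by move: Gj; exact/subsetPset/ndG/leq_maxr.
move=> i; have [mFi Fioo] := mF i; have [mGi Gioo] := mG i.
split; first exact: measurableX.
by rewrite product_measure1E// lte_mul_pinfty// ge0_fin_numE.
Qed.

(** The product measure under a constant of its own, to which sigma-finiteness
    is attached. *)
Definition sigma_product : set (T1 * T2)%type -> \bar R := (mu \x nu)%E.

HB.instance Definition _ := Measure.copy sigma_product (mu \x nu)%E.
HB.instance Definition _ :=
  Measure_isSigmaFinite.Build _ _ _ sigma_product sigma_finite_product.

End sigma_finite_product.

Section operators.
Variable R : realType.
Local Notation C := R[i].
Local Notation phase n := ('cV[R]_n * 'cV[R]_n)%type.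
Local Notation T n := (n.-tuple (measurableTypeR R)).
Local Notation leb n := (@lebesgue_tuple R n).
Local Notation leb2 n := (sigma_product (leb n) (leb n)).
Local Notation cnt n := (@lattice_count n R).
Local Notation ex a := (cexp (0 +i* (a : R))).

Definition cols n (w : T n * T n) : phase n :=
  (col_of_tuple w.1, col_of_tuple w.2).

(** A function on the fundamental domain, extended by zero. *)
Definition cut n (g : phase n -> C) (w : T n * T n) : C :=
  (chi w.1 * chi w.2)%:C * g (cols w).

Lemma phase_integral_cut n (K g : phase n -> C) :
  phase_integral (fun w => K w * g w) =
  cint (leb2 n) (fun w => K (cols w) * cut g w).
Proof.
have E (t : T n * T n) : (chi t.1 * chi t.2) = \1_(@cube R n `*` @cube R n) t :> R.
  rewrite /chi !indicE -natrM mulnb; congr (_ %:R); congr nat_of_bool.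
  by apply/andP/idP => [[/set_mem ? /set_mem ?]|/set_mem[? ?]];
    [exact/mem_set|split; exact/mem_set].
rewrite /phase_integral /cintegral; apply: complex_eqP => /=.
- rewrite Rintegral_mkcond; apply: eq_Rintegral => t _.
  rewrite /cut mulrCA [in RHS]ReM /= mul0r subr0 E patchE indicE.
  by case: ifP; rewrite ?mul1r ?mul0r.
- rewrite Rintegral_mkcond; apply: eq_Rintegral => t _.
  rewrite /cut mulrCA [in RHS]ImM /= mul0r addr0 E patchE indicE.
  by case: ifP; rewrite ?mul1r ?mul0r.
Qed.

Lemma ccont_theta_space n (g : phase n -> C) : theta_space g -> ccont g.
Proof. by move=> [/(_ 0)[[c1 _] [c2 _]] _]. Qed.

Section phase_function.
Variables (n : nat) (g : phase n -> C).
Hypothesis cg : ccont g.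

Lemma cmeas_cols : cmeas (fun w : T n * T n => g (cols w)).
Proof.
have m1 : mcol (fun w : T n * T n => col_of_tuple w.1).
  by apply: mcol_comp; [exact: mcol_tuple|exact: measurable_fst].
have m2 : mcol (fun w : T n * T n => col_of_tuple w.2).
  by apply: mcol_comp; [exact: mcol_tuple|exact: measurable_snd].
have [c1 c2] := cg; split.
- exact: (measurable_continuous_phase c1 m1 m2).
- exact: (measurable_continuous_phase c2 m1 m2).
Qed.

Lemma measurable_chi2 :
  measurable_fun setT (fun w : T n * T n => chi w.1 * chi w.2 : R).
Proof.
apply: measurable_funM.
- exact: (measurableT_comp (@measurable_chi R n) measurable_fst).
- exact: (measurableT_comp (@measurable_chi R n) measurable_snd).
Qed.

Lemma cmeas_cut : cmeas (cut g).
Proof.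
by apply: cmeasM; [apply: cmeas_real; exact: measurable_chi2|exact: cmeas_cols].
Qed.

Lemma cut_le : exists2 M : R, 0 <= M &
  forall w, normc (cut g w) <= M * (chi w.1 * chi w.2).
Proof.
have [c1 c2] := cg.
have [M1 h1] := bounded_on_cube c1; have [M2 h2] := bounded_on_cube c2.
exists (`|M1| + `|M2|); first by rewrite addr_ge0.
move=> w; rewrite /cut normcM normc_real mulrC.
have [->|[cw1 ->]] := chi_cube w.1; first by rewrite mul0r normr0 !mulr0.
have [->|[cw2 ->]] := chi_cube w.2; first by rewrite mulr0 normr0 !mulr0.
rewrite mulr1 normr1 !mulr1; apply: le_trans (normc_le _) _; apply: lerD.
- by apply: le_trans (h1 _ _ cw1 cw2) (ler_norm _).
- by apply: le_trans (h2 _ _ cw1 cw2) (ler_norm _).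
Qed.

Lemma rintegrable_chi2 : rintegrable (leb2 n) (fun w => chi w.1 * chi w.2).
Proof.
exact: (rintegrable_tensor (@rintegrable_chi R n) (@rintegrable_chi R n)
  (@chi_ge0 R n) (@chi_ge0 R n)).
Qed.

(** The source of the lattice sum: the cube integral, unfolded along the
    periods in the first variable. *)
Definition src_measure :
  {sigma_finite_measure set ((T n * T n) * lattice n)%type -> \bar R} :=
  sigma_product (leb2 n) (cnt n).

Definition src_point (t : (T n * T n) * lattice n) : 'cV[R]_n :=
  col_of_tuple t.1.1 + period R t.2.

Definition src_amp (c : C) (t : (T n * T n) * lattice n) : C :=
  ex (- dotv (intv R t.2) (col_of_tuple t.1.2)) * (c * cut g t.1).

Lemma mcol_src_point : mcol src_point.
Proof.
apply: mcolD; last exact: (measurable_period measurable_snd).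
apply: (mcol_comp (@mcol_tuple R n)).
exact: (measurableT_comp measurable_fst measurable_fst).
Qed.

Lemma cmeas_src_amp c : cmeas (src_amp c).
Proof.
apply: cmeasM.
- apply/cmeas_cexp/cmeas_imag/measurable_funN/measurable_dotv.
  + exact: measurable_intv measurable_snd.
  + apply: (mcol_comp (@mcol_tuple R n)).
    exact: (measurableT_comp measurable_snd measurable_fst).
- apply: cmeasM; first exact: cmeas_cst.
  exact: (cmeas_comp cmeas_cut measurable_fst).
Qed.

Lemma src_amp_le c e : 0 <= e -> exists2 K : R, 0 <= K & forall t,
  gauss_weight e (src_point t) * normc (src_amp c t) <=
  K * (chi t.1.1 * chi t.1.2) * gauss_weight (e / 2) (period R t.2).
Proof.
move=> e0; have [M M0 hM] := cut_le.
pose B := expR (e * (n%:R * (2 * pi) ^+ 2)); have B0 : 0 <= B by exact: expR_ge0.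
exists (B * (normc c * M)); first by rewrite !mulr_ge0 ?normc_ge0.
move=> [w l] /=; rewrite /src_point /src_amp /=.
rewrite normcM normc_ex mul1r normcM.
have [x0|[cw _]] := chi_cube w.1.
  by rewrite /cut x0 mul0r normcM normc_real normr0 !(mul0r, mulr0).
have h1 : gauss_weight e (col_of_tuple w.1 + period R l) <=
    B * gauss_weight (e / 2) (period R l).
  apply: le_trans (gauss_weight_shift _ _ e0) _.
  by rewrite ler_wpM2r ?gauss_weight_ge0// ler_expR ler_wpM2l// sqnorm_cube.
have h2 : normc c * normc (cut g w) <= normc c * (M * (chi w.1 * chi w.2)).
  by rewrite ler_wpM2l ?normc_ge0.
have := ler_pM (gauss_weight_ge0 _ _) (mulr_ge0 (normc_ge0 _) (normc_ge0 _)) h1 h2.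
by apply: eq_ind; congr (_ <= _); ring.
Qed.

Lemma rintegrable_src c e : 0 < e ->
  rintegrable src_measure
    (fun t => gauss_weight e (src_point t) * normc (src_amp c t)).
Proof.
move=> e0; have [K K0 h] := src_amp_le c (ltW e0).
have e2 : 0 < e / 2 by rewrite divr_gt0.
have ib := rintegrable_lattice n e2.
have ia := rintegrableZ K rintegrable_chi2.
have := rintegrable_tensor ia ib.
move=> /(_ (fun w => mulr_ge0 K0 (mulr_ge0 (chi_ge0 _) (chi_ge0 _)))).
move=> /(_ (fun k => gauss_weight_ge0 _ _)) it.
apply: (rintegrable_le _ _ it).
- apply: measurable_funM.
  + exact: (measurable_gauss_weight _ mcol_src_point).
  + exact: (measurable_normc (cmeas_src_amp c)).
- by move=> t; rewrite ger0_norm ?mulr_ge0 ?gauss_weight_ge0 ?normc_ge0.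
Qed.

End phase_function.

Section kernel.
Variables (m n : nat) (S : 'M[C]_(m + n)).
Hypothesis gS : gauss_dominated S.

Let kk (p : phase m) (w : phase n) (k : lattice m) (l : lattice n) : C :=
  ekernel S (p.1 + period R k) (w.1 + period R l) *
  ex (dotv (intv R k) p.2) * ex (- dotv (intv R l) w.2).

Let kk_le p w : exists K e : R, [/\ 0 <= K, 0 < e & forall k l,
  normc (kk p w k l) <=
  (K * gauss_weight e (period R k)) * gauss_weight e (period R l)].
Proof.
have [c [e [e0 h]]] := gS; have e2 : 0 < e / 2 by rewrite divr_gt0.
pose B := expR (e * sqnorm p.1); pose B' := expR (e * sqnorm w.1).
have [B0 B'0] : 0 <= B /\ 0 <= B' by split; exact: expR_ge0.
exists (`|c| * (B * B')), (e / 2); split => //; first by rewrite !mulr_ge0.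
move=> k l; rewrite /kk normcM normc_ex mulr1 normcM normc_ex mulr1.
apply: le_trans (h _ _) _.
have h1 := gauss_weight_shift p.1 (period R k) (ltW e0).
have h2 := gauss_weight_shift w.1 (period R l) (ltW e0).
have h3 := ler_pM (gauss_weight_ge0 _ _) (gauss_weight_ge0 _ _) h1 h2.
have h4 : 0 <= gauss_weight e (p.1 + period R k) * gauss_weight e (w.1 + period R l).
  by rewrite mulr_ge0 ?gauss_weight_ge0.
apply: le_trans (ler_wpM2r h4 (ler_norm c)) _.
by apply: le_trans (ler_wpM2l (normr_ge0 c) h3) _; rewrite le_eqVlt;
  apply/orP; left; apply/eqP; rewrite /B /B'; ring.
Qed.

Let cintegrable_kk1 p w k : cintegrable (cnt n) (kk p w k).
Proof.
have [K [e [K0 e0 h]]] := kk_le p w.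
have ia := rintegrableZ (K * gauss_weight e (period R k)) (rintegrable_lattice n e0).
by apply: (cintegrable_le _ _ ia).
Qed.

Let cintegrable_kk2 p w :
  cintegrable (cnt m) (fun k => cint (cnt n) (kk p w k)).
Proof.
have [K [e [K0 e0 h]]] := kk_le p w.
have iL := rintegrable_lattice n e0.
have ia := rintegrableZ (2 * (\int[cnt n]_l gauss_weight e (period R l)))
  (rintegrableZ K (rintegrable_lattice m e0)).
apply: (cintegrable_le _ _ ia) => // k.
have mk : cmeas (fun z : lattice m * lattice n => kk p w z.1 z.2).
  by apply: cmeas_lattice_prod.
exact: (normc_cint1 iL mk h k).
Qed.

Lemma theta_kernelE p w : theta_kernel S p w =
  cint (cnt m) (fun k => cint (cnt n) (fun l => kk p w k l)).
Proof.
have -> : theta_kernel S p w = csum (fun k => cint (cnt n) (kk p w k)).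
  by congr csum; apply/funext => k; rewrite -csum_cint.
exact: csum_cint.
Qed.

Variables (g : phase n -> C) (c : C).
Hypothesis cg : ccont g.

Let sp := @src_point n.
Let amp := src_amp g c.

Let F (p : phase m) (k : lattice m) (t : (T n * T n) * lattice n) : C :=
  ex (dotv (intv R k) p.2) * (ekernel S (p.1 + period R k) (sp t) * amp t).

Let cmeas_F p k : cmeas (F p k).
Proof.
apply: cmeasM; first exact: cmeas_cst.
apply: cmeasM; last exact: cmeas_src_amp.
by apply: cmeas_ekernel; [exact: mcol_cst|exact: mcol_src_point].
Qed.

Let F_le p : exists K e : R, [/\ 0 <= K, 0 < e & forall k t, normc (F p k t) <=
  (K * gauss_weight e (period R k)) *
  ((chi t.1.1 * chi t.1.2) * gauss_weight e (period R t.2))].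
Proof.
have [c0 [e [e0 h]]] := gS; have e2 : 0 < e / 2 by rewrite divr_gt0.
have [K K0 hK] := src_amp_le cg c (ltW e0).
pose B := expR (e * sqnorm p.1); have B0 : 0 <= B by exact: expR_ge0.
exists (`|c0| * B * K), (e / 2); split => //; first by rewrite !mulr_ge0.
move=> k t; rewrite /F normcM normc_ex mul1r normcM.
apply: le_trans (ler_wpM2r (normc_ge0 _) (h _ _)) _.
have h1 := gauss_weight_shift p.1 (period R k) (ltW e0).
have h2 : 0 <= gauss_weight e (sp t) * normc (amp t).
  by rewrite mulr_ge0 ?gauss_weight_ge0 ?normc_ge0.
have h3 := ler_pM (gauss_weight_ge0 _ _) h2 h1 (hK t).
have h4 : 0 <= gauss_weight e (p.1 + period R k) *
    (gauss_weight e (sp t) * normc (amp t)).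
  by rewrite mulr_ge0 ?gauss_weight_ge0.
rewrite -!mulrA; apply: le_trans (ler_wpM2r h4 (ler_norm c0)) _.
by apply: le_trans (ler_wpM2l (normr_ge0 c0) h3) _; rewrite le_eqVlt;
  apply/orP; left; apply/eqP; rewrite /B; ring.
Qed.

(** Absolute convergence lets the lattice sums be taken outside the integral. *)
Lemma kernel_integral_transform p :
  let f := fun w => theta_kernel S p (cols w) * (c * cut g w) in
  cintegrable (leb2 n) f /\
  cint (leb2 n) f = theta_transform S (src_measure n) sp amp p.
Proof.
have [K [e [K0 e0 h]]] := F_le p.
have iK := rintegrableZ K (rintegrable_lattice m e0).
have K0k (k : lattice m) : 0 <= K * gauss_weight e (period R k).
  by rewrite mulr_ge0 ?gauss_weight_ge0.
have iL := rintegrable_lattice n e0.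
have L0 (l : lattice n) : 0 <= gauss_weight e (period R l) by exact: gauss_weight_ge0.
have iC := @rintegrable_chi2 n.
have C0 (w : T n * T n) : 0 <= chi w.1 * chi w.2 :> R by rewrite mulr_ge0 ?chi_ge0.
have iCL : rintegrable (src_measure n) (fun t =>
    (chi t.1.1 * chi t.1.2) * gauss_weight e (period R t.2)).
  exact: (rintegrable_tensor iC iL C0 L0).
have CL0 (t : (T n * T n) * lattice n) :
    0 <= (chi t.1.1 * chi t.1.2) * gauss_weight e (period R t.2).
  by rewrite mulr_ge0.
have mF : cmeas (fun z => F p z.1 z.2).
  by apply: cmeas_lattice_prod => k; exact: cmeas_F.
move=> f; rewrite /theta_transform (cint_fubini1 iK iCL K0k CL0 mF h).
pose H (z : lattice m * (T n * T n)) := cint (cnt n) (fun l => F p z.1 (z.2, l)).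
have hk k w l : normc (F p k (w, l)) <=
    (K * gauss_weight e (period R k) * (chi w.1 * chi w.2)) * gauss_weight e (period R l).
  by rewrite -mulrA; exact: (h k (w, l)).
have iCk (k : lattice m) := rintegrableZ (K * gauss_weight e (period R k)) iC.
have Ck0 (k : lattice m) (w : T n * T n) :
    0 <= K * gauss_weight e (period R k) * (chi w.1 * chi w.2).
  by rewrite mulr_ge0.
have -> : cint (cnt m) (fun k => cint (src_measure n) (F p k)) =
    cint (cnt m) (fun k => cint (leb2 n) (fun w => H (k, w))).
  apply: eq_cint => k; transitivity (cint (leb2 n \x cnt n)%E (F p k)) => //.
  exact: (cint_fubini1 (iCk k) iL (Ck0 k) L0 (cmeas_F p k) (hk k)).
have mH : cmeas H.
  apply: cmeas_lattice_prod => k.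
  exact: (cmeas_cint1 (iCk k) iL (Ck0 k) L0 (cmeas_F p k) (hk k)).
pose I := \int[cnt n]_l gauss_weight e (period R l).
have iI := rintegrableZ (2 * I) iK.
have I0 : 0 <= I by apply: Rintegral_ge0.
have I0k (k : lattice m) : 0 <= 2 * I * (K * gauss_weight e (period R k)).
  by apply: mulr_ge0 (K0k k); rewrite mulr_ge0.
have HkI k w : normc (H (k, w)) <=
    2 * I * (K * gauss_weight e (period R k)) * (chi w.1 * chi w.2).
  rewrite -mulrA; exact: (normc_cint1 iL (cmeas_F p k) (hk k) w).
rewrite (cint_swap iI iC I0k C0 mH HkI).
have E w : theta_kernel S p (cols w) * (c * cut g w) =
    cint (cnt m) (fun k => H (k, w)).
  rewrite theta_kernelE /H mulrC -cintZ//; apply: eq_cint => k; rewrite -cintZ//.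
  by apply: eq_cint => l; rewrite /F /kk /sp /amp /src_point /src_amp /=; ring.
rewrite /f (funext E); split => //.
pose J := 2 * (\int[cnt m]_k (2 * I * (K * gauss_weight e (period R k)))).
apply: (cintegrable_le (a := fun w => J * (chi w.1 * chi w.2))).
- exact: (cmeas_cint2 iI iC I0k C0 mH HkI).
- move=> w; rewrite /J -mulrA [X in _ * X]mulrC -RintegralZl//.
  apply: normc_cint; last exact: rintegrableZ.
  + exact: (cmeas_comp mH (measurable_pair2 w)).
  + by move=> k; rewrite mulrC; exact: HkI.
- exact: rintegrableZ.
Qed.

End kernel.

Lemma kernel_op_transform m n (S : 'M[C]_(m + n)) (a : C) (g : phase n -> C) :
  gauss_dominated S -> ccont g ->
  kernel_op (fun p w => a * theta_kernel S p w) g =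
  theta_transform S (src_measure n) (@src_point n)
    (src_amp g ((((2 * pi) `^ (3 * (n + m)%:R / 4))^-1)%:C * a)).
Proof.
move=> gS cg; apply/funext => p; rewrite /kernel_op phase_integral_cut.
set k := (_^-1)%:C.
have [_ <-] := kernel_integral_transform gS (k * a) cg p.
have [ia _] := kernel_integral_transform gS a cg p.
transitivity (k * cint (leb2 n) (fun w => theta_kernel S p (cols w) * (a * cut g w))).
  by congr (_ * _); apply: eq_cint => w; rewrite mulrA [a * _]mulrC.
by rewrite -cintZ//; apply: eq_cint => w; rewrite -[k * a * _]mulrA mulrCA.
Qed.

End operators.

(** * Composition of Gaussian kernels *)

Section gaussian_composition.
Variable R : realType.
Local Notation C := R[i].
Local Notation T n := (n.-tuple (measurableTypeR R)).
Local Notation leb n := (@lebesgue_tuple R n).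
Local Notation cx v := (map_mx (real_complex R) v).

Lemma Re_negdef_half_form n (S : 'M[C]_n) : Re_negdef S ->
  exists2 e : R, 0 < e & forall z, complex.Re (half_form S z) <= - (e * sqnorm z).
Proof.
move=> nS; have [v v0|e e0 he] := @coercive_posdef R n (- S).
  have -> : map_mx (@complex.Re R) (- S) = - map_mx (@complex.Re R) S.
    by apply/matrixP => i j; rewrite !mxE ReN.
  by rewrite mulmxN mulNmx mxE oppr_gt0; exact: nS.
exists (e / 2) => [|z]; first by rewrite divr_gt0.
have := he z; rewrite half_formE Re_half.
have -> : qform (- S) z = - qform S z.
  rewrite /qform -sumrN; apply: eq_bigr => i _; rewrite -sumrN.
  by apply: eq_bigr => j _; rewrite mxE mulNr.
by rewrite ReN; lra.
Qed.

Lemma Re_negdef_gauss_dominated m n (S : 'M[C]_(m + n)) :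
  Re_negdef S -> gauss_dominated S.
Proof.
move=> /Re_negdef_half_form[e e0 he]; exists 1, e; split => // x y.
by rewrite mul1r -gauss_weight_col_mx normc_cexp ler_expR.
Qed.

(** Both factors decay in the middle variable. *)
Lemma ekernel_mul_le m q n (S1 : 'M[C]_(m + q)) (S2 : 'M[C]_(q + n)) :
  gauss_dominated S1 -> gauss_dominated S2 -> exists c e1 e2 : R,
  [/\ 0 <= c, 0 < e1, 0 < e2 & forall x z y,
    normc (ekernel S1 x z * ekernel S2 z y) <=
    c * gauss_weight e1 x * gauss_weight (e1 + e2) z * gauss_weight e2 y].
Proof.
move=> [c1 [e1 [e10 h1]]] [c2 [e2 [e20 h2]]].
exists (`|c1| * `|c2|), e1, e2; split => // x z y; rewrite normcM gauss_weightD.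
have h1' : normc (ekernel S1 x z) <= `|c1| * (gauss_weight e1 x * gauss_weight e1 z).
  apply: le_trans (h1 x z) _.
  by rewrite ler_wpM2r ?ler_norm// mulr_ge0 ?gauss_weight_ge0.
have h2' : normc (ekernel S2 z y) <= `|c2| * (gauss_weight e2 z * gauss_weight e2 y).
  apply: le_trans (h2 z y) _.
  by rewrite ler_wpM2r ?ler_norm// mulr_ge0 ?gauss_weight_ge0.
have := ler_pM (normc_ge0 _) (normc_ge0 _) h1' h2'.
by apply: eq_ind; congr (_ <= _); ring.
Qed.

Let addmx00 (A B : 'M[C]_1) : (A + B) 0 0 = A 0 0 + B 0 0.
Proof. by rewrite mxE. Qed.

Let mx00 : (0 : 'M[C]_1) 0 0 = 0.
Proof. by rewrite mxE. Qed.

Let oppmx00 (B : 'M[C]_1) : (- B) 0 0 = - B 0 0.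
Proof. by rewrite mxE. Qed.

Let bilinN p r (a : 'rV[C]_p) (B : 'M[C]_(p, r)) (b : 'cV[C]_r) :
  (a *m (- B) *m b) 0 0 = - (a *m B *m b) 0 0.
Proof. by rewrite mulmxN mulNmx; exact: oppmx00. Qed.

Let bilinD p r (a : 'rV[C]_p) (B D : 'M[C]_(p, r)) (b : 'cV[C]_r) :
  (a *m (B + D) *m b) 0 0 = (a *m B *m b) 0 0 + (a *m D *m b) 0 0.
Proof. by rewrite mulmxDr mulmxDl; exact: addmx00. Qed.

Lemma half_form_block m n (K : 'M[C]_m) (L : 'M[C]_(m, n)) L' (M : 'M[C]_n) x y :
  half_form (block_mx K L L' M) (col_mx x y) =
  (((cx x)^T *m K *m cx x) 0 0 + ((cx x)^T *m L *m cx y) 0 0 +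
   ((cx y)^T *m L' *m cx x) 0 0 + ((cx y)^T *m M *m cx y) 0 0) / 2.
Proof.
rewrite /half_form map_col_mx tr_col_mx mul_row_block mul_row_col !mulmxDl.
by rewrite !addmx00; congr (_ / _); ring.
Qed.

Let cx0 n : cx (0 : 'cV[R]_n) = 0.
Proof. by apply/matrixP => i j; rewrite !mxE. Qed.

Lemma half_form_block0r m n (K : 'M[C]_m) L L' (M : 'M[C]_n) x :
  half_form (block_mx K L L' M) (col_mx x 0) = half_form K x.
Proof. by rewrite half_form_block cx0 trmx0 !(mulmx0, mul0mx) mx00 !addr0. Qed.

Lemma half_form_block0l m n (K : 'M[C]_m) L L' (M : 'M[C]_n) y :
  half_form (block_mx K L L' M) (col_mx 0 y) = half_form M y.
Proof. by rewrite half_form_block cx0 trmx0 !(mulmx0, mul0mx) mx00 !add0r. Qed.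

Lemma qform_mx n (A : 'M[C]_n) z : qform A z = ((cx z)^T *m A *m cx z) 0 0.
Proof.
have := half_formE A z; rewrite /half_form.
by move=> /(congr1 ( *%R^~ 2)); rewrite !divfK.
Qed.

Lemma lform_mx n (u : 'cV[C]_n) z : lform u z = (u^T *m cx z) 0 0.
Proof. by rewrite mxE; apply: eq_bigr => i _; rewrite !mxE. Qed.

(** The two evaluations of the Gaussian integral, compared at [u = 0]. *)
Lemma det_invsqrt_sqr n (A : 'M[C]_n) e :
  symmetric_mx A -> 0 < e -> coercive e A -> det_invsqrt A ^+ 2 * \det A = 1.
Proof.
move=> sA e0 cA; have [c hc H] := cint_ggauss sA e0 cA.
have := H 0 0 (mulmx0 _ _); rewrite (cint_ggauss_det sA e0 cA (mulmx0 _ _)).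
move=> /(mulIf (cexp_neq0 _))/mulfI -> //.
by rewrite fmorph_eq0 expf_eq0 negb_and sqrtr_eq0 -ltNge mulr_gt0 ?pi_gt0 ?orbT.
Qed.

Section convolution.
Variables (m q n : nat).
Variables (K1 : 'M[C]_m) (L1 : 'M[C]_(m, q)) (M1 : 'M[C]_q).
Variables (K2 : 'M[C]_q) (L2 : 'M[C]_(q, n)) (M2 : 'M[C]_n).
Let S1 : 'M[C]_(m + q) := block_mx K1 L1 L1^T M1.
Let S2 : 'M[C]_(q + n) := block_mx K2 L2 L2^T M2.
Hypothesis sS1 : symmetric_mx S1.
Hypothesis nS1 : Re_negdef S1.
Hypothesis sS2 : symmetric_mx S2.
Hypothesis nS2 : Re_negdef S2.
Let A := - M1 - K2.
Let W := invmx (M1 + K2).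
Let S3 : 'M[C]_(m + n) :=
  block_mx (K1 - L1 *m W *m L1^T) (- (L1 *m W *m L2))
           (- (L2^T *m W *m L1^T)) (M2 - L2^T *m W *m L2).

Let symM : (M1 + K2)^T = M1 + K2.
Proof.
rewrite linearD /=; congr (_ + _).
- by have := congr1 drsubmx sS1; rewrite tr_block_mx !block_mxKdr.
- by have := congr1 ulsubmx sS2; rewrite tr_block_mx !block_mxKul.
Qed.

Let AE : A = - (M1 + K2). Proof. by rewrite opprD. Qed.

Let symA : symmetric_mx A.
Proof. by rewrite /symmetric_mx AE linearN /= symM. Qed.

Let coerciveA : exists2 e : R, 0 < e & coercive e A.
Proof.
have [e1 e10 h1] := Re_negdef_half_form nS1.
have [e2 e20 h2] := Re_negdef_half_form nS2.
exists (2 * (e1 + e2)) => [|z]; first by rewrite mulr_gt0// addr_gt0.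
have := h1 (col_mx 0 z); have := h2 (col_mx z 0).
rewrite half_form_block0l half_form_block0r !sqnorm_col_mx.
have -> : sqnorm (0 : 'cV[R]_m) = 0.
  by rewrite /sqnorm big1// => i _; rewrite mxE expr0n.
have -> : sqnorm (0 : 'cV[R]_n) = 0.
  by rewrite /sqnorm big1// => i _; rewrite mxE expr0n.
rewrite addr0 add0r !half_formE !Re_half.
have -> : qform A z = - qform M1 z - qform K2 z.
  by rewrite !qform_mx /A bilinD (bilinN _ M1) (bilinN _ K2).
by rewrite ReD !ReN; lra.
Qed.

Let unitM : M1 + K2 \in unitmx.
Proof.
have [e e0 cA] := coerciveA; have := det_invsqrt_sqr symA e0 cA.
rewrite AE => h; rewrite -(opprK (M1 + K2)) unitmxE unitfE.
rewrite -scaleN1r detZ mulf_neq0// ?signr_eq0//.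
by apply/eqP => d0; move: h; rewrite d0 mulr0 => /esym/eqP; rewrite oner_eq0.
Qed.

Lemma det_invsqrt_neq0 : det_invsqrt A != 0.
Proof.
have [e e0 cA] := coerciveA; have := det_invsqrt_sqr symA e0 cA.
move=> h; apply/eqP => d0; move: h.
by rewrite d0 expr0n mul0r => /esym/eqP; rewrite oner_eq0.
Qed.

(** The product of the two kernels is a Gaussian in the middle variable, with
    quadratic part [A] and linear part [u]; completing the square produces the
    correction of [S3] by [W]. *)
Lemma ekernel_convolution x y :
  cint (leb q) (fun t => ekernel S1 x (col_of_tuple t) * ekernel S2 (col_of_tuple t) y) =
  (Num.sqrt (2 * pi) ^+ q)%:C * det_invsqrt A * ekernel S3 x y.
Proof.
have [e e0 cA] := coerciveA.
pose u : 'cV[C]_q := L1^T *m cx x + L2 *m cx y.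
pose w : 'cV[C]_q := - (W *m u).
have Aw : A *m w = u.
  by rewrite /w AE mulNmx mulmxN opprK mulmxA mulmxV// mul1mx.
pose d := (((cx x)^T *m K1 *m cx x) 0 0 + ((cx y)^T *m M2 *m cx y) 0 0) / 2.
have E z : ekernel S1 x z * ekernel S2 z y = cexp d * ggauss A u z.
  rewrite /ekernel /ggauss -!cexpD; congr cexp.
  rewrite !half_form_block qform_mx lform_mx /d /A /u.
  rewrite bilinD (bilinN _ M1) (bilinN _ K2).
  rewrite [(_ + _)^T]linearD /= !trmx_mul trmxK mulmxDl addmx00.
  have -> : ((cx z)^T *m L1^T *m cx x) 0 0 = ((cx x)^T *m L1 *m cx z) 0 0.
    by rewrite -[RHS]trace_mx11 -mxtrace_tr !trmx_mul trmxK mulmxA trace_mx11.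
  have -> : ((cx y)^T *m L2^T *m cx z) 0 0 = ((cx z)^T *m L2 *m cx y) 0 0.
    by rewrite -[RHS]trace_mx11 -mxtrace_tr !trmx_mul trmxK mulmxA trace_mx11.
  by field; rewrite ?pnatr_eq0.
transitivity (cint (leb q) (fun t => cexp d * ggauss A u (col_of_tuple t))).
  by apply: eq_cint => t; exact: E.
have ig : cintegrable (leb q) (fun t => ggauss A u (col_of_tuple t)).
  have e4 : 0 < e / 4 by rewrite divr_gt0.
  have iB := rintegrableZ (expR (\sum_i (complex.Re (u i 0)) ^+ 2 / e))
    (rintegrable_gauss_weight q e4).
  apply: (cintegrable_le _ _ iB) => [|t]; last exact: normc_ggauss.
  by apply: cmeas_ggauss; exact: mcol_tuple.
rewrite cintZ// (cint_ggauss_det symA e0 cA Aw) mulrCA; congr (_ * _).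
rewrite -cexpD; congr cexp; rewrite half_form_block /d.
have -> : \sum_i u i 0 * w i 0 = - (u^T *m W *m u) 0 0.
  by rewrite -mulmxA -oppmx00 -mulmxN mxE; apply: eq_bigr => i _; rewrite [u^T _ _]mxE.
rewrite 2!bilinD 4!bilinN /u [(_ + _)^T]linearD /= !trmx_mul trmxK.
rewrite !(mulmxDl, mulmxDr) !addmx00 !mulmxA.
have E6 (a b c1 c2 c3 c4 : C) : (a + b) / 2 + - (c1 + c2 + (c3 + c4)) / 2 =
    (a - c1 - c3 - c2 + (b - c4)) / 2.
  by rewrite -mulrDl; congr (_ / _); ring.
exact: E6.
Qed.

(** The convolution integral inherits a Gaussian bound, and the constant in
    front of the composed kernel does not vanish. *)
Lemma gauss_dominated_composition : gauss_dominated S3.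
Proof.
have [c [e1 [e2 [c0 e10 e20 h]]]] := ekernel_mul_le
  (Re_negdef_gauss_dominated nS1) (Re_negdef_gauss_dominated nS2).
pose k := (Num.sqrt (2 * pi) ^+ q)%:C * det_invsqrt A.
have k0 : 0 < normc k.
  rewrite lt_neqAle normc_ge0 andbT eq_sym; apply/eqP => /eq0_normc/eqP.
  rewrite mulf_eq0 (negbTE det_invsqrt_neq0) orbF fmorph_eq0 expf_eq0.
  by rewrite sqrtr_eq0 leNgt mulr_gt0 ?pi_gt0// andbF.
have ia := rintegrable_gauss_weight q (addr_gt0 e10 e20).
pose I := \int[leb q]_t gauss_weight (e1 + e2) (col_of_tuple t).
have I0 : 0 <= I by apply: Rintegral_ge0 => t _; exact: gauss_weight_ge0.
exists ((normc k)^-1 * (2 * (c * I))), (Num.min e1 e2); split.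
  by rewrite lt_min e10.
move=> x y; rewrite -[X in _ <= X]mulrA ler_pdivlMl// -normcM.
rewrite /k -ekernel_convolution.
have iB := rintegrableZ (c * gauss_weight e1 x * gauss_weight e2 y) ia.
apply: le_trans (normc_cint _ _ iB) _.
- by apply: cmeasM; apply: cmeas_ekernel; (exact: mcol_cst || exact: mcol_tuple).
- by move=> t; rewrite mulrAC; exact: h.
- rewrite RintegralZl// -/I -[X in _ <= X]mulrA ler_wpM2l//.
  have -> : c * gauss_weight e1 x * gauss_weight e2 y * I =
    c * I * (gauss_weight e1 x * gauss_weight e2 y) by ring.
  rewrite ler_wpM2l ?mulr_ge0//; apply: ler_pM; rewrite ?gauss_weight_ge0//.
  + by apply: gauss_weight_le; rewrite ge_min lexx.
  + by apply: gauss_weight_le; rewrite ge_min lexx orbT.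
Qed.

End convolution.

End gaussian_composition.

(** * The composition of two operators *)

Section zak_pairing.
Variable R : realType.
Local Notation C := R[i].
Local Notation phase n := ('cV[R]_n * 'cV[R]_n)%type.
Local Notation T n := (n.-tuple (measurableTypeR R)).
Local Notation leb n := (@lebesgue_tuple R n).
Local Notation leb2 n := (sigma_product (leb n) (leb n)).
Local Notation cnt n := (@lattice_count n R).
Local Notation ex a := (cexp (0 +i* (a : R))).

Variables (q : nat) (H E : 'cV[R]_q -> C) (cH eH cE eE : R).
Hypothesis mH : cmeas (fun t : T q => H (col_of_tuple t)).
Hypothesis eH0 : 0 < eH.
Hypothesis hH : forall z, normc (H z) <= cH * gauss_weight eH z.
Hypothesis mE : cmeas (fun t : T q => E (col_of_tuple t)).
Hypothesis eE0 : 0 < eE.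
Hypothesis hE : forall z, normc (E z) <= cE * gauss_weight eE z.

(** The Weil-Brezin-Zak transform, which makes a decaying function
    quasi-periodic. *)
Definition zak (p : phase q) : C :=
  cint (cnt q) (fun j => ex (dotv (intv R j) p.2) * H (p.1 + period R j)).

Let eH2 : 0 < eH / 2. Proof. by rewrite divr_gt0. Qed.
Let eE2 : 0 < eE / 2. Proof. by rewrite divr_gt0. Qed.

Let cH0 : 0 <= cH.
Proof.
by have := le_trans (normc_ge0 _) (hH 0); rewrite pmulr_lge0 ?gauss_weight_gt0.
Qed.

Let cE0 : 0 <= cE.
Proof.
by have := le_trans (normc_ge0 _) (hE 0); rewrite pmulr_lge0 ?gauss_weight_gt0.
Qed.

Let H_shift (y : 'cV[R]_q) (j : 'cV[int]_q) : normc (H (y + period R j)) <=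
  (cH * expR (eH * sqnorm y)) * gauss_weight (eH / 2) (period R j).
Proof.
apply: le_trans (hH _) _; rewrite -mulrA ler_wpM2l//.
exact: gauss_weight_shift (ltW eH0).
Qed.

Let iHj (y : 'cV[R]_q) : rintegrable (cnt q) (fun j =>
  (cH * expR (eH * sqnorm y)) * gauss_weight (eH / 2) (period R j)).
Proof. exact: rintegrableZ (rintegrable_lattice q eH2). Qed.

Let cintegrable_zak p : cintegrable (cnt q)
  (fun j => ex (dotv (intv R j) p.2) * H (p.1 + period R j)).
Proof.
apply: (cintegrable_le _ _ (iHj p.1)) => // j.
by rewrite normcM normc_ex mul1r; exact: H_shift.
Qed.

(** Integrated against a character, the series of [zak] keeps a single term. *)
Lemma zak_fourier (y : 'cV[R]_q) (l : 'cV[int]_q) :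
  cint (leb q) (fun t => (chi t)%:C *
    (ex (- dotv (intv R l) (col_of_tuple t)) * zak (y, col_of_tuple t))) =
  ((2 * pi) ^+ q)%:C * H (y + period R l).
Proof.
have dotvNl u : dotv (intv R (- l)) u = - dotv (intv R l) u.
  rewrite -[RHS]mulN1r -dotvZl scaleN1r; congr dotv.
  exact: (map_mxN intr).
pose F (z : T q * lattice q) : C := (chi z.1)%:C *
  (ex (dotv (intv R (z.2 - l : 'cV[int]_q)) (col_of_tuple z.1)) *
   H (y + period R z.2)).
have mF : cmeas F.
  apply: cmeasM.
    apply/cmeas_real/(measurableT_comp (@measurable_chi R q)).
    exact: measurable_fst.
  apply: cmeasM.
  - apply: cmeas_ex_dotv; last first.
      exact: (mcol_comp (@mcol_tuple R q) measurable_fst).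
    have mk : mcol (fun j : lattice q => intv R (j - l : 'cV[int]_q)).
      by move=> i; exact: measurable_lattice.
    exact: (mcol_comp mk measurable_snd).
  - exact: (cmeas_comp (@cmeas_lattice q R (fun j => H (y + period R j)))
      measurable_snd).
have hF t j : normc (F (t, j)) <=
    chi t * ((cH * expR (eH * sqnorm y)) * gauss_weight (eH / 2) (period R j)).
  rewrite /F normcM normc_real ger0_norm ?chi_ge0// ler_wpM2l ?chi_ge0//.
  by rewrite normcM normc_ex mul1r; exact: H_shift.
have j0 (j : lattice q) :
    0 <= (cH * expR (eH * sqnorm y)) * gauss_weight (eH / 2) (period R j).
  by rewrite mulr_ge0 ?gauss_weight_ge0// mulr_ge0 ?expR_ge0.
have sw := cint_swap (@rintegrable_chi R q) (iHj y) (@chi_ge0 R q) j0 mF hF.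
transitivity (cint (leb q) (fun t => cint (cnt q) (fun j => F (t, j)))).
  apply: eq_cint => t; rewrite mulrA /zak -cintZ//; apply: eq_cint => j.
  by rewrite /F /= intvD dotvDl dotvNl exD; ring.
have ichar (k : 'cV[int]_q) : cintegrable (leb q)
    (fun t => (chi t)%:C * ex (dotv (intv R k) (col_of_tuple t))).
  apply: (cintegrable_le _ _ (@rintegrable_chi R q)) => [|t].
    apply: cmeasM; first by apply: cmeas_real; exact: measurable_chi.
    by apply: cmeas_ex_dotv; [exact: mcol_cst|exact: mcol_tuple].
  by rewrite normcM normc_ex mulr1 normc_real ger0_norm ?chi_ge0.
rewrite sw (@cint_lattice_single _ _ _ l) => [|j jl].
  under eq_cint => t.
    rewrite /F /= mulrA mulrC; over.
  by rewrite (cintZ _ (ichar _)) cint_cube_exp subrr eqxx mulrC.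
under eq_cint => t.
  rewrite /F /= mulrA mulrC; over.
rewrite (cintZ _ (ichar _)) cint_cube_exp subr_eq0 ifN ?mulr0//; exact/eqP.
Qed.

Hypothesis cz : ccont zak.
Variable c : C.

Let cintegrable_zak_fourier (y : 'cV[R]_q) (l : 'cV[int]_q) :
  cintegrable (leb q) (fun t => (chi t)%:C *
    (ex (- dotv (intv R l) (col_of_tuple t)) * zak (y, col_of_tuple t))).
Proof.
have iB := rintegrableZ (2 * (\int[cnt q]_j (cH * expR (eH * sqnorm y) *
  gauss_weight (eH / 2) (period R j)))) (@rintegrable_chi R q).
apply: (cintegrable_le _ _ iB) => [|t].
- apply: cmeasM; first by apply: cmeas_real; exact: measurable_chi.
  apply: cmeasM.
  + apply/cmeas_cexp/cmeas_imag/measurable_funN/measurable_dotv.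
      exact: mcol_cst.
    exact: mcol_tuple.
  + have [c1 c2] := cz; split.
    * exact: (measurable_continuous_phase c1 (mcol_cst y) (@mcol_tuple R q)).
    * exact: (measurable_continuous_phase c2 (mcol_cst y) (@mcol_tuple R q)).
- rewrite normcM normc_real ger0_norm ?chi_ge0// mulrC ler_wpM2r ?chi_ge0//.
  rewrite normcM normc_ex mul1r.
  apply: normc_cint => // j.
  by rewrite normcM normc_ex mul1r; exact: H_shift.
Qed.

Let F (t : (T q * T q) * lattice q) : C :=
  E (src_point t) * src_amp zak c t.

Let cmeas_shift (f : 'cV[R]_q -> C) l : cmeas (fun t : T q => f (col_of_tuple t)) ->
  cmeas (fun t : T q => f (col_of_tuple t + period R l)).
Proof.
move=> mf; under eq_fun do rewrite -col_shift.
exact: (cmeas_comp mf (measurable_shift_tuple _)).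
Qed.

Let mF : cmeas F.
Proof.
apply: cmeasM; last exact: cmeas_src_amp.
have m1 : cmeas (fun z : lattice q * T q => E (col_of_tuple z.2 + period R z.1)).
  by apply: cmeas_lattice_prod => l; exact: cmeas_shift.
apply: (cmeas_comp (f := fun z : lattice q * T q =>
  E (col_of_tuple z.2 + period R z.1)) (g := fun t => (t.2, t.1.1)) m1).
apply: measurable_fun_pair; first exact: measurable_snd.
exact: (measurableT_comp measurable_fst measurable_fst).
Qed.

(** Unfolding the cube integral against a Zak transform: orthogonality of the
    characters selects the diagonal, and the cubes tile the space. *)
Lemma zak_pairing : cint (src_measure R q) F =
  (c * ((2 * pi) ^+ q)%:C) *
  cint (leb q) (fun t => E (col_of_tuple t) * H (col_of_tuple t)).
Proof.
have [K K0 hK] := src_amp_le cz c (ltW eE0).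
have cK0 : 0 <= cE * K by rewrite mulr_ge0.
have hF w l : normc (F (w, l)) <=
    (cE * K * (chi w.1 * chi w.2)) * gauss_weight (eE / 2) (period R l).
  rewrite /F normcM; have := ler_wpM2r (normc_ge0 (src_amp zak c (w, l))) (hE (src_point (w, l))).
  move=> /le_trans; apply; rewrite -!mulrA ler_wpM2l//.
  by have := hK (w, l); rewrite -!mulrA.
have iC := rintegrableZ (cE * K) (@rintegrable_chi2 R q).
have C0 (w : T q * T q) : 0 <= cE * K * (chi w.1 * chi w.2).
  by rewrite mulr_ge0// mulr_ge0 ?chi_ge0.
have iL := rintegrable_lattice q eE2.
have L0 (l : lattice q) : 0 <= gauss_weight (eE / 2) (period R l).
  exact: gauss_weight_ge0.
transitivity (cint (leb2 q) (fun w => cint (cnt q) (fun l => F (w, l)))).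
  exact: (cint_fubini1 iC iL C0 L0 mF hF).
pose I := \int[cnt q]_l gauss_weight (eE / 2) (period R l).
have I0 : 0 <= I by apply: Rintegral_ge0.
have mF1 := cmeas_cint1 iC iL C0 L0 mF hF.
have i1 := rintegrableZ (2 * I * (cE * K)) (@rintegrable_chi R q).
have k1 (y : T q) : 0 <= 2 * I * (cE * K) * chi y.
  by rewrite !mulr_ge0 ?chi_ge0.
have hF1 y u : normc (cint (cnt q) (fun l => F ((y, u), l))) <=
    2 * I * (cE * K) * chi y * chi u.
  have := normc_cint1 iL mF hF (y, u).
  by move=> /le_trans; apply; rewrite le_eqVlt -/I /=; apply/orP; left; apply/eqP; ring.
transitivity (cint (leb q) (fun y => cint (leb q) (fun u =>
    cint (cnt q) (fun l => F ((y, u), l))))).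
  exact: (cint_fubini1 i1 (@rintegrable_chi R q) k1 (@chi_ge0 R q) mF1 hF1).
pose f z := c * ((2 * pi) ^+ q)%:C * (E z * H z).
(* the integral in the dual variable selects the term of index [l] *)
transitivity (cint (leb q) (fun y => cint (cnt q) (fun l =>
    (chi y)%:C * f (col_of_tuple y + period R l)))).
  apply: eq_cint => y.
  pose Fy (z : T q * lattice q) := F ((y, z.1), z.2).
  have mFy : cmeas Fy.
    apply: (cmeas_comp mF); apply: measurable_fun_pair; last exact: measurable_snd.
    by apply: measurable_fun_pair; [exact: measurable_cst|exact: measurable_fst].
  have hFy u l : normc (Fy (u, l)) <=
      (cE * K * chi y * chi u) * gauss_weight (eE / 2) (period R l).
    by rewrite -[cE * K * _ * _]mulrA; exact: hF.
  have iy := rintegrableZ (cE * K * chi y) (@rintegrable_chi R q).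
  have y0 (u : T q) : 0 <= cE * K * chi y * chi u by rewrite !mulr_ge0 ?chi_ge0.
  rewrite (cint_swap iy iL y0 L0 mFy hFy).
  apply: eq_cint => l.
  transitivity (cint (leb q) (fun t => ((chi y)%:C * (c * E (col_of_tuple y + period R l))) *
      ((chi t)%:C * (ex (- dotv (intv R l) (col_of_tuple t)) *
        zak (col_of_tuple y, col_of_tuple t))))).
    apply: eq_cint => t; rewrite /Fy /F /src_point /src_amp /cut /cols /=.
    by rewrite rmorphM; ring.
  by rewrite cintZ// zak_fourier /f; ring.
have mf : cmeas (fun t : T q => f (col_of_tuple t)).
  by apply: cmeasM; [exact: cmeas_cst|exact: cmeasM].
pose B := normc (c * ((2 * pi) ^+ q)%:C) * (cE * cH).
have B0 : 0 <= B by rewrite !mulr_ge0 ?normc_ge0.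
have hf z : normc (f z) <= B * gauss_weight eE z.
  rewrite /f normcM /B -[X in _ <= X]mulrA ler_wpM2l ?normc_ge0// normcM.
  have h1 := ler_pM (normc_ge0 _) (normc_ge0 _) (hE z) (hH z).
  apply: le_trans h1 _; rewrite mulrACA ler_wpM2l ?mulr_ge0//.
  by rewrite ler_piMr ?gauss_weight_ge0// gauss_weight_le1// ltW.
pose G (z : T q * lattice q) := (chi z.1)%:C * f (col_of_tuple z.1 + period R z.2).
have mG : cmeas G.
  have m1 : cmeas (fun z : lattice q * T q =>
      (chi z.2)%:C * f (col_of_tuple z.2 + period R z.1)).
    apply: cmeas_lattice_prod => l; apply: cmeasM; last exact: cmeas_shift.
    by apply: cmeas_real; exact: measurable_chi.
  apply: (cmeas_comp (g := fun t : T q * lattice q => (t.2, t.1)) m1).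
  by apply: measurable_fun_pair; [exact: measurable_snd|exact: measurable_fst].
pose D := B * expR (eE * (q%:R * (2 * pi) ^+ 2)).
have D0 : 0 <= D by rewrite mulr_ge0 ?expR_ge0.
have hG y l : normc (G (y, l)) <=
    (D * chi y) * gauss_weight (eE / 2) (period R l).
  rewrite /G normcM normc_real ger0_norm ?chi_ge0//=.
  have [->|[cy ->]] := chi_cube y; first by rewrite mulr0 !mul0r.
  rewrite mul1r mulr1; apply: le_trans (hf _) _; rewrite /D -mulrA ler_wpM2l//.
  apply: le_trans (gauss_weight_shift _ _ (ltW eE0)) _.
  rewrite ler_wpM2r ?gauss_weight_ge0// ler_expR ler_wpM2l ?sqnorm_cube//.
  exact: ltW.
have Dy0 (y : T q) : 0 <= D * chi y by rewrite mulr_ge0 ?chi_ge0.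
rewrite (cint_swap (rintegrableZ D (@rintegrable_chi R q)) iL Dy0 L0 mG hG).
rewrite -(cint_tile mf eE0 hf) /f cintZ//.
have iB := rintegrableZ (cE * cH) (rintegrable_gauss_weight q eE0).
apply: (cintegrable_le _ _ iB) => [|t]; first exact: cmeasM.
rewrite normcM.
have h1 := ler_pM (normc_ge0 _) (normc_ge0 _) (hE (col_of_tuple t)) (hH (col_of_tuple t)).
apply: le_trans h1 _; rewrite mulrACA ler_wpM2l ?mulr_ge0//.
by rewrite ler_piMr ?gauss_weight_ge0// gauss_weight_le1// ltW.
Qed.

End zak_pairing.

Section composition.
Variable R : realType.
Local Notation C := R[i].
Local Notation phase n := ('cV[R]_n * 'cV[R]_n)%type.
Local Notation T n := (n.-tuple (measurableTypeR R)).
Local Notation leb n := (@lebesgue_tuple R n).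

Definition op_cst (m n : nat) : C := (((2 * pi) `^ (3 * (n + m)%:R / 4))^-1)%:C.

(** Two normalizations contribute [3 q / 2] powers of [2 pi] too many in the
    denominator; [q] of them are compensated by the orthogonality of characters
    and [q / 2] by the Gaussian integral. *)
Lemma op_cst_mul m q n :
  op_cst m q * ((2 * pi) ^+ q)%:C * (Num.sqrt (2 * pi) ^+ q)%:C * op_cst q n =
  op_cst m n.
Proof.
rewrite /op_cst -!rmorphM /=; congr (_%:C).
have a0 : 0 < 2 * pi :> R by rewrite mulr_gt0// pi_gt0.
move: (2 * pi) a0 => a a0.
have an0 : a != 0 by rewrite gt_eqF.
rewrite -powR12_sqrt ?ltW// -!powR_mulrn ?powR_ge0 ?ltW// -powRrM -!powRN.
rewrite -!powRD ?an0 ?implybT//.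
by congr (_ `^ _); rewrite !natrD; lra.
Qed.

Lemma src_ampZ n (g : phase n -> C) (a b : C) t :
  src_amp g (a * b) t = a * src_amp g b t.
Proof. by rewrite /src_amp; ring. Qed.

Lemma Qop_transform m n (S : 'M[C]_(m + n)) (g : phase n -> C) :
  gauss_dominated S -> ccont g ->
  Qop S g = theta_transform S (src_measure R n) (@src_point R n)
    (src_amp g (op_cst m n)).
Proof.
move=> gS cg; rewrite -[op_cst m n]mulr1 -(kernel_op_transform 1 gS cg) /Qop.
have -> : (fun p w => 1 * theta_kernel S p w) = theta_kernel S.
  by apply/funext => p; apply/funext => w; rewrite mul1r.
by [].
Qed.

Lemma theta_space_Qop m n (S : 'M[C]_(m + n)) (g : phase n -> C) :
  gauss_dominated S -> ccont g -> theta_space (Qop S g).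
Proof.
move=> gS cg; rewrite Qop_transform//; apply: theta_space_transform => //.
- exact: mcol_src_point.
- exact: cmeas_src_amp.
- by move=> e e0; exact: rintegrable_src.
Qed.

Variables (m q n : nat).
Variables (K1 : 'M[C]_m) (L1 : 'M[C]_(m, q)) (M1 : 'M[C]_q).
Variables (K2 : 'M[C]_q) (L2 : 'M[C]_(q, n)) (M2 : 'M[C]_n).
Let S1 : 'M[C]_(m + q) := block_mx K1 L1 L1^T M1.
Let S2 : 'M[C]_(q + n) := block_mx K2 L2 L2^T M2.
Hypothesis sS1 : symmetric_mx S1.
Hypothesis nS1 : Re_negdef S1.
Hypothesis sS2 : symmetric_mx S2.
Hypothesis nS2 : Re_negdef S2.
Let W := invmx (M1 + K2).
Let S3 : 'M[C]_(m + n) :=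
  block_mx (K1 - L1 *m W *m L1^T) (- (L1 *m W *m L2))
           (- (L2^T *m W *m L1^T)) (M2 - L2^T *m W *m L2).
Variable g : phase n -> C.
Hypothesis cg : ccont g.

Let gS1 : gauss_dominated S1. Proof. exact: Re_negdef_gauss_dominated. Qed.
Let gS2 : gauss_dominated S2. Proof. exact: Re_negdef_gauss_dominated. Qed.
Let gS3 : gauss_dominated S3. Proof. exact: gauss_dominated_composition. Qed.

Let s := @src_point R n.
Let G c := src_amp g c.
Let nu := src_measure R n.

Let ms : mcol s. Proof. exact: mcol_src_point. Qed.
Let mG c : cmeas (G c). Proof. exact: cmeas_src_amp. Qed.
Let iG c e : 0 < e -> rintegrable nu (fun t => gauss_weight e (s t) * normc (G c t)).
Proof. by move=> e0; exact: rintegrable_src. Qed.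

(** Fubini's theorem and [ekernel_convolution]. *)
Let source_composition c x :
  cint (leb q) (fun t => ekernel S1 x (col_of_tuple t) *
    source_integral S2 nu s (G c) (col_of_tuple t)) =
  (Num.sqrt (2 * pi) ^+ q)%:C * det_invsqrt (- M1 - K2) *
    source_integral S3 nu s (G c) x.
Proof.
have [k1 [e1 [e2 [k10 e10 e20 hK]]]] := ekernel_mul_le gS1 gS2.
pose F (z : T q * ((T n * T n) * lattice n)) :=
  ekernel S1 x (col_of_tuple z.1) * (ekernel S2 (col_of_tuple z.1) (s z.2) * G c z.2).
have mF : cmeas F.
  have mc : mcol (fun z : T q * ((T n * T n) * lattice n) => col_of_tuple z.1).
    exact: (mcol_comp (@mcol_tuple R q) measurable_fst).
  apply: cmeasM; first by apply: cmeas_ekernel => //; exact: mcol_cst.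
  apply: cmeasM; last exact: (cmeas_comp (mG c) measurable_snd).
  by apply: cmeas_ekernel => //; exact: (mcol_comp ms measurable_snd).
pose k := k1 * gauss_weight e1 x.
have k0 : 0 <= k by rewrite mulr_ge0 ?gauss_weight_ge0.
have ia := rintegrableZ k (rintegrable_gauss_weight q (addr_gt0 e10 e20)).
have a0 (t : T q) : 0 <= k * gauss_weight (e1 + e2) (col_of_tuple t).
  by rewrite mulr_ge0 ?gauss_weight_ge0.
have b0 t : 0 <= gauss_weight e2 (s t) * normc (G c t).
  by rewrite mulr_ge0 ?gauss_weight_ge0 ?normc_ge0.
have hF t w : normc (F (t, w)) <= k * gauss_weight (e1 + e2) (col_of_tuple t) *
    (gauss_weight e2 (s w) * normc (G c w)).
  have -> : F (t, w) = ekernel S1 x (col_of_tuple t) *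
      ekernel S2 (col_of_tuple t) (s w) * G c w by rewrite /F mulrA.
  by rewrite normcM [X in _ <= X]mulrA ler_wpM2r ?normc_ge0.
transitivity (cint (leb q) (fun t => cint nu (fun w => F (t, w)))).
  apply: eq_cint => t; rewrite /source_integral -cintZ//.
  exact: (cintegrable_source ms (mG c) (@iG c) gS2).
rewrite (cint_swap ia (iG c e20) a0 b0 mF hF) /source_integral -cintZ; last first.
  exact: (cintegrable_source ms (mG c) (@iG c) gS3).
apply: eq_cint => w.
rewrite mulrA -(ekernel_convolution sS1 nS1 sS2 nS2) mulrC.
have iE : cintegrable (leb q) (fun t => ekernel S1 x (col_of_tuple t) *
    ekernel S2 (col_of_tuple t) (s w)).
  have iB := rintegrableZ (k * gauss_weight e2 (s w))
    (rintegrable_gauss_weight q (addr_gt0 e10 e20)).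
  apply: (cintegrable_le _ _ iB) => [|t].
    by apply: cmeasM; apply: cmeas_ekernel; (exact: mcol_cst || exact: mcol_tuple).
  by rewrite mulrAC; exact: hK.
by rewrite -cintZ//; apply: eq_cint => t; rewrite /F /=; ring.
Qed.

(** [Qop S2 g] is the Zak transform of a source integral, so that [zak_pairing]
    turns the cube integral of [Qop S1] into an integral over the whole space. *)
Lemma Qop_composition : Qop S1 (Qop S2 g) =
  kernel_op (fun p w => det_invsqrt (- M1 - K2) * theta_kernel S3 p w) g.
Proof.
have ts := theta_space_Qop gS2 cg; have cQ := ccont_theta_space ts.
rewrite kernel_op_transform// Qop_transform//.
apply/funext => p.
rewrite (theta_transform_sum ms (mG _) (@iG _) gS3).
rewrite (theta_transform_sum (@mcol_src_point R q) (cmeas_src_amp cQ _)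
  (fun e e0 => rintegrable_src cQ _ e0) gS1).
apply: eq_cint => k; congr (_ * _); set x := p.1 + _.
set H := source_integral S2 nu s (G (op_cst q n)).
have QE : Qop S2 g = zak H.
  apply/funext => w; rewrite Qop_transform//.
  exact: (theta_transform_sum ms (mG _) (@iG _) gS2).
have mH : cmeas (fun t : T q => H (col_of_tuple t)).
  exact: (cmeas_source_integral ms (mG _) (@iG _) gS2).
have [cH [eH [eH0 hH]]] := source_integral_le ms (mG (op_cst q n)) (@iG _) gS2.
have [c1 [e1 [e10 h1]]] := gS1.
have mE : cmeas (fun t : T q => ekernel S1 x (col_of_tuple t)).
  by apply: cmeas_ekernel; [exact: mcol_cst|exact: mcol_tuple].
have hE z : normc (ekernel S1 x z) <= (c1 * gauss_weight e1 x) * gauss_weight e1 z.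
  by rewrite -mulrA; exact: h1.
rewrite QE in cQ *.
have := zak_pairing mH eH0 hH mE e10 hE cQ (op_cst m q).
rewrite /source_integral => ->.
rewrite source_composition mulrA /source_integral -cintZ; last first.
  exact: (cintegrable_source ms (mG _) (@iG _) gS3).
set k1 := _ * _ * (_ * _).
have -> : (((2 * pi) `^ (3 * (n + m)%:R / 4))^-1)%:C * det_invsqrt (- M1 - K2) =
    k1 * op_cst q n.
  rewrite /k1 -[X in X * _ = _]/(op_cst m n) -(op_cst_mul m q n).
  by move: (op_cst m q) (op_cst q n) (det_invsqrt _) => a b d; ring.
by apply: eq_cint => t; rewrite /G src_ampZ mulrCA.
Qed.

End composition.

Unset Implicit Arguments.

Theorem proposition3p5 (R : realType) (m q n : nat)
    (K1 : 'M[R[i]]_m) (L1 : 'M[R[i]]_(m, q)) (M1 : 'M[R[i]]_q)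
    (K2 : 'M[R[i]]_q) (L2 : 'M[R[i]]_(q, n)) (M2 : 'M[R[i]]_n) :
  let S1 : 'M[R[i]]_(m + q) := block_mx K1 L1 L1^T M1 in
  let S2 : 'M[R[i]]_(q + n) := block_mx K2 L2 L2^T M2 in
  symmetric_mx S1 -> Re_negdef S1 ->
  symmetric_mx S2 -> Re_negdef S2 ->
  let W := invmx (M1 + K2) in
  let S3 : 'M[R[i]]_(m + n) :=
    block_mx (K1 - L1 *m W *m L1^T) (- (L1 *m W *m L2))
             (- (L2^T *m W *m L1^T)) (M2 - L2^T *m W *m L2) in
  let lambda := det_invsqrt (- M1 - K2) in
  let K3 := fun p w => lambda * theta_kernel S3 p w in
  forall g : 'cV[R]_n * 'cV[R]_n -> R[i], theta_space g ->
    [/\ theta_space (Qop S2 g), theta_space (Qop S1 (Qop S2 g)) &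
        Qop S1 (Qop S2 g) = kernel_op K3 g].
Proof.
move=> S1 S2 sS1 nS1 sS2 nS2 W S3 lambda K3 g /ccont_theta_space cg.
have gS1 : gauss_dominated S1 := Re_negdef_gauss_dominated nS1.
have gS2 : gauss_dominated S2 := Re_negdef_gauss_dominated nS2.
have tQ := theta_space_Qop gS2 cg.
split; [exact: tQ|exact: theta_space_Qop gS1 (ccont_theta_space tQ)|].
exact: (Qop_composition sS1 nS1 sS2 nS2 cg).
Qed.
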